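(* Let $d\ge 2$, let $x\in\mathbb R^d$, and suppose that $g:\mathbb R^d\to\mathbb R\cup\{-\infty\}$ is upper semicontinuous with $g(x)\in\mathbb R$ and $$g(y)<g(x)+C_1(1+|y-x|)\quad\text{for all } y\in\mathbb R^d.$$ Then there is a constant $C>0$, depending only on $C_1$, $K$, $\alpha$, $\beta$ and $|b-a|$ (and on $d$, and for $d=2$ on $\nu$), such that $$\operatorname{var}(u(t,x,\omega))\le C\,\frac{t}{\log t}\qquad\text{for all } t\ge 2.$$
   Context: Fix $d\ge2$ and real numbers $a<b$. Let $\Omega=\{a,b\}^{\mathbb Z^d}$ with the product probability measure $\mathbb P$ under which the coordinates $\omega_k$, $k\in\mathbb Z^d$, are i.i.d. with $\mathbb P(\omega_k=a)=\alpha\in(0,1)$ and $\mathbb P(\omega_k=b)=\beta=1-\alpha$. For $k\in\mathbb Z^d$ let $Q_k=k+[0,1)^d$ and define $V(x,\omega)=\sum_k\omega_k\mathbb I_{Q_k}(x)$ (so $V(x,\omega)=\omega_k$ for $x\in Q_k$). Let $K:\mathbb R^d\to[0,\infty)$ be convex with $K(0)=0$ and $K(z)/|z|\to\infty$ as $|z|\to\infty$; if $d=2$ assume moreover that for some $\nu>1$, $K(z)\ge|z|^\nu$ for all $z$ with $|z|<1/2$. For $t>0$ and $x\in\mathbb R^d$, let $\mathcal A_{t,x}=\{\gamma\in W^{1,\infty}([0,t];\mathbb R^d):\gamma(0)=x\}$, $\mathcal L(\gamma,\omega)=\int_0^t K(\gamma'(s))+V(\gamma(s),\omega)\,ds$,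 and $$u(t,x,\omega)=\sup_{\gamma\in\mathcal A_{t,x}}\big(g(\gamma(t))-\mathcal L(\gamma,\omega)\big).$$ The variance is taken with respect to $\mathbb P$. *)

(* Defs.v *)
From HB Require Import structures.
From mathcomp Require Import all_boot all_order all_algebra.
From mathcomp Require Import all_classical all_reals all_analysis.
Set Implicit Arguments. Unset Strict Implicit. Unset Printing Implicit Defensive.
Import Order.TTheory GRing.Theory Num.Theory.
Import numFieldNormedType.Exports.
Local Open Scope classical_set_scope.
Local Open Scope ring_scope.

Section Defs.
Variable R : realType.
Variable d : nat.

Definition enorm (z : 'rV[R]_d) : R := Num.sqrt (\sum_(i < d) z ord0 i ^+ 2).

Definition convex_fun (K : 'rV[R]_d -> R) : Prop :=
  forall (y z : 'rV[R]_d) (l : R), 0 <= l <= 1 ->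
    K (l *: y + (1 - l) *: z) <= l * K y + (1 - l) * K z.

Definition superlinear (K : 'rV[R]_d -> R) : Prop :=
  forall M : R, exists r : R, forall z, r < enorm z -> M < K z / enorm z.

Definition usc (g : 'rV[R]_d -> \bar R) : Prop :=
  forall y (M : R), (g y < M%:E)%E -> \forall z \near y, (g z < M%:E)%E.

(* the lattice site k with x \in Q_k = k + [0,1)^d *)
Definition cell (x : 'rV[R]_d) : 'rV[int]_d := \row_i Num.floor (x ord0 i).

(* the potential V(x, w) = sum_k om_k(w) 1_{Q_k}(x) = om_{cell x}(w) *)
Definition potential {T : Type} (om : 'rV[int]_d -> T -> R)
  (x : 'rV[R]_d) (w : T) : R := om (cell x) w.

(* W^{1,oo}([0,t]; R^d) paths (Lipschitz on [0,t]) starting from x *)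
Definition admissible (t : R) (x : 'rV[R]_d) (gam : R -> 'rV[R]_d) : Prop :=
  gam 0 = x /\
  exists L : R, forall s1 s2, 0 <= s1 <= t -> 0 <= s2 <= t ->
    enorm (gam s1 - gam s2) <= L * `|s1 - s2|.

Definition action {T : Type} (K : 'rV[R]_d -> R) (om : 'rV[int]_d -> T -> R)
  (t : R) (gam : R -> 'rV[R]_d) (w : T) : \bar R :=
  (\int[@lebesgue_measure R]_(s in `[0%R, t]%classic)
      ((K (derive1 gam s) + potential om (gam s) w)%:E))%E.

Definition value {T : Type} (K : 'rV[R]_d -> R) (om : 'rV[int]_d -> T -> R)
  (g : 'rV[R]_d -> \bar R) (t : R) (x : 'rV[R]_d) (w : T) : \bar R :=
  ereal_sup [set (g (gam t) - action K om t gam w)%E | gam in admissible t x].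

End Defs.

Definition mutually_independent {dT} {T : measurableType dT} {R : realType}
  (P : probability T R) {I : eqType} (X : I -> T -> R) : Prop :=
  forall (s : seq I) (B : I -> set R), uniq s -> (forall i, measurable (B i)) ->
    P (\bigcap_(i in [set i | i \in s]) (X i @^-1` B i)) =
    (\prod_(i <- s) P (X i @^-1` B i))%E.

(* Main.v *)
Require Import Defs.
From HB Require Import structures.
From mathcomp Require Import all_boot all_order all_algebra.
From mathcomp Require Import all_classical all_reals all_analysis.
From mathcomp Require Import measurable_realfun.
From mathcomp Require Import ring lra zify.
Set Implicit Arguments. Unset Strict Implicit. Unset Printing Implicit Defensive.
Import Order.TTheory GRing.Theory Num.Theory.
Import numFieldNormedType.Exports.
Local Open Scope ring_scope.

(** The horizon [t] is fixed, so a comparison of two environments must produce a path of exactly the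
    same duration. Time is the currency of the proof: straight crossings save it, and free waiting
    in a good cell absorbs it. A cell can escape the O(1) bound on its influence only when it is the
    sole good cell that the path meets, which leaves nowhere else to wait. A good cell at distance
    [rho] then gives O(rho), and [rho] of order sqrt t is the largest radius whose square is still
    O(t).

    Translations have to act on a finite product space. The cells are therefore labelled modulo N,
    with N large in terms of [t]; no constant depends on N.

    The exponents are tied by two demands. The error m^2 = t^(2 theta) of the averaging must be O(t
    / ln t), so theta < 1/2. With Q the total influence of a box, lam * Q must be at most m^d. For Q
    of order t this forces d theta > 1, hence d >= 3. In dimension 2, a path that crosses a box
    cheaply visits only O(t^(1 - 1/(2 nu))) of its cells, and this gain is just what is missing. *)

(** The value at time t depends on finitely many cells, so it is a function of finitely
    many Bernoulli variables (good cells, where waiting is free, and bad ones).  Subtracting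
    from K a subgradient at 0 makes it nonnegative, so waiting in a good cell costs nothing.
    The Falik-Samorodnitsky inequality bounds Var f by
      [2 E(f) + lam * sum_i (E |D_i f|)^2] / ln lam,
    where D_i is the influence of cell i and E(f) the sum of the E |D_i f|^2.

    Along a near-optimal path the influence of a good cell is at most the time spent in it,
    whence sum_i E |D_i f| = O(t).  It is also O(1) for all cells but one: the visits to the
    cell can be compressed into a bounded time and the time saved spent in another good cell
    of the path.  For the exceptional cell one waits instead in a good cell near x, which
    with overwhelming probability exists at distance sqrt t.  Hence E(f) = O(t).

    To make each E |D_i f| small, f is averaged over translations of the environment by a box
    of side m = t^theta with theta < 1/2, as in Benjamini, Kalai and Schramm; this changes f
    by O(m) only, since time can be saved along a path to walk to its translate.  The
    averaged influences are m^-d times the influences of boxes: for d >= 3 the bound O(t) is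
    enough, and for d = 2 the lower bound on K limits the number of cells of a box that a
    path can visit.  Finally lam is a small power of t. *)

(** * Product measures on finite cubes *)

Definition xlnx {R : realType} (x : R) := x * ln x.

Lemma ln_sub1 {R : realType} (x : R) : 0 < x -> ln x <= x - 1.
Proof. move=> x0; have := @le_ln1Dx R (x - 1).
have -> : 1 + (x - 1) = x by ring.
by apply; lra. Qed.

(** The right side dominates the left because the left is the tangent at [y] to the convex function
    [xlnx]. *)
Lemma xlnx_ge {R : realType} (x y : R) : 0 <= x -> 0 < y -> x * ln y + x - y <= xlnx x.
Proof.
rewrite le_eqVlt => /predU1P[<- y0|x0 y0]; first by rewrite /xlnx !mul0r; lra.
have : ln (y / x) <= y / x - 1 by apply: ln_sub1; rewrite divr_gt0.
rewrite ln_div ?posrE// -(ler_pM2l x0) !mulrBr mulr1 mulrCA divff ?gt_eqF// mulr1.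
by rewrite /xlnx; lra.
Qed.

Section ProductSpace.
Variables (R : realType) (I : finType) (al : R).
Hypotheses (al0 : 0 < al) (al1 : al < 1).
Local Ltac plra := move: (al0) (al1) => ? ?; lra.
Local Ltac pnra := move: (al0) (al1) => ? ?; nra.
Local Notation conf := {ffun I -> bool}.
Implicit Types (f g : conf -> R) (c : conf) (i j : I).

Definition upd c i b : conf := [ffun k => if k == i then b else c k].
Definition wgt (b : bool) : R := if b then al else 1 - al.
Definition weight c : R := \prod_i wgt (c i).
Definition expect f : R := \sum_c weight c * f c.
Definition avg i f : conf -> R := fun c => al * f (upd c i true) + (1 - al) * f (upd c i false).
Definition infl i f : conf -> R := fun c => f (upd c i true) - f (upd c i false).

Lemma updE c i b : upd c i b i = b. Proof. by rewrite ffunE eqxx. Qed.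
Lemma updN c i b j : j != i -> upd c i b j = c j.
Proof. by rewrite ffunE => /negbTE ->. Qed.
Lemma upd_id c i : upd c i (c i) = c.
Proof. by apply/ffunP => k; rewrite ffunE; case: eqP => [->|]. Qed.
Lemma updK c i b b' : upd (upd c i b) i b' = upd c i b'.
Proof. by apply/ffunP => k; rewrite !ffunE; case: eqP. Qed.
Lemma updC c i j b b' : i != j -> upd (upd c i b) j b' = upd (upd c j b') i b.
Proof.
move=> ij; apply/ffunP => k; rewrite !ffunE; case: (k =P j) => [->|//].
by rewrite eq_sym (negbTE ij).
Qed.

Lemma wgt_gt0 b : 0 < wgt b. Proof. by rewrite /wgt; case: b => /=; plra. Qed.
Lemma weight_gt0 c : 0 < weight c.
Proof. by apply: prodr_gt0 => i _; exact: wgt_gt0. Qed.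

Lemma sum_pair i (phi : conf -> R) :
  \sum_c phi c = \sum_(c : conf | c i) (phi c + phi (upd c i false)).
Proof.
rewrite (bigID (fun c : conf => c i)) /= big_split /=; congr (_ + _).
rewrite (reindex_onto (fun c => upd c i false) (fun c => upd c i true)) /=.
  apply: eq_bigl => c; rewrite updE /= updK.
  apply/eqP/idP => [<-|ci]; first by rewrite updE.
  by rewrite -[RHS](upd_id c i) ci.
by move=> c ci; rewrite updK -[RHS](upd_id c i) (negbTE ci).
Qed.

Lemma weight_upd i b c : weight (upd c i b) = wgt b * \prod_(j | j != i) wgt (c j).
Proof.
rewrite /weight (bigD1 i) //= updE; congr (_ * _).
by apply: eq_bigr => j ji; rewrite updN.
Qed.

Lemma expect_avg i f : expect (avg i f) = expect f.
Proof.
rewrite /expect !(sum_pair i); apply: eq_bigr => c ci.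
rewrite /avg !updK.
have -> : upd c i true = c by rewrite -{2}(upd_id c i) ci.
have -> : weight c = wgt true * \prod_(j | j != i) wgt (c j).
  by rewrite -[in LHS](upd_id c i) weight_upd ci.
rewrite weight_upd /wgt; ring.
Qed.

Lemma eq_expect f g : f =1 g -> expect f = expect g.
Proof. by move=> fg; apply: eq_bigr => c _; rewrite fg. Qed.
Lemma expectD f g : expect (fun c => f c + g c) = expect f + expect g.
Proof. by rewrite /expect -big_split; apply: eq_bigr => c _; rewrite mulrDr. Qed.
Lemma expectZ a f : expect (fun c => a * f c) = a * expect f.
Proof. by rewrite /expect big_distrr; apply: eq_bigr => c _; rewrite mulrCA. Qed.
Lemma expectN f : expect (fun c => - f c) = - expect f.
Proof. by rewrite /expect -sumrN; apply: eq_bigr => c _; rewrite mulrN. Qed.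
Lemma expectB f g : expect (fun c => f c - g c) = expect f - expect g.
Proof. by rewrite -expectN -expectD. Qed.
Lemma expect_sum (J : Type) (s : seq J) (P : pred J) (F : J -> conf -> R) :
  expect (fun c => \sum_(j <- s | P j) F j c) = \sum_(j <- s | P j) expect (F j).
Proof.
rewrite /expect exchange_big; apply: eq_bigr => c _.
by rewrite big_distrr.
Qed.
Lemma le_expect f g : (forall c, f c <= g c) -> expect f <= expect g.
Proof. by move=> fg; apply: ler_sum => c _; rewrite ler_pM2l// weight_gt0. Qed.
Lemma expect_ge0 f : (forall c, 0 <= f c) -> 0 <= expect f.
Proof. by move=> f0; apply: sumr_ge0 => c _; rewrite mulr_ge0// ltW// weight_gt0. Qed.

Lemma sum_weight : \sum_c weight c = 1.
Proof.
rewrite /weight -(bigA_distr_bigA (fun (i : I) (b : bool) => wgt b)) big1// => i _.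
by rewrite big_bool /wgt /=; ring.
Qed.
Lemma expect_cst a : expect (fun=> a) = a.
Proof. by rewrite /expect -big_distrl /= sum_weight mul1r. Qed.

(** An influence does not see the state of its own cell. Its mean can thus be computed on the
    configurations where the cell is good, the only ones on which paths are compared, at the price
    of a factor [al^-1]. *)
Lemma expect_given i h : (forall c b, h (upd c i b) = h c) ->
  expect h = al^-1 * expect (fun c => if c i then h c else 0).
Proof.
move=> hi; rewrite -[in RHS](expect_avg i).
have E c : avg i (fun c => if c i then h c else 0) c = al * h c.
  by rewrite /avg !updE hi mulr0 addr0.
by rewrite (eq_expect E) expectZ mulKf// gt_eqF.
Qed.

Lemma expect_none (S : {set I}) :
  expect (fun c => [forall j in S, ~~ c j]%:R) = (1 - al) ^+ #|S|.
Proof.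
pose h i (b : bool) : R := if (i \in S) && b then 0 else 1.
have E c : weight c * [forall j in S, ~~ c j]%:R = \prod_i (wgt (c i) * h i (c i)).
  rewrite big_split /=; congr (_ * _).
  case: forallP => [H|/forallP]; rewrite /=.
    by rewrite big1// => i _; rewrite /h; have := H i; case: (i \in S) => //= /negbTE ->.
  rewrite negb_forall => /existsP[i]; rewrite negb_imply negbK => /andP[iS ci].
  by rewrite (bigD1 i)//= /h iS ci mul0r.
rewrite /expect (eq_bigr _ (fun c _ => E c)).
rewrite -(bigA_distr_bigA (fun i b => wgt b * h i b)).
rewrite -prodr_const [RHS]big_mkcond /=; apply: eq_bigr => i _.
by rewrite big_bool /h /wgt /=; case: (i \in S) => /=; ring.
Qed.

Definition avgs (s : seq I) f := foldl (fun h i => avg i h) f s.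

Lemma avg_upd i b f c : avg i f (upd c i b) = avg i f c.
Proof. by rewrite /avg !updK. Qed.
Lemma infl_avg i f c : infl i (avg i f) c = 0.
Proof. by rewrite /infl !avg_upd subrr. Qed.
Lemma infl_avgC i j f c : i != j -> infl i (avg j f) c = avg j (infl i f) c.
Proof.
move=> ij; rewrite /infl /avg.
rewrite !(updC _ _ _ ij); ring.
Qed.

(* [avg i] is an orthogonal projection *)
Lemma expect_sqr_avg i f :
  expect (fun c => (f c - avg i f c) ^+ 2)
  = expect (fun c => f c ^+ 2) - expect (fun c => avg i f c ^+ 2).
Proof.
rewrite -expectB -(expect_avg i) -[RHS](expect_avg i); apply: eq_expect => c.
by rewrite {1 3}/avg !avg_upd /avg; ring.
Qed.

Definition energy f : R := \sum_i expect (fun c => infl i f c ^+ 2).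

(** For i different from j the influence commutes with [avg j], which is an orthogonal projection,
    so Pythagoras applies; for i = j the averaged function has no influence. This is why the
    energies of martingale increments add up. *)
Lemma energy_sub_avg j f :
  energy (fun c => f c - avg j f c) = energy f - energy (avg j f).
Proof.
rewrite /energy -sumrB; apply: eq_bigr => i _.
have [->|ij] := eqVneq i j.
  rewrite -expectB; apply: eq_expect => c.
  have /eqP := infl_avg j f c; rewrite /infl subr_eq0 => /eqP ->.
  by rewrite subrr; ring.
rewrite -[in RHS](eq_expect (fun c => congr1 (fun x => x ^+ 2) (esym (infl_avgC f c ij)))).
rewrite -expect_sqr_avg; apply: eq_expect => c; congr (_ ^+ 2).
rewrite -infl_avgC// /infl; ring.
Qed.

Lemma expect_abs_avg_le j f : expect (fun c => `|avg j f c|) <= expect (fun c => `|f c|).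
Proof.
rewrite -[leRHS](expect_avg j); apply: le_expect => c; rewrite /avg.
apply: (le_trans (ler_normD _ _)); rewrite !normrM.
have e1 : `|al| = al by rewrite ger0_norm ?ltW.
have e2 : `|1 - al| = 1 - al by rewrite ger0_norm//; plra.
by rewrite e1 e2.
Qed.

Lemma expect_infl_avg i j f :
  expect (fun c => `|infl i (avg j f) c|) <= expect (fun c => `|infl i f c|).
Proof.
have [->|ij] := eqVneq i j.
  rewrite (@eq_expect _ (fun=> 0)) ?expect_cst ?expect_ge0// => c.
  by rewrite infl_avg normr0.
rewrite (@eq_expect _ (fun c => `|avg j (infl i f) c|)); last first.
  by move=> c; rewrite infl_avgC.
exact: expect_abs_avg_le.
Qed.

Lemma expect_abs_sub_avg i f :
  expect (fun c => `|f c - avg i f c|) <= expect (fun c => `|infl i f c|).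
Proof.
apply: le_expect => c.
have : f c = f (upd c i (c i)) by rewrite upd_id.
rewrite /avg /infl => ->.
case: (c i).
  rewrite (_ : _ - _ = (1 - al) * (f (upd c i true) - f (upd c i false))); last by ring.
  by rewrite normrM ger0_norm ?ler_piMl//; plra.
rewrite (_ : _ - _ = - (al * (f (upd c i true) - f (upd c i false)))); last by ring.
by rewrite normrN normrM ger0_norm ?ler_piMl//; plra.
Qed.

(* From [ln u <= u - 1], the entropy of a two-point variable [X] is at most [Var X / E X]. *)
Lemma two_point_log_sobolev (x y : R) : 0 <= x -> 0 <= y ->
  al * xlnx (x ^+ 2) + (1 - al) * xlnx (y ^+ 2)
    - xlnx (al * x ^+ 2 + (1 - al) * y ^+ 2) <= 2 * (x - y) ^+ 2.
Proof.
move=> x0 y0; set v := al * x ^+ 2 + (1 - al) * y ^+ 2.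
have X0 : 0 <= al * x ^+ 2 by rewrite mulr_ge0 ?sqr_ge0//; plra.
have Y0 : 0 <= (1 - al) * y ^+ 2 by rewrite mulr_ge0 ?sqr_ge0//; plra.
have [v0|v0] := eqVneq v 0.
  have /eqP : x ^+ 2 = 0.
    have : al * x ^+ 2 = 0 by rewrite /v in v0; plra.
    by move=> /eqP; rewrite mulf_eq0 => /orP[/eqP|/eqP//]; plra.
  have /eqP : y ^+ 2 = 0.
    have : (1 - al) * y ^+ 2 = 0 by rewrite /v in v0; plra.
    by move=> /eqP; rewrite mulf_eq0 => /orP[/eqP|/eqP//]; plra.
  rewrite v0 !sqrf_eq0 => /eqP -> /eqP ->.
  by rewrite /xlnx expr0n /= !mul0r !mulr0 subrr expr0n /= mulr0; plra.
have {v0} v0 : 0 < v by rewrite lt_neqAle eq_sym v0 /v; plra.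
have up (z : R) : 0 <= z -> xlnx (z ^+ 2) <= z ^+ 2 * ln v + z ^+ 2 * (z ^+ 2 / v - 1).
  rewrite le_eqVlt => /predU1P[<-|z0].
    by rewrite /xlnx expr0n /= !mul0r addr0.
  rewrite /xlnx -mulrDr ler_wpM2l ?sqr_ge0//.
  have z2 : 0 < z ^+ 2 by rewrite exprn_gt0.
  have : ln (z ^+ 2 / v) <= z ^+ 2 / v - 1 by apply: ln_sub1; rewrite divr_gt0.
  by rewrite ln_div ?posrE//; plra.
have := up x x0; have := up y y0; move=> uy ux.
have : al * xlnx (x ^+ 2) <= al * (x ^+ 2 * ln v + x ^+ 2 * (x ^+ 2 / v - 1)).
  by rewrite ler_wpM2l//; plra.
have : (1 - al) * xlnx (y ^+ 2) <= (1 - al) * (y ^+ 2 * ln v + y ^+ 2 * (y ^+ 2 / v - 1)).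
  by rewrite ler_wpM2l//; plra.
move=> hy hx.
suff main : al * (x ^+ 2 * (x ^+ 2 / v - 1)) + (1 - al) * (y ^+ 2 * (y ^+ 2 / v - 1))
    <= 2 * (x - y) ^+ 2.
  have -> : xlnx v = al * (x ^+ 2 * ln v) + (1 - al) * (y ^+ 2 * ln v).
    by rewrite /xlnx /v; ring.
  by move: hy hx main; rewrite !mulrDr; plra.
have -> : al * (x ^+ 2 * (x ^+ 2 / v - 1)) + (1 - al) * (y ^+ 2 * (y ^+ 2 / v - 1))
   = (al * (1 - al) * (x + y) ^+ 2 * (x - y) ^+ 2) / v.
  have vn : v != 0 by rewrite gt_eqF.
  have -> : al * (x ^+ 2 * (x ^+ 2 / v - 1)) + (1 - al) * (y ^+ 2 * (y ^+ 2 / v - 1))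
    = (al * x ^+ 2 * x ^+ 2 + (1 - al) * y ^+ 2 * y ^+ 2 - v * v) / v.
    have -> : v * v = v * (al * x ^+ 2 + (1 - al) * y ^+ 2) by [].
    by field.
  by rewrite /v; congr (_ / _); ring.
(* Here [al * (1 - al) * (x + y) ^+ 2 <= 2 * v], so the constant 2 does not depend on [al]. *)
rewrite ler_pdivrMr// [leRHS]mulrAC ler_wpM2r ?sqr_ge0//.
have : (x + y) ^+ 2 <= 2 * x ^+ 2 + 2 * y ^+ 2.
  by have := sqr_ge0 (x - y); rewrite !expr2; plra.
have p0 : 0 <= al * (1 - al) by rewrite mulr_ge0//; plra.
move=> /(ler_wpM2l p0) /le_trans; apply.
have : 0 <= al ^+ 2 * x ^+ 2 by rewrite mulr_ge0 ?sqr_ge0.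
have : 0 <= (1 - al) ^+ 2 * y ^+ 2 by rewrite mulr_ge0 ?sqr_ge0.
rewrite -subr_ge0 -[in X in _ -> _ -> X]subr_ge0.
have -> : 2 * v - al * (1 - al) * (2 * x ^+ 2 + 2 * y ^+ 2)
  = 2 * (al ^+ 2 * x ^+ 2 + (1 - al) ^+ 2 * y ^+ 2) by rewrite /v; ring.
by rewrite subr0 => h1 h2; rewrite mulr_ge0// addr_ge0.
Qed.

(** The quadratic counterpart of [avg]: it averages [f ^+ 2] and returns to a root, so that the next
    coordinate again sees the entropy of a square. *)
Definition root_avg i f : conf -> R := fun c => Num.sqrt (avg i (fun c => f c ^+ 2) c).

Lemma avg_sqr_ge0 i f c : 0 <= avg i (fun c => f c ^+ 2) c.
Proof. by rewrite /avg addr_ge0// mulr_ge0 ?sqr_ge0//; plra. Qed.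

Lemma root_avg_sqr i f c : root_avg i f c ^+ 2 = avg i (fun c => f c ^+ 2) c.
Proof. by rewrite sqr_sqrtr// avg_sqr_ge0. Qed.

(** The reverse triangle inequality for the Euclidean norm with weights [al] and [1 - al], from
    Cauchy-Schwarz. It makes [root_avg] contract the influences in the other directions. *)
Lemma two_point_minkowski (x y x' y' : R) :
  (Num.sqrt (al * x ^+ 2 + (1 - al) * y ^+ 2)
    - Num.sqrt (al * x' ^+ 2 + (1 - al) * y' ^+ 2)) ^+ 2
  <= al * (x - x') ^+ 2 + (1 - al) * (y - y') ^+ 2.
Proof.
have H (a b : R) : 0 <= al * a ^+ 2 + (1 - al) * b ^+ 2.
  by rewrite addr_ge0// mulr_ge0 ?sqr_ge0//; plra.
rewrite sqrrB !sqr_sqrtr// -sqrtrM//.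
suff : al * (x * x') + (1 - al) * (y * y') <=
   Num.sqrt ((al * x ^+ 2 + (1 - al) * y ^+ 2) * (al * x' ^+ 2 + (1 - al) * y' ^+ 2)).
  by rewrite !sqrrB mulr2n; plra.
apply: (le_trans (ler_norm _)); rewrite -sqrtr_sqr ler_wsqrtr//.
rewrite -subr_ge0 (_ : _ - _ = al * (1 - al) * (x * y' - y * x') ^+ 2); last by ring.
by rewrite mulr_ge0 ?sqr_ge0// mulr_ge0//; plra.
Qed.

Lemma expect_infl_root_avg i j f :
  expect (fun c => infl i (root_avg j f) c ^+ 2) <= expect (fun c => infl i f c ^+ 2).
Proof.
have [->|ij] := eqVneq i j.
  rewrite (@eq_expect _ (fun=> 0)) ?expect_cst ?expect_ge0// => c; first exact: sqr_ge0.
  by rewrite /infl /root_avg /avg !updK subrr expr0n.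
rewrite -[leRHS](expect_avg j); apply: le_expect => c.
rewrite /infl /root_avg /avg; rewrite !(updC _ _ _ ij).
exact: two_point_minkowski.
Qed.

Definition entropy f := expect (fun c => xlnx (f c)) - xlnx (expect f).

Definition root_avgs (s : seq I) f := foldl (fun h i => root_avg i h) f s.

(** Tensorisation: each [root_avg] loses the mean of a two-point entropy, and it does not raise the
    energies of the coordinates still to come. *)
Lemma expect_xlnx_root_avgs (s : seq I) f : uniq s -> (forall c, 0 <= f c) ->
  expect (fun c => xlnx (f c ^+ 2)) - expect (fun c => xlnx (root_avgs s f c ^+ 2))
   <= 2 * \sum_(i <- s) expect (fun c => infl i f c ^+ 2).
Proof.
elim: s f => [|i s IH] f /=; first by rewrite big_nil subrr mulr0.
move=> /andP[nis us] f0; rewrite big_cons.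
have g0 c : 0 <= root_avg i f c by exact: sqrtr_ge0.
have {IH} := IH _ us g0.
have -> : expect (fun c => xlnx (root_avgs s (root_avg i f) c ^+ 2))
   = expect (fun c => xlnx (root_avgs (i :: s) f c ^+ 2)) by [].
have h1 : expect (fun c => xlnx (f c ^+ 2)) - expect (fun c => xlnx (root_avg i f c ^+ 2))
   <= 2 * expect (fun c => infl i f c ^+ 2).
  rewrite -(expect_avg i) -expectB -expectZ; apply: le_expect => c.
  rewrite root_avg_sqr /avg /infl.
  exact: two_point_log_sobolev.
have h2 : \sum_(j <- s) expect (fun c => infl j (root_avg i f) c ^+ 2)
   <= \sum_(j <- s) expect (fun c => infl j f c ^+ 2).
  by apply: ler_sum => j _; exact: expect_infl_root_avg.
rewrite /=; plra.
Qed.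

Lemma expect_root_avgs s f :
  expect (fun c => root_avgs s f c ^+ 2) = expect (fun c => f c ^+ 2).
Proof.
elim: s f => //= i s IH f; rewrite IH.
by rewrite -[RHS](expect_avg i); apply: eq_expect => c; rewrite root_avg_sqr.
Qed.

Lemma upd_invariant_cst (f : conf -> R) :
  (forall i b c, f (upd c i b) = f c) -> forall c c', f c = f c'.
Proof.
move=> fu c c'.
have H (s : seq I) : f [ffun k => if k \in s then c' k else c k] = f c.
  elim: s => [|i s <-]; first by congr f; apply/ffunP => k; rewrite ffunE.
  rewrite -[RHS](fu i (c' i)); congr f; apply/ffunP => k; rewrite !ffunE inE.
  by case: eqP => [->|].
rewrite -(H (enum I)); congr f; apply/ffunP => k; rewrite ffunE.
by rewrite mem_enum.
Qed.

Lemma root_avg_inv i b f j : (forall c, f (upd c i b) = f c) ->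
  forall c, root_avg j f (upd c i b) = root_avg j f c.
Proof.
move=> fi c; have [->|ij] := eqVneq j i; first by rewrite /root_avg avg_upd.
rewrite eq_sym in ij.
by rewrite /root_avg /avg !(updC _ _ _ ij) !fi.
Qed.

Lemma root_avgs_upd (s : seq I) f i b c : i \in s -> root_avgs s f (upd c i b) = root_avgs s f c.
Proof.
have H t (g : conf -> R) : (forall c, g (upd c i b) = g c) ->
    forall c, root_avgs t g (upd c i b) = root_avgs t g c.
  by elim: t g => //= j t IH g gi; apply: IH; exact: root_avg_inv.
elim: s f => // j s IH f; rewrite inE => /predU1P[<- /=|/IH]; last exact.
by apply: H => c'; rewrite /root_avg avg_upd.
Qed.

Lemma avg_inv i b f j : (forall c, f (upd c i b) = f c) ->
  forall c, avg j f (upd c i b) = avg j f c.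
Proof.
move=> fi c; have [->|ij] := eqVneq j i; first by rewrite avg_upd.
rewrite eq_sym in ij.
by rewrite /avg !(updC _ _ _ ij) !fi.
Qed.

Lemma avgs_upd (s : seq I) f i b c : i \in s -> avgs s f (upd c i b) = avgs s f c.
Proof.
have H t (g : conf -> R) : (forall c, g (upd c i b) = g c) ->
    forall c, avgs t g (upd c i b) = avgs t g c.
  by elim: t g => //= j t IH g gi; apply: IH; exact: avg_inv.
elim: s f => // j s IH f; rewrite inE => /predU1P[<- /=|/IH]; last exact.
by apply: H => c'; rewrite avg_upd.
Qed.

Lemma expect_avgs s f : expect (avgs s f) = expect f.
Proof. by elim: s f => //= i s IH f; rewrite IH expect_avg. Qed.

Lemma avgs_enum f c : avgs (enum I) f c = expect f.
Proof.
rewrite -(expect_avgs (enum I)) -(expect_cst (avgs (enum I) f c)).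
apply: eq_expect => c'; apply: upd_invariant_cst => i b c0.
by rewrite avgs_upd// mem_enum.
Qed.

Lemma root_avgs_enum f c : root_avgs (enum I) f c ^+ 2 = expect (fun c => f c ^+ 2).
Proof.
rewrite -(expect_root_avgs (enum I)) -(expect_cst (root_avgs (enum I) f c ^+ 2)).
apply: eq_expect => c'; congr (_ ^+ 2); apply: upd_invariant_cst => i b c0.
by rewrite root_avgs_upd// mem_enum.
Qed.

Lemma log_sobolev f : entropy (fun c => f c ^+ 2) <= 2 * energy f.
Proof.
(* Root averages are nonnegative, hence the passage to the absolute value of [f]. It has the same
   square and no larger influences. *)
have := @expect_xlnx_root_avgs (enum I) (fun c => `|f c|) (enum_uniq _) (fun c => normr_ge0 _).
rewrite (@eq_expect (fun c => xlnx (root_avgs (enum I) (fun c => `|f c|) c ^+ 2))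
  (fun=> xlnx (expect (fun c => f c ^+ 2)))); last first.
  move=> c; rewrite root_avgs_enum; congr xlnx; apply: eq_expect => c'.
  by rewrite -normrX ger0_norm ?sqr_ge0.
rewrite expect_cst /entropy (@eq_expect (fun c => xlnx (`|f c| ^+ 2)) (fun c => xlnx (f c ^+ 2))); last first.
  by move=> c; rewrite -normrX ger0_norm ?sqr_ge0.
move=> /le_trans; apply; rewrite big_enum /=.
rewrite ler_wpM2l// ler_sum// => i _; apply: le_expect => c.
rewrite -[leRHS]ger0_norm ?sqr_ge0// -[leLHS]ger0_norm ?sqr_ge0// !normrX.
by rewrite lerXn2r ?nnegrE// /infl ler_dist_dist.
Qed.

(** Let v = E f^2 and w = E |f|. The tangent to [xlnx] at v / w, taken at |f|, multiplied by 2 |f|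
    and averaged, shows that the entropy is at least v ln (v / w^2). A second tangent, at
    [lam * w ^+ 2], makes this bound linear in v. The bounds for the successive increments can then
    be added with one common [lam]. *)
Lemma entropy_sqr_ge f (lam : R) : 0 < lam ->
  expect (fun c => f c ^+ 2) * ln lam - lam * expect (fun c => `|f c|) ^+ 2
   <= entropy (fun c => f c ^+ 2).
Proof.
move=> lam0; set v := expect (fun c => f c ^+ 2); set w := expect (fun c => `|f c|).
have v0 : 0 <= v by apply: expect_ge0 => c; exact: sqr_ge0.
have w0 : 0 <= w by apply: expect_ge0 => c; exact: normr_ge0.
have [wz|wn] := eqVneq w 0.
  have f0 c : f c = 0.
    apply/eqP; rewrite -normr_eq0; apply/eqP.
    have : weight c * `|f c| <= w.
      rewrite /w /expect (bigD1 c) //= lerDl; apply: sumr_ge0 => c' _.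
      by rewrite mulr_ge0 ?normr_ge0// ltW ?weight_gt0.
    rewrite wz => h; apply/eqP; rewrite eq_le normr_ge0 andbT.
    by rewrite -(ler_pM2l (weight_gt0 c)) mulr0.
  rewrite /entropy wz /v (@eq_expect (fun c => f c ^+ 2) (fun=> 0)); last first.
    by move=> c; rewrite f0 expr0n.
  rewrite (@eq_expect (fun c => xlnx (f c ^+ 2)) (fun=> 0)); last first.
    by move=> c; rewrite f0 expr0n /xlnx mul0r.
  by rewrite !expect_cst /xlnx expr0n /= !mul0r mulr0 subrr.
have {wn} w1 : 0 < w by rewrite lt_neqAle eq_sym wn.
have v1 : 0 < v.
  rewrite lt_neqAle v0 andbT eq_sym; apply/eqP => vz.
  suff : w = 0 by move=> wz; rewrite wz ltxx in w1.
  rewrite /w -(expect_cst 0); apply: eq_expect => c.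
  have : weight c * f c ^+ 2 <= v.
    rewrite /v /expect (bigD1 c) //= lerDl; apply: sumr_ge0 => c' _.
    by rewrite mulr_ge0 ?sqr_ge0// ltW ?weight_gt0.
  rewrite vz => h; apply/eqP; rewrite normr_eq0 -sqrf_eq0 eq_le sqr_ge0 andbT.
  by rewrite -(ler_pM2l (weight_gt0 c)) mulr0.
have k0 : 0 < v / w by rewrite divr_gt0.
have pt (x : R) : 2 * (x ^+ 2 * ln (v / w) + x ^+ 2 - v / w * `|x|) <= xlnx (x ^+ 2).
  have := xlnx_ge (normr_ge0 x) k0.
  move=> /(ler_wpM2l (normr_ge0 x)); rewrite /xlnx mulrBr mulrDr !mulrA -expr2.
  have -> : `|x| * v / w = v / w * `|x| by rewrite mulrAC mulrC mulrA mulrAC.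
  rewrite -normrX (@ger0_norm _ (x ^+ 2)) ?sqr_ge0// => h.
  have [->|x0] := eqVneq x 0; first by rewrite normr0 expr0n /= !mul0r !mulr0; plra.
  have : ln (x ^+ 2) = 2 * ln `|x|.
    by rewrite -(ger0_norm (sqr_ge0 x)) normrX lnXn ?normr_gt0// mulr_natl.
  by move=> ->; move: h; rewrite mulrC; plra.
have := le_expect (fun c => pt (f c)).
rewrite expectZ expectB expectD expectZ.
have -> : expect (fun c => f c ^+ 2 * ln (v / w)) = v * ln (v / w).
  by rewrite /v [RHS]mulrC -expectZ; apply: eq_expect => c; rewrite mulrC.
rewrite -/v -/w divfK ?gt_eqF// => h.
have : v * ln (lam * w ^+ 2) + v - lam * w ^+ 2 <= xlnx v.
  by apply: xlnx_ge => //; rewrite mulr_gt0// exprn_gt0.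
rewrite lnM ?posrE ?exprn_gt0// lnXn// /entropy -/v => h2.
move: h; rewrite ln_div ?posrE// => h.
by move: h h2; rewrite /xlnx -mulr_natl mulrDr mulrBr; plra.
Qed.

Definition variance_fin f := expect (fun c => (f c - expect f) ^+ 2).

(** The increment [f - avg i f] has L1 norm at most that of the influence of i. Second moments and
    energies telescope along [s], and averaging never raises the L1 influences of the later
    coordinates. *)
Lemma expect_sqr_avgs_sub s f (lam : R) : uniq s -> 0 < lam ->
  (expect (fun c => f c ^+ 2) - expect (fun c => avgs s f c ^+ 2)) * ln lam
    - lam * \sum_(i <- s) expect (fun c => `|infl i f c|) ^+ 2
  <= 2 * (energy f - energy (avgs s f)).
Proof.
move=> + lam0; elim: s f => [|i s IH] f /=; first by rewrite big_nil !subrr; plra.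
move=> /andP[_ us]; rewrite big_cons.
have := IH (avg i f) us.
have : expect (fun c => (f c - avg i f c) ^+ 2) * ln lam
    - lam * expect (fun c => `|infl i f c|) ^+ 2 <= 2 * (energy f - energy (avg i f)).
  rewrite -energy_sub_avg; apply: le_trans (log_sobolev _).
  apply: le_trans (entropy_sqr_ge _ lam0); rewrite lerD2l lerN2 (ler_wpM2l (ltW lam0))//.
  rewrite lerXn2r ?nnegrE ?expect_ge0//.
  exact: expect_abs_sub_avg.
rewrite expect_sqr_avg.
have : \sum_(j <- s) expect (fun c => `|infl j (avg i f) c|) ^+ 2
   <= \sum_(j <- s) expect (fun c => `|infl j f c|) ^+ 2.
  apply: ler_sum => j _; rewrite lerXn2r ?nnegrE ?expect_ge0//.
  exact: expect_infl_avg.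
move=> /(ler_wpM2l (ltW lam0)) h1 h2 h3.
rewrite mulrDr; move: h1 h2 h3.
by rewrite [in X in _ -> X -> _]mulrBl [in X in _ -> _ -> X -> _]mulrBl
   [in X in _ -> _ -> _ -> X]mulrBl; plra.
Qed.

(* Falik and Samorodnitsky: the log-Sobolev inequality applied to the martingale
   increments of [f], whose energies add up to that of [f]. *)
Theorem variance_energy f (lam : R) : 0 < lam ->
  variance_fin f * ln lam <=
  2 * energy f + lam * \sum_i expect (fun c => `|infl i f c|) ^+ 2.
Proof.
move=> lam0; have := expect_sqr_avgs_sub f (enum_uniq I) lam0.
rewrite big_enum /=.
have e0 : 0 <= energy (avgs (enum I) f).
  by apply: sumr_ge0 => i _; apply: expect_ge0 => c; exact: sqr_ge0.
have -> : expect (fun c => avgs (enum I) f c ^+ 2) = expect f ^+ 2.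
  by rewrite -(expect_cst (expect f ^+ 2)); apply: eq_expect => c; rewrite avgs_enum.
have -> : expect (fun c => f c ^+ 2) - expect f ^+ 2 = variance_fin f.
  rewrite /variance_fin.
  rewrite (@eq_expect (fun c => (f c - expect f) ^+ 2)
    (fun c => (f c ^+ 2 + (-2 * expect f) * f c) + expect f ^+ 2)).
    by rewrite 2!expectD expectZ expect_cst; ring.
  by move=> c; ring.
plra.
Qed.

End ProductSpace.

Local Open Scope classical_set_scope.
Local Open Scope ring_scope.

(** * Lipschitz functions *)

Section LowerIntegral.
Context d (T : measurableType d) (R : realType) (mu : {measure set T -> \bar R}).
Import HBNNSimple.
Local Open Scope ereal_scope.

(* [integral] is a supremum over simple minorants, so it is blind to null sets
   even for non-measurable integrands. *)
Lemma ge0_le_integral_null (N : set T) (f g : T -> \bar R) :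
  measurable N -> mu N = 0 -> (forall x, 0 <= f x) -> (forall x, 0 <= g x) ->
  (forall x, ~ N x -> f x <= g x) ->
  \int[mu]_x f x <= \int[mu]_x g x.
Proof.
move=> mN N0 f0 g0 fg; rewrite (ge0_integralTE _ f0).
apply: ge_ereal_sup => _ [h /= hf <-].
have mCN : measurable (~` N) by exact: measurableC.
pose h' : {nnsfun T >-> R} := proj_nnsfun h mCN.
have hE x : h' x = (if x \in N then 0 else h x)%R.
  rewrite /h' /proj_nnsfun/= mindicE.
  by rewrite in_setC; case: (x \in N); rewrite ?mulr0 ?mulr1.
have -> : sintegral mu h = sintegral mu h'.
  rewrite -!integralT_nnsfun; apply: ae_eq_integral => //.
  - exact/measurable_EFinP.
  - exact/measurable_EFinP.
  - exists N; split => // x hx; apply: contrapT => nNx; apply: hx => _.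
    by rewrite hE memNset.
rewrite (ge0_integralTE _ g0); apply: ereal_sup_ubound; exists h' => // x.
rewrite hE; case: ifPn => [_|/negP xN]; first exact: g0.
by apply: (le_trans (hf x)); apply: fg => Nx; apply: xN; rewrite inE.
Qed.

Lemma integral_null_eq (D N : set T) (f g : T -> \bar R) :
  measurable N -> mu N = 0 ->
  (forall x, D x -> ~ N x -> f x = g x) ->
  \int[mu]_(x in D) f x = \int[mu]_(x in D) g x.
Proof.
move=> mN N0 fg; rewrite integral_mkcond [RHS]integral_mkcond.
have fgD x : ~ N x -> (f \_ D) x = (g \_ D) x.
  by move=> Nx; rewrite /patch; case: ifPn => // /[!inE] Dx; exact: fg.
by rewrite integralE [RHS]integralE; congr (_ - _); apply/eqP; rewrite eq_le;
  apply/andP; split; apply: (ge0_le_integral_null mN N0) => // x /fgD e;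
  rewrite ?funeposE ?funenegE e.
Qed.

End LowerIntegral.

Section Translation.
Context {R : realType}.
Local Notation mu := (@lebesgue_measure R).

Lemma shift_preimage_itv (h : R) (b1 b2 : bool) (a b : R) :
  (fun x => x + h) @^-1` [set` Interval (BSide b1 a) (BSide b2 b)] =
  [set` Interval (BSide b1 (a - h)) (BSide b2 (b - h))].
Proof.
apply/seteqP; split => x /=; rewrite !in_itv /= => /andP[h1 h2]; apply/andP; split;
  by move: h1 h2; case: b1; case: b2 => /=; lra.
Qed.

Lemma lebesgue_measure_shift (h : R) (A : set R) : measurable A ->
  mu ((fun x => x + h) @^-1` A) = mu A.
Proof.
move=> mA; pose phi : measurableTypeR R -> measurableTypeR R := fun x => (x + h).
have mphi : measurable_fun setT phi by exact: measurable_funD.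
have -> : mu ((fun x => x + h) @^-1` A) = pushforward mu phi A by [].
apply/esym/(@lebesgue_measure_unique _ (pushforward mu phi)) => // _ [[a b]] _ <-.
rewrite [(a, b).1]/= [(a, b).2]/=.
transitivity (mu `]a - h, b - h]%classic); last by rewrite -shift_preimage_itv.
rewrite !lebesgue_measure_itv/= !lte_fin ltrD2r; case: ifP => // _.
by rewrite -!EFinD; congr EFin; ring.
Qed.

Lemma ge0_integral_shift (h : R) (D : set (measurableTypeR R)) (f : measurableTypeR R -> \bar R) :
  measurable D -> measurable_fun D f -> (forall x, D x -> (0 <= f x)%E) ->
  (\int[mu]_(x in (fun x => (x + h)%R) @^-1` D) f (x + h)%R)%E = (\int[mu]_(x in D) f x)%E.
Proof.
move=> mD mf f0; pose phi : measurableTypeR R -> measurableTypeR R := fun x => (x + h).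
have mphi : measurable_fun setT phi by exact: measurable_funD.
rewrite (_ : (fun x => x + h) @^-1` D = phi @^-1` D)//.
rewrite -(@ge0_integral_pushforward _ _ _ _ _ phi mphi mu D f)//; last first.
  by move=> x /[!inE]; exact: f0.
by apply: eq_measure_integral => A mA _; rewrite /= /pushforward lebesgue_measure_shift.
Qed.

End Translation.

Section IntegrableBounded.
Context {R : realType}.
Local Notation mu := (@lebesgue_measure R).

Lemma integrable_itv_bounded (b1 b2 : bool) (r s M : R) (f : R -> R) :
  measurable_fun setT f -> (forall x, `|f x| <= M) ->
  mu.-integrable [set` Interval (BSide b1 r) (BSide b2 s)] (EFin \o f).
Proof.
move=> mf fM; apply: measurable_bounded_integrable.
- exact: measurable_itv.
- rewrite /= lebesgue_measure_itv/=; case: ifP => _ //.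
  by rewrite -EFinB ltry.
- exact: measurable_funTS.
- by exists M; split; [exact: num_real|move=> y My x _ /=; exact: le_trans (fM x) (ltW My)].
Qed.

End IntegrableBounded.

Section LipschitzScalar.
Context {R : realType}.
Local Notation mu := (@lebesgue_measure R).
Variables (f : R -> R) (L : R).
Hypothesis fL : forall x y, `|f x - f y| <= L * `|x - y|.

Let psi (x : R) : R := f x + L * x.

Let L0 : 0 <= L.
Proof.
by have := fL 1 0; rewrite subr0 normr1 mulr1; apply: le_trans.
Qed.

Let psi_nd : nondecreasing psi.
Proof.
move=> x y xy; rewrite /psi; have := fL x y.
rewrite (@ler0_norm _ (x - y)) ?subr_le0// opprB => /ler_normlP[_].
by rewrite mulrBr; lra.
Qed.

Let psi_le x y : x <= y -> psi y - psi x <= (L + L) * (y - x).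
Proof.
move=> xy; rewrite /psi; have := fL y x.
rewrite (@ger0_norm _ (y - x)) ?subr_ge0// => /ler_normlP[_].
by rewrite mulrBr mulrDl !mulrBr; lra.
Qed.

Let f_cont : continuous f.
Proof.
move=> x; apply/cvgrPdist_le => e e0; near=> y.
apply: (le_trans (fL _ _)).
have : `|x - y| <= e / (L + 1).
  near: y; apply: cvgr_dist_le; [exact: cvg_id|].
  by rewrite divr_gt0// ltr_wpDl.
move=> /(ler_wpM2l L0) /le_trans; apply.
have L1 : 0 < L + 1 by rewrite ltr_wpDl.
by rewrite mulrA ler_pdivrMr// mulrC ler_pM2l// lerDl.
Unshelve. all: by end_near. Qed.

Let psi_rc : right_continuous psi.
Proof.
apply: right_continuousW => x; apply: cvgD; first exact: f_cont.
by apply: cvgM; [exact: cvg_cst|exact: cvg_id].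
Qed.

HB.instance Definition _ := isCumulative.Build R _ R psi psi_nd psi_rc.

Let nu := lebesgue_stieltjes_measure (psi : cumulative R R).

Let nu_itv a b : a <= b -> nu `]a, b] = (psi b - psi a)%:E.
Proof.
move=> ab; rewrite /nu /lebesgue_stieltjes_measure/= /measure_extension/=.
rewrite measurable_mu_extE/=; last exact: is_ocitv.
by rewrite wlength_itv_bnd.
Qed.

(** A cover by half-open intervals of small total length has [psi]-length at most 2 L times as
    large. The divisor [L + L + 1] stays positive when L = 0. *)
Let nu_null A : measurable A -> mu A = 0%E -> nu A = 0%E.
Proof.
move=> mA A0; apply/eqP; rewrite eq_le measure_ge0 andbT.
apply/lee_addgt0Pr => e e0; rewrite add0e.
have L1 : 0 < L + L + 1 by have := L0; lra.
have e1 : 0 < e / (L + L + 1) by rewrite divr_gt0.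
have : (mu A < (e / (L + L + 1))%:E)%E by rewrite A0 lte_fin.
rewrite /lebesgue_measure /lebesgue_stieltjes_measure /=.
rewrite /measure_extension /= /mu_ext => /ereal_inf_lt[_ [B cB <-]] Be.
rewrite /nu /lebesgue_stieltjes_measure /= /measure_extension /= /mu_ext.
apply: (@le_trans _ _ (\sum_(0 <= k <oo) wlength psi (B k))%E).
  by apply: ereal_inf_lbound; exists B.
apply: (@le_trans _ _ (\sum_(0 <= k <oo) ((L + L)%:E * wlength idfun (B k)))%E).
  apply: lee_nneseries => [k _ _|k _]; first exact: measure_ge0.
  have [mB _] := cB; have /ocitvP[->|[[a b] /= ab ->]] := mB k.
    by rewrite !wlength0 mule0.
  rewrite (wlength_itv_bnd _ _ _ (ltW ab)) (@wlength_itv_bnd _ idfun _ _ _ _ (ltW ab)).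
  by rewrite -EFinM lee_fin psi_le// ltW.
rewrite nneseriesZl; last by move=> k _; exact: measure_ge0.
have LL : 0 <= L + L by have := L0; lra.
have /(@lee_wpmul2l _ (L + L)%:E) := ltW Be.
rewrite lee_fin => /(_ LL) /le_trans; apply; rewrite -EFinM lee_fin.
by rewrite mulrA ler_pdivrMr// mulrC ler_pM2l// lerDl.
Qed.

(* Rademacher's theorem in dimension one: the Stieltjes measure of [f + L id] is absolutely
   continuous, and its density is the derivative by Lebesgue differentiation. *)
Lemma lipschitz_scalar_density (T : R) : 0 < T ->
  exists v : R -> R, [/\ measurable_fun setT v,
    (forall r s, 0 <= r -> r <= s -> s <= T ->
       mu.-integrable `]r, s] (EFin \o v) /\
       (\int[mu]_(x in `]r, s]) (v x)%:E)%E = (f s - f r)%:E) &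
    {ae mu, forall x, 0 < x < T -> is_derive x 1 f (v x)}].
Proof.
move=> T0.
(* Restricted to this interval the Stieltjes measure is finite, so it has an integrable density
   [h]. *)
pose D : set (measurableTypeR R) := [set` `]0, T]].
have mD : measurable D by exact: measurable_itv.
have nuD : (nu D < +oo)%E by rewrite nu_itv ?ltW// ltry.
have dom : mfrestr mD nuD `<< mu.
  apply/null_content_dominatesP => A mA A0; rewrite /= /mfrestr /mrestr.
  apply: nu_null; first exact: measurableI.
  by apply: (subset_measure0 _ _ _ A0) => //; exact: measurableI.
have [h [h0 hfin hint hE]] := radon_nikodym_sigma_finite dom.
have gE : EFin \o (fine \o h) = h by apply/funext => x /=; rewrite fineK.
have gint : mu.-integrable setT (EFin \o (fine \o h)) by rewrite gE.
have hI r s : 0 <= r -> r <= s -> s <= T ->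
    (\int[mu]_(x in `]r, s]) h x)%E = (psi s - psi r)%:E.
  move=> r0 rs sT; rewrite -hE; last exact: measurable_itv.
  rewrite /= /mfrestr /mrestr -nu_itv//; congr (nu _).
  apply/setIidPl => x /=; rewrite /D /= !in_itv/=; lra.
have mg : measurable_fun setT (fine \o h).
  by apply/measurable_EFinP; exact: (measurable_int mu).
exists (fun x => fine (h x) - L); split.
- exact: measurable_funB.
- move=> r s r0 rs sT; have mrs : measurable (`]r, s]%classic : set (measurableTypeR R)).
    exact: measurable_itv.
  have i1 : mu.-integrable `]r, s] (EFin \o (fine \o h)).
    by apply: integrableS gint.
  have i2 : mu.-integrable `]r, s] (EFin \o cst L).
    by apply: (@integrable_itv_bounded _ _ _ _ _ `|L|).
  split.
    have := integrableB mrs i1 i2.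
    by apply: eq_integrable.
  under eq_integral do rewrite EFinB.
  rewrite integralB//.
  rewrite [X in (X - _)%E](_ : _ = (psi s - psi r)%:E); last first.
    by rewrite -hI//; apply: eq_integral => x _; rewrite fineK.
  rewrite integral_cst//= lebesgue_measure_itv/= lte_fin.
  case: ltP => [_|sr]; first by rewrite -EFinM -EFinB; congr EFin; rewrite /psi; ring.
  by rewrite mule0 sube0; congr EFin; rewrite /psi (_ : s = r); [ring|apply/eqP; rewrite eq_le sr].
- pose g : R -> R := fine \o h.
  have gi : mu.-integrable [set: R] (EFin \o g) by [].
  have gl : locally_integrable setT g by exact: open_integrable_locally openT gi.
  have gy y : mu.-integrable [set` Interval (BRight 0) (BRight y)] (EFin \o g).
    by apply: integrableS gi => //; exact: measurable_itv.
  have := FTC1 gy gl.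
  apply: filterS; first exact: (ae_filter_ringOfSetsType mu).
  move=> x /= H /andP[x0 xT]; have [] := H x0.
  set F := (F in derivable F x 1) => dF F'.
  have dF2 : is_derive x 1 F (g x) by rewrite -F' -/F derive1E; exact: derivableP.
  have dL : is_derive x 1 (fun y : R => L * y) L.
    by rewrite -[X in is_derive _ _ _ X]mulr1; apply: is_deriveZ.
  have dc : is_derive x 1 (fun _ : R => f 0) 0 by exact: is_derive_cst.
  have := is_deriveD (is_deriveB dF2 dL) dc.
  rewrite addr0; apply: near_eq_is_derive; near=> y.
  have y0 : 0 < y by near: y; exact: lt_nbhsr.
  have yT : y < T by near: y; exact: lt_nbhsl.
  suff -> : (F \- (fun y : R => L * y) + (fun=> f 0)) y = psi y - psi 0 - L * y + f 0.
    by rewrite /psi; ring.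
  rewrite /= /F /Rintegral; congr (_ - _ + _).
  rewrite (_ : (\int[mu]_(x in _) _)%E = (psi y - psi 0)%:E)//.
  rewrite -hI// ?ltW//; apply: eq_integral => z _; rewrite /= fineK//.
Unshelve. all: by end_near. Qed.

End LipschitzScalar.

(** * The cost of a Lipschitz path *)

Section Paths.
Context {R : realType} {d : nat}.
Local Notation V := 'rV[R]_d.
Local Notation mu := (@lebesgue_measure R).
Implicit Types (K : V -> R) (G : 'rV[int]_d -> R) (gam : R -> V) (T r s h : R).

Lemma rV_norm_le (z : V) M : 0 <= M -> (forall i, `|z ord0 i| <= M) -> `|z| <= M.
Proof.
move=> M0 zM; rewrite [leLHS]/Num.Def.normr/= mx_normrE.
by apply: bigmax_le => // -[i j] _ /=; rewrite ord1.
Qed.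

Lemma rV_coord_le (z : V) i : `|z ord0 i| <= `|z|.
Proof.
rewrite [leRHS]/Num.Def.normr/= mx_normrE.
exact: (le_bigmax _ (fun ij : 'I_1 * 'I_d => `|z ij.1 ij.2|) (ord0, i)).
Qed.

Lemma rV_norm_coord (z : V) : z != 0 -> exists i, `|z| = `|z ord0 i|.
Proof.
move=> z0; have [|[i j] e] := @mx_norm_neq0 _ _ _ z.
  by apply: contra z0 => /eqP /mx_norm_eq0 ->.
by exists j; rewrite [LHS]/Num.Def.normr/= e /= ord1.
Qed.

Lemma lebesgue_null_eq (D N : set R) (f g : R -> \bar R) :
  measurable N -> mu N = 0%E -> (forall x, D x -> ~ N x -> f x = g x) ->
  (\int[mu]_(x in D) f x = \int[mu]_(x in D) g x)%E.
Proof.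
move=> mN N0 fg.
exact: (@integral_null_eq _ (measurableTypeR R) R mu D N f g mN N0 fg).
Qed.

Definition lip_path (T : R) (gam : R -> V) := exists L : R, forall s1 s2,
  0 <= s1 <= T -> 0 <= s2 <= T -> `|gam s1 - gam s2| <= L * `|s1 - s2|.

(** The values of a path outside [[0, T]] are arbitrary. Composition with [clamp] replaces them by a
    Lipschitz continuation to the whole line. *)
Definition clamp (T s : R) : R := Num.max 0 (Num.min s T).

Lemma clamp_itv T s : 0 <= T -> 0 <= clamp T s <= T.
Proof.
move=> T0; rewrite /clamp le_max lexx /= ge_max T0 /=.
by rewrite ge_min lexx orbT.
Qed.
Lemma clamp_id T s : 0 <= s <= T -> clamp T s = s.
Proof. by move=> /andP[s0 sT]; rewrite /clamp min_l// max_r. Qed.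
Lemma clamp_lip T x y : `|clamp T x - clamp T y| <= `|x - y|.
Proof.
rewrite /clamp.
case: (leP x T) => h1; case: (leP y T) => h2;
  repeat (match goal with |- context [Num.max 0 ?y] => case: (leP 0 y) => ? end);
  rewrite ?subrr ?normr0 ?normr_ge0//; apply/ler_normlP; split;
  have := ler_norm (x - y); have := ler_norm (y - x); rewrite (distrC y x); lra.
Qed.

Lemma is_derive_lip_le (f : R -> R) (L x df : R) :
  (forall x y, `|f x - f y| <= L * `|x - y|) -> is_derive x 1 f df -> `|df| <= L.
Proof.
move=> fL [fd fdf].
have : (fun h => h^-1 *: (f (h + x) - f x)) @ 0^' --> df.
  have -> : (fun h => h^-1 *: (f (h + x) - f x)) = (fun h => h^-1 *: (f (h *: 1 + x) - f x)).
    by apply/funext => h; rewrite [h *: 1]mulr1.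
  by rewrite -fdf; exact: fd.
move=> /cvg_norm /cvgr_to_le; apply; near=> h.
have h0 : h != 0 by near: h; exact: nbhs_dnbhs_neq.
rewrite /= normrZ normfV ler_pdivrMl ?normr_gt0// mulrC.
by have := fL (h + x) x; rewrite addrK.
Unshelve. all: by end_near. Qed.

Lemma lip_path_density (T : R) (gam : R -> V) : 0 < T -> lip_path T gam ->
  exists (v : R -> V) (N : set R) (M : R), [/\
    forall i, measurable_fun setT (fun s => v s ord0 i),
    forall s, `|v s| <= M,
    [/\ measurable N, mu N = 0%E &
       forall s, 0 < s < T -> ~ N s -> derive1 gam s = v s] &
    forall i r s, 0 <= r -> r <= s -> s <= T ->
      (\int[mu]_(x in `]r, s[) (v x ord0 i)%:E)%E = (gam s ord0 i - gam r ord0 i)%:E].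
Proof.
move=> T0 [L0 gL0]; pose L := Num.max 0 L0.
have L_ge0 : 0 <= L by rewrite /L le_max lexx.
have gL s1 s2 : 0 <= s1 <= T -> 0 <= s2 <= T -> `|gam s1 - gam s2| <= L * `|s1 - s2|.
  move=> h1 h2; apply: (le_trans (gL0 _ _ h1 h2)); apply: ler_wpM2r => //.
  by rewrite /L le_max lexx orbT.
pose f i s : R := gam (clamp T s) ord0 i.
have fL i x y : `|f i x - f i y| <= L * `|x - y|.
  have := rV_coord_le (gam (clamp T x) - gam (clamp T y)) i; rewrite !mxE => /le_trans; apply.
  apply: (le_trans (gL _ _ (clamp_itv _ (ltW T0)) (clamp_itv _ (ltW T0)))).
  by rewrite ler_wpM2l// clamp_lip.
have := fun i => lipschitz_scalar_density (fL i) T0.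
move=> /choice[w] /all_and3[mw wI wd].
(* The truncation gives a bound at every point. Almost everywhere it changes nothing, since [w i] is
   there the derivative of an L-Lipschitz function. *)
pose v s : V := \row_i Num.max (- L) (Num.min (w i s) L).
have vE i s : `|w i s| <= L -> v s ord0 i = w i s.
  by move=> /ler_normlP[h1 h2]; rewrite mxE min_l// max_r//; lra.
have mv i : measurable_fun setT (fun s => v s ord0 i).
  have -> : (fun s => v s ord0 i) = (fun s => Num.max (- L) (Num.min (w i s) L)).
    by apply/funext => s; rewrite mxE.
  by apply: measurable_maxr => //; apply: measurable_minr.
have /choice[N HN] : forall i, exists N : set R, [/\ measurable N, mu N = 0%E &
    forall s, ~ N s -> 0 < s < T -> is_derive s 1 (f i) (w i s)].
  move=> i; have [N [mN N0 subN]] := wd i; exists N; split => // s Ns.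
  by apply: contrapT => h; apply/Ns/subN.
have [mN N0 NP] := all_and3 HN.
exists v, (\bigcup_(i in [set` enum 'I_d]) N i), L; split => //.
- move=> s; apply: rV_norm_le => // i; rewrite mxE.
  apply/ler_normlP; split; last by rewrite ge_max ge_min lexx orbT andbT; lra.
  by rewrite lerNl le_max lexx.
- split.
  + by rewrite bigcup_seq; apply: bigsetU_measurable => i _; exact: mN.
  + rewrite bigcup_seq; apply: measure_negligible.
      by apply: bigsetU_measurable => i _; exact: mN.
    elim/big_ind: _ => [|A B|i _]; [exact: negligible_set0|exact: negligibleU|].
    exact: (ex_intro _ (N i) (And3 (mN i) (N0 i) (@subset_refl _ _))).
  + move=> s sT Ns.
    have fd i : is_derive s 1 (f i) (w i s).
      by apply: NP => // Ni; apply: Ns; exists i => //=; rewrite mem_enum.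
    have gd i : is_derive s 1 (fun x => gam x ord0 i) (w i s).
      apply: near_eq_is_derive (fd i); case/andP: sT => s0 sT.
      near=> x; rewrite /f clamp_id//.
      apply/andP; split; apply: ltW; near: x; [exact: lt_nbhsr|exact: lt_nbhsl].
    rewrite derive1E derive_mx.
      apply/rowP => i; rewrite mxE vE; last by apply: is_derive_lip_le (fL i) (fd i).
      by have := gd i => -[].
    apply/derivable_mxP => i j; rewrite ord1.
    by have := gd j => -[].
- move=> i r s r0 rs sT; have [wi] := wI i r s r0 rs sT.
  rewrite /f !clamp_id ?r0 ?sT ?(le_trans rs sT) ?(le_trans r0 rs)// => <-.
  transitivity (\int[mu]_(x in `]r, s[) (w i x)%:E)%E.
    apply: (lebesgue_null_eq (mN i) (N0 i)) => x /=; rewrite in_itv/= => /andP[rx xs] Nx.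
    rewrite vE//; apply: is_derive_lip_le (fL i) _; apply: NP => //.
    by rewrite (le_lt_trans r0 rx) (lt_le_trans xs sT).
  rewrite integral_itv_bndo_bndc//.
  exact/measurable_EFinP/measurable_funTS.
Unshelve. all: by end_near. Qed.

(** The lattice is countable, so a preimage is a countable union over cells, and each cell is a
    product of half-open intervals. *)
Lemma measurable_cell_fun (u : R -> V) (G : 'rV[int]_d -> R) :
  (forall i, measurable_fun setT (fun s => u s ord0 i)) ->
  measurable_fun setT (fun s => G (cell (u s))).
Proof.
move=> mu_ _ B mB; rewrite setTI.
have -> : (fun s => G (cell (u s))) @^-1` B =
    \bigcup_(k in [set k | B (G k)]) \bigcap_(i in [set` enum 'I_d])
       [set s | Num.floor (u s ord0 i) = k ord0 i].
  apply/seteqP; split => [s Bs|s [k /= Bk ks]].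
    by exists (cell (u s)) => //= i _; rewrite mxE.
  rewrite /preimage /= (_ : cell (u s) = k)//; apply/rowP => i; rewrite mxE.
  by apply: ks; rewrite /= mem_enum.
rewrite bigcup_mkcond; apply: countable_bigcupT_measurable => [|k]; first exact: countableP.
case: ifPn => _; last exact: measurable0.
rewrite bigcap_seq; apply: bigsetI_measurable => i _.
have -> : [set s | Num.floor (u s ord0 i) = k ord0 i] =
   (fun s => u s ord0 i) @^-1` [set` `[(k ord0 i)%:~R, (k ord0 i + 1)%:~R[].
  apply/seteqP; split => [s /= <-|s /=]; rewrite in_itv /=.
    by rewrite Num.Theory.floor_le_tmp Num.Theory.floorD1_gt.
  by move=> /floor_def.
by rewrite -[X in measurable X]setTI; apply: mu_ => //; exact: measurable_itv.
Qed.

(** Rounding [u] down to the lattice of mesh 1/(n+1) yields functions of cells, which are measurable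
    and converge pointwise by continuity of [K]. *)
Lemma measurable_continuous_rV (u : R -> V) (K : V -> R) :
  continuous K -> (forall i, measurable_fun setT (fun s => u s ord0 i)) ->
  measurable_fun setT (fun s => K (u s)).
Proof.
move=> Kc mu_.
pose q (n : nat) (z : V) : V := n.+1%:R^-1 *: map_mx intr (cell (n.+1%:R *: z)).
have qz (z : V) : q ^~ z @ \oo --> z.
  apply/cvgrPdist_le => e e0; near=> n.
  have n0 : 0 < n.+1%:R :> R by [].
  apply: (@le_trans _ _ n.+1%:R^-1); last first.
    by apply: ltW; near: n; have := near_infty_natSinv_lt (PosNum e0).
  apply: rV_norm_le => [|i]; first by rewrite invr_ge0 ltW.
  rewrite !mxE -(ler_pM2l n0) -[X in X * `|_|](ger0_norm (ltW n0)) -normrM mulrBr.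
  rewrite mulrA divff ?gt_eqF// mul1r.
  set y := (_ * z ord0 i); have := Num.Theory.floor_le_tmp y; have := Num.Theory.floorD1_gt y.
  by rewrite intrD => h1 h2; rewrite ger0_norm; lra.
apply: (@measurable_fun_cvg _ _ _ _ (fun n s => K (q n (u s)))) => [n|s _]; last first.
  by apply: cvg_comp (qz (u s)) (Kc _).
apply: (@measurable_cell_fun (fun s => n.+1%:R *: u s)
   (fun k => K (n.+1%:R^-1 *: map_mx intr k))) => i.
rewrite (_ : (fun s => _) = (fun s => n.+1%:R * u s ord0 i)); last first.
  by apply/funext => s; rewrite mxE.
exact: measurable_funM.
Unshelve. all: by end_near. Qed.

Lemma continuous_rV_bounded (K : V -> R) (M : R) : continuous K ->
  exists B, forall z, `|z| <= M -> `|K z| <= B.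
Proof.
move=> Kc; pose A : set V := [set z | `|z| <= M].
have cA : compact A.
  apply: bounded_closed_compact.
    by exists M; split => [|y My z /= zM]; [exact: num_real|exact: le_trans zM (ltW My)].
  have -> : A = (fun z : V => `|z|) @^-1` [set y | y <= M] by [].
  by apply: preimage_closed; [move=> z _; exact: norm_continuous|exact: closed_le].
have cKA : {within A, continuous K} by apply: continuous_subspaceT.
have /compact_bounded [B [_ KB]] := continuous_compact cKA cA.
exists (B + 1) => z zM; apply: KB; first by rewrite ltrDl.
by exists z.
Qed.

Definition lagr (K : V -> R) (G : 'rV[int]_d -> R) (gam : R -> V) (s : R) : R :=
  K (derive1 gam s) + G (cell (gam s)).

(** On the open interval the derivative depends only on the values of [gam] between [r] and [s], so
    pieces of paths can be cut out and glued without regard to the end points. *)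
Definition cost K G gam (r s : R) : R := \int[mu]_(x in `]r, s[) lagr K G gam x.

Definition bounded_cells (G : 'rV[int]_d -> R) := exists B, forall k, `|G k| <= B.

Lemma lip_path_continuous (T : R) gam : 0 <= T -> lip_path T gam ->
  continuous (fun s => gam (clamp T s)).
Proof.
move=> T0 [L gL] x; apply/cvgrPdist_le => e e0; near=> y.
apply: (le_trans (gL _ _ (clamp_itv _ T0) (clamp_itv _ T0))).
have L1 : 0 < `|L| + 1 by rewrite ltr_wpDl.
have h : `|x - y| <= e / (`|L| + 1).
  near: y; apply: cvgr_dist_le; [exact: cvg_id|].
  by rewrite divr_gt0// ltr_wpDl.
apply: (@le_trans _ _ ((`|L| + 1) * (e / (`|L| + 1)))); last first.
  by rewrite mulrCA divff ?mulr1// gt_eqF.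
apply: (@le_trans _ _ ((`|L| + 1) * `|clamp T x - clamp T y|)).
  by apply: ler_wpM2r => //; apply: (le_trans (ler_norm L)); rewrite lerDl.
by apply: ler_wpM2l; [exact: ltW|exact: le_trans (clamp_lip _ _ _) h].
Unshelve. all: by end_near. Qed.

(* [derive1 gam] need not be measurable where [gam] is not differentiable; [v] is a
   measurable version of it. *)
Lemma cost_repr (T : R) gam : 0 <= T -> lip_path T gam ->
  exists (v : R -> V) (N : set R),
    [/\ measurable N, mu N = 0%E &
    forall K G, continuous K -> bounded_cells G ->
       let phi s := K (v s) + G (cell (gam (clamp T s))) in
       [/\ measurable_fun setT phi, exists M, forall x, `|phi x| <= M &
        forall s, 0 < s < T -> ~ N s -> lagr K G gam s = phi s]] /\
    (forall i r s, 0 <= r -> r <= s -> s <= T ->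
      (\int[mu]_(x in `]r, s[) (v x ord0 i)%:E)%E = (gam s ord0 i - gam r ord0 i)%:E).
Proof.
move=> T0 gl.
have mgam i : measurable_fun setT (fun s => gam (clamp T s) ord0 i).
  apply: continuous_measurable_fun => s.
  by apply: (@continuous_comp _ _ _ (fun s => gam (clamp T s)) (fun z : V => z ord0 i));
    [exact: lip_path_continuous|exact: coord_continuous].
have mphi K G (v : R -> V) M : continuous K -> bounded_cells G ->
    (forall i, measurable_fun setT (fun s => v s ord0 i)) -> (forall s, `|v s| <= M) ->
    let phi s := K (v s) + G (cell (gam (clamp T s))) in
    measurable_fun setT phi /\ exists M, forall x, `|phi x| <= M.
  move=> Kc [B GB] mv vM phi; split.
    by apply: measurable_funD; [exact: measurable_continuous_rV|exact: measurable_cell_fun].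
  have [B' KB] := continuous_rV_bounded M Kc.
  by exists (B' + B) => x; apply: (le_trans (ler_normD _ _)); apply: lerD => //; exact: KB.
have [T1|T1] := eqVneq T 0.
  exists (fun=> 0), set0; split.
    split => [||K G Kc GB phi]; [exact: measurable0|exact: measure0|].
    have [] := @mphi K G (fun=> 0) 0 Kc GB; first by move=> i; exact: measurable_cst.
      by move=> s; rewrite normr0.
    by move=> h1 h2; split => // s /andP[s0]; rewrite T1 ltNge ltW.
  move=> i r s r0 rs sT.
  have -> : r = 0 by apply/eqP; rewrite eq_le r0 andbT -T1 (le_trans rs).
  have -> : s = 0 by apply/eqP; rewrite eq_le (le_trans r0 rs) -T1 sT.
  by rewrite set_itv_ge ?integral_set0 ?subrr// bnd_simp ltxx.
have {}T1 : 0 < T by rewrite lt_neqAle eq_sym T1.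
have [v [N [M [mv vM [mN N0 NP] vI]]]] := lip_path_density T1 gl.
exists v, N; split => //; split => // K G Kc GB phi.
have [h1 h2] := mphi K G v M Kc GB mv vM; split => // x xI Nx.
rewrite /phi /lagr NP// clamp_id//; case/andP: xI => x0 xT; by rewrite !ltW.
Qed.

Lemma cost_reprR (T : R) gam : 0 <= T -> lip_path T gam ->
  exists v : R -> V,
    (forall K G, continuous K -> bounded_cells G ->
       let phi s := K (v s) + G (cell (gam (clamp T s))) in
       [/\ measurable_fun setT phi,
           forall b1 b2 r s, mu.-integrable [set` Interval (BSide b1 r) (BSide b2 s)] (EFin \o phi) &
        forall r s, 0 <= r -> s <= T ->
         cost K G gam r s = \int[mu]_(x in `]r, s]) phi x]) /\
    (forall i r s, 0 <= r -> r <= s -> s <= T ->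
      mu.-integrable `]r, s] (EFin \o (fun x => v x ord0 i)) /\
      \int[mu]_(x in `]r, s]) v x ord0 i = gam s ord0 i - gam r ord0 i).
Proof.
move=> T0 gl; have [v [N [[mN N0 vK] vI]]] := cost_repr T0 gl; exists v.
have G0 : bounded_cells (fun=> 0) by exists 0 => k; rewrite normr0.
split=> [K G Kc GB phi|i r s r0 rs sT].
  have [mphi [M phiM] phiE] := vK K G Kc GB.
  have ii b1 b2 r s : mu.-integrable [set` Interval (BSide b1 r) (BSide b2 s)] (EFin \o phi).
    exact: integrable_itv_bounded phiM.
  split => // r s r0 sT; rewrite -Rintegral_itv_bndo_bndc// /cost /Rintegral.
  congr fine; apply: (lebesgue_null_eq mN N0) => x /=; rewrite in_itv/= => /andP[rx xs] Nx.
  by rewrite phiE// (le_lt_trans r0 rx) (lt_le_trans xs sT).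
have cc : continuous (fun z : V => z ord0 i) by exact: coord_continuous.
have [mphi [M phiM] _] := vK (fun z => z ord0 i) (fun=> 0) cc G0.
have ii b1 b2 : mu.-integrable [set` Interval (BSide b1 r) (BSide b2 s)]
    (EFin \o (fun x => v x ord0 i)).
  apply: (@integrable_itv_bounded _ _ _ _ _ M).
    by under eq_fun do rewrite -[v _ _ _]addr0.
  by move=> x; rewrite -[v _ _ _]addr0.
split => //; rewrite -Rintegral_itv_bndo_bndc//.
by rewrite /Rintegral vI.
Qed.

Lemma cost_split K G T gam r q s : continuous K -> bounded_cells G ->
  lip_path T gam -> 0 <= r -> r <= q -> q <= s -> s <= T ->
  cost K G gam r s = cost K G gam r q + cost K G gam q s.
Proof.
move=> Kc GB gl r0 rq qs sT.
have T0 : 0 <= T by rewrite (le_trans r0)// (le_trans rq)// (le_trans qs).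
have [v [/(_ K G Kc GB)[mphi ii phiE] _]] := cost_reprR T0 gl.
rewrite !phiE// ?(le_trans r0 rq)// ?(le_trans qs sT)//.
rewrite -(Rintegral_itvB (x := q) (ii false false r s))// addrC subrK//.
Qed.

Lemma cost_ge0 K G gam r s : (forall z, 0 <= K z) -> (forall k, 0 <= G k) ->
  0 <= cost K G gam r s.
Proof.
by move=> K0 G0; apply: Rintegral_ge0 => x _; rewrite addr_ge0.
Qed.

Lemma le_cost K1 K2 G1 G2 T gam r s :
  continuous K1 -> bounded_cells G1 -> continuous K2 -> bounded_cells G2 ->
  lip_path T gam -> 0 <= r -> s <= T -> 0 <= T ->
  (forall z, K1 z <= K2 z) -> (forall k, G1 k <= G2 k) ->
  cost K1 G1 gam r s <= cost K2 G2 gam r s.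
Proof.
move=> Kc1 GB1 Kc2 GB2 gl r0 sT T0 K12 G12.
have [v [vK _]] := cost_reprR T0 gl.
have [_ i1 ->//] := vK _ _ Kc1 GB1; have [_ i2 ->//] := vK _ _ Kc2 GB2.
by apply: le_Rintegral => // x _; exact: lerD.
Qed.

Lemma bounded_cellsD G1 G2 : bounded_cells G1 -> bounded_cells G2 ->
  bounded_cells (fun k => G1 k + G2 k).
Proof.
move=> [B1 H1] [B2 H2]; exists (B1 + B2) => k.
by apply: (le_trans (ler_normD _ _)); exact: lerD.
Qed.

Lemma costD K1 K2 G1 G2 T gam r s :
  continuous K1 -> bounded_cells G1 -> continuous K2 -> bounded_cells G2 ->
  lip_path T gam -> 0 <= r -> s <= T -> 0 <= T ->
  cost (fun z => K1 z + K2 z) (fun k => G1 k + G2 k) gam r s =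
  cost K1 G1 gam r s + cost K2 G2 gam r s.
Proof.
move=> Kc1 GB1 Kc2 GB2 gl r0 sT T0.
have [v [vK _]] := cost_reprR T0 gl.
have [_ i1 ->//] := vK _ _ Kc1 GB1; have [_ i2 ->//] := vK _ _ Kc2 GB2.
have Kc12 : continuous (fun z => K1 z + K2 z).
  by move=> z; apply: continuousD; [exact: Kc1|exact: Kc2].
have [_ i12 ->//] := vK _ _ Kc12 (bounded_cellsD GB1 GB2).
rewrite -RintegralD//; apply: eq_Rintegral => x _; ring.
Qed.

(** The fundamental theorem of calculus, written as the cost of a linear function of the velocity.
    The lower bounds of costs by displacements come from it. *)
Lemma cost_coord (a e : R) i T gam r s :
  lip_path T gam -> 0 <= r -> r <= s -> s <= T ->
  cost (fun z => a * z ord0 i) (fun=> e) gam r s =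
  a * (gam s ord0 i - gam r ord0 i) + e * (s - r).
Proof.
move=> gl r0 rs sT.
have T0 : 0 <= T by rewrite (le_trans r0)// (le_trans rs).
have [v [vK vI]] := cost_reprR T0 gl.
have Kc : continuous (fun z : V => a * z ord0 i).
  by move=> z; apply: continuousM; [exact: cst_continuous|exact: coord_continuous].
have GB : bounded_cells (fun=> e) by exists `|e|.
have [_ _ ->//] := vK _ _ Kc GB.
have [i1 <-] := vI i r s r0 rs sT.
have i2 : mu.-integrable `]r, s] (EFin \o (fun x => a * v x ord0 i)).
  have /(_ (measurable_itv _)) := fun m => integrableZl m a i1.
  by apply: eq_integrable => //; exact: measurable_itv.
have i3 : mu.-integrable `]r, s] (EFin \o (cst e : R -> R)).
  exact: (@integrable_itv_bounded _ _ _ _ _ `|e|).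
rewrite RintegralD// RintegralZl// Rintegral_cst//= lebesgue_measure_itv/= lte_fin.
case: ltP => [_|sr] //=.
by rewrite (_ : s = r) ?subrr//; apply/eqP; rewrite eq_le sr.
Qed.

Lemma eq_derive1 (gam gam' : R -> V) (x x' : R) :
  (forall h, gam (h + x) - gam x = gam' (h + x') - gam' x') ->
  derive1 gam x = derive1 gam' x'.
Proof.
move=> e; rewrite /derive1.
rewrite (_ : (fun h => h^-1 *: (gam (h + x) - gam x)) =
  (fun h => h^-1 *: (gam' (h + x') - gam' x')))//.
by apply/funext => h; rewrite e.
Qed.

Lemma eq_cost K G gam gam' r s : (forall x, r < x < s -> gam x = gam' x) ->
  cost K G gam r s = cost K G gam' r s.
Proof.
move=> gg; apply: eq_Rintegral => x; rewrite inE /= in_itv /= => xI.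
rewrite /lagr; have -> : gam x = gam' x by exact: gg.
congr (_ + _); congr K.
rewrite !derive1E; apply: near_eq_derive; case/andP: xI => rx xs; near=> y.
by apply: gg; apply/andP; split; near: y; [exact: lt_nbhsr|exact: lt_nbhsl].
Unshelve. all: by end_near. Qed.

Lemma eq_cost_cells K G G' gam r s : (forall x, r < x < s -> G (cell (gam x)) = G' (cell (gam x))) ->
  cost K G gam r s = cost K G' gam r s.
Proof.
move=> gg; apply: eq_Rintegral => x; rewrite inE /= in_itv /= => xI.
by rewrite /lagr gg.
Qed.

Lemma cost_translate K G (k : 'rV[int]_d) gam r s :
  cost K (fun j => G (j + k)) gam r s = cost K G (fun x => gam x + map_mx intr k) r s.
Proof.
apply: eq_Rintegral => x _; rewrite /lagr; congr (K _ + G _).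
  by apply: eq_derive1 => h; rewrite opprD addrACA subrr addr0.
by apply/rowP => i; rewrite !mxE floorDrz// ?intr_int// intrKfloor.
Qed.

Lemma cost_shift K G T gam h r s : continuous K -> bounded_cells G ->
  (forall z, 0 <= K z) -> (forall k, 0 <= G k) ->
  lip_path T gam -> 0 <= T -> 0 <= r -> s <= T ->
  cost K G (fun x => gam (x - h)) (r + h) (s + h) = cost K G gam r s.
Proof.
move=> Kc GB K0 G0 gl T0 r0 sT.
have [v [N [[mN N0 /(_ K G Kc GB)[mphi [M phiM] phiE]] _]]] := cost_repr T0 gl.
set phi := (fun s => _) in mphi phiM phiE.
have phi0 x : 0 <= phi x by rewrite addr_ge0.
have mN' : measurable ((fun x => x + - h) @^-1` N).
  have mf : measurable_fun setT (fun x : R => x + - h) by exact: measurable_funD.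
  by rewrite -[X in measurable X]setTI; exact: mf.
have N0' : mu ((fun x => x + - h) @^-1` N) = 0%E by rewrite lebesgue_measure_shift.
have dE x : derive1 (fun x => gam (x - h)) x = derive1 gam (x - h).
  by apply: eq_derive1 => e; rewrite addrA.
rewrite /cost /Rintegral; congr fine.
transitivity (\int[mu]_(x in `](r + h)%R, (s + h)%R[) (phi (x + - h)%R)%:E)%E.
  apply: (lebesgue_null_eq mN' N0') => x /=; rewrite in_itv/= => /andP[rx xs] Nx.
  rewrite /lagr dE; congr EFin; apply: (phiE (x - h)) => //.
  by apply/andP; split; lra.
have -> : `]r + h, s + h[%classic = (fun x => x + - h) @^-1` `]r, s[%classic.
  by rewrite shift_preimage_itv !opprK.
rewrite (@ge0_integral_shift _ (- h) `]r, s[%classic (fun x => (phi x)%:E)).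
- apply: (lebesgue_null_eq mN N0) => x /=; rewrite in_itv/= => /andP[rx xs] Nx.
  by rewrite phiE// (le_lt_trans r0 rx) (lt_le_trans xs sT).
- exact: measurable_itv.
- exact/measurable_EFinP/measurable_funTS.
- by move=> x _; rewrite lee_fin.
Qed.

End Paths.

(** * Comparison of values *)

Section Reach.
Context {R : realType} {d : nat}.
Local Notation V := 'rV[R]_d.
Local Notation mu := (@lebesgue_measure R).
Implicit Types (G : 'rV[int]_d -> R) (gam : R -> V) (T r s h : R) (y z w : V).
Variables (K : V -> R) (dl : R).
Hypotheses (Kc : continuous K) (K0 : forall z, 0 <= K z) (Kz : K 0 = 0) (dl0 : 0 <= dl).

(** The potentials left after subtraction of the smaller value; [dl] stands for the gap between the
    two values. *)
Definition env G := forall k, 0 <= G k <= dl.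

Lemma env_bounded G : env G -> bounded_cells G.
Proof. by move=> eG; exists dl => k; have /andP[G0 Gd] := eG k; rewrite ger0_norm. Qed.
Lemma env_ge0 G : env G -> forall k, 0 <= G k.
Proof. by move=> eG k; have /andP[] := eG k. Qed.

Lemma continuous_coordM (a : R) i : continuous (fun z : V => a * z ord0 i).
Proof.
by move=> z; apply: continuousM; [exact: cst_continuous|exact: coord_continuous].
Qed.

Lemma cost_nonneg G gam r s : env G -> 0 <= cost K G gam r s.
Proof. by move=> eG; apply: cost_ge0 => //; exact: env_ge0. Qed.

Lemma cost_empty (K' : V -> R) G gam r s : s <= r -> cost K' G gam r s = 0.
Proof. by move=> sr; rewrite /cost set_itv_ge ?Rintegral_set0// bnd_simp -leNgt. Qed.

Lemma cost_cst (K' : V -> R) G gam r s a : r <= s -> (forall x, r < x < s -> lagr K' G gam x = a) ->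
  cost K' G gam r s = a * (s - r).
Proof.
move=> rs la; rewrite /cost.
transitivity (\int[mu]_(x in `]r, s[) a).
  by apply: eq_Rintegral => x; rewrite inE /= in_itv /= => /la.
rewrite Rintegral_cst//= lebesgue_measure_itv/= lte_fin.
case: ltP => [_|sr] //=.
by rewrite (_ : s = r) ?subrr//; apply/eqP; rewrite eq_le sr.
Qed.

Lemma derive1_line (y w : V) (x : R) : derive1 (fun x => y + x *: w) x = w.
Proof.
rewrite /derive1; apply/cvg_lim => //; apply: cvg_near_cst; near=> e.
have e0 : e != 0 by near: e; exact: nbhs_dnbhs_neq.
by rewrite opprD addrACA subrr add0r -scalerBl addrK scalerA mulVf// scale1r.
Unshelve. all: by end_near. Qed.

Lemma lip_line T (y w : V) : lip_path T (fun x => y + x *: w).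
Proof.
exists `|w| => s1 s2 _ _.
by rewrite opprD addrACA subrr add0r -scalerBl normrZ mulrC.
Qed.

Lemma lip_sub T gam r s : lip_path T gam -> 0 <= r -> s <= T ->
  lip_path (s - r) (fun x => gam (x - (- r))).
Proof.
move=> [L gL] r0 sT; exists L => s1 s2 /andP[h1 h2] /andP[h3 h4].
apply: (le_trans (gL _ _ _ _)); [apply/andP; split; lra..|].
by rewrite opprD opprK addrACA subrr addr0.
Qed.

(** All surgery on paths goes through this relation. The duration is exact because the horizon of
    the value is fixed, whereas the cost is only bounded above. *)
Definition reach G T y z c := 0 <= T /\ exists gam,
  [/\ lip_path T gam, gam 0 = y, gam T = z & cost K G gam 0 T <= c].

Lemma reach_le G T y z c c' : reach G T y z c -> c <= c' -> reach G T y z c'.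
Proof.
move=> [T0 [gam [gl g0 gT gc]]] cc; split => //; exists gam; split => //.
exact: le_trans cc.
Qed.

Lemma reach_sub G T gam r s : env G -> lip_path T gam -> 0 <= r -> r <= s -> s <= T ->
  reach G (s - r) (gam r) (gam s) (cost K G gam r s).
Proof.
move=> eG gl r0 rs sT; split; first by rewrite subr_ge0.
exists (fun x => gam (x - (- r))); split.
- exact: lip_sub gl r0 sT.
- by rewrite opprK add0r.
- by rewrite opprK subrK.
- have T0 : 0 <= T by lra.
  have := @cost_shift _ _ K G T gam (- r) r s Kc (env_bounded eG) K0 (env_ge0 eG) gl T0 r0 sT.
  by rewrite subrr => ->.
Qed.

Lemma reach_trans G T1 T2 y z w c1 c2 : env G ->
  reach G T1 y z c1 -> reach G T2 z w c2 -> reach G (T1 + T2) y w (c1 + c2).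
Proof.
move=> eG [T10 [g1 [gl1 g10 g1T gc1]]] [T20 [g2 [gl2 g20 g2T gc2]]].
split; first exact: addr_ge0.
pose gam x := if x <= T1 then g1 x else g2 (x - T1).
have gam2 x : T1 <= x -> gam x = g2 (x - T1).
  move=> Tx; rewrite /gam; case: ifPn => // xT.
  have -> : x = T1 by apply/eqP; rewrite eq_le xT.
  by rewrite subrr g1T g20.
have gam1 x : x <= T1 -> gam x = g1 x by rewrite /gam => ->.
have gl : lip_path (T1 + T2) gam.
  have [L1 H1] := gl1; have [L2 H2] := gl2.
  exists (`|L1| + `|L2|).
  have M1 x1 x2 : 0 <= x1 <= T1 -> 0 <= x2 <= T1 -> `|g1 x1 - g1 x2| <= `|L1| * `|x1 - x2|.
    by move=> h1 h2; apply: (le_trans (H1 _ _ h1 h2)); rewrite ler_wpM2r// ler_norm.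
  have M2 x1 x2 : 0 <= x1 <= T2 -> 0 <= x2 <= T2 -> `|g2 x1 - g2 x2| <= `|L2| * `|x1 - x2|.
    by move=> h1 h2; apply: (le_trans (H2 _ _ h1 h2)); rewrite ler_wpM2r// ler_norm.
  have nE (u v : R) : u <= v -> `|u - v| = v - u by move=> uv; rewrite distrC ger0_norm ?subr_ge0.
  have main x1 x2 : 0 <= x1 -> x1 <= x2 -> x2 <= T1 + T2 ->
      `|gam x1 - gam x2| <= (`|L1| + `|L2|) * (x2 - x1).
    move=> x10 x12 x2T.
    have l1 : 0 <= `|L1| by []. have l2 : 0 <= `|L2| by [].
    have [xT1|xT1] := leP x2 T1.
      rewrite !gam1//; last lra.
      apply: (le_trans (M1 _ _ _ _)); [apply/andP; split; lra..|].
      by rewrite nE// ler_wpM2r ?subr_ge0// lerDl.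
    have [Tx1|Tx1] := leP T1 x1.
      rewrite !gam2//; last lra.
      apply: (le_trans (M2 _ _ _ _)); [apply/andP; split; lra..|].
      rewrite opprB addrA subrK nE//.
      by rewrite ler_wpM2r ?subr_ge0// lerDr.
    rewrite (gam1 x1 (ltW Tx1)) (gam2 x2 (ltW xT1)).
    rewrite -[g1 x1](subrK (g1 T1)) -addrA.
    apply: (le_trans (ler_normD _ _)).
    rewrite {2}g1T -g20 mulrDl; apply: lerD.
      apply: (le_trans (M1 _ _ _ _)); [apply/andP; split; lra..|].
      by rewrite nE ?(ltW Tx1)// ler_wpM2l// lerD2r ltW.
    apply: (le_trans (M2 _ _ _ _)); [apply/andP; split; lra..|].
    rewrite nE ?subr_ge0 ?(ltW xT1)// ler_wpM2l// subr0 lerD2l lerN2 ltW//.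
  move=> s1 s2 /andP[h1 h2] /andP[h3 h4].
  have [s12|s12] := leP s1 s2.
    by rewrite [`|s1 - s2|]distrC (ger0_norm (x := s2 - s1)) ?subr_ge0//; exact: main.
  rewrite distrC (ger0_norm (x := s1 - s2)) ?subr_ge0 ?(ltW s12)//; apply: main => //.
  exact: ltW.
exists gam; split => //.
- by rewrite gam1.
- by rewrite gam2 ?lerDl// [T1 + T2]addrC addrK.
- rewrite (@cost_split _ _ K G (T1 + T2) gam 0 T1 (T1 + T2) Kc (env_bounded eG) gl)//; last by rewrite lerDl.
  apply: lerD.
    rewrite (@eq_cost _ _ K G gam g1)// => x /andP[_ xT]; exact/gam1/ltW.
  rewrite (@eq_cost _ _ K G gam (fun x => g2 (x - T1))) => [|x /andP[Tx _]]; last exact/gam2/ltW.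
  have := @cost_shift _ _ K G T2 g2 T1 0 T2 Kc (env_bounded eG) K0 (env_ge0 eG) gl2 T20 (lexx _) (lexx _).
  by rewrite add0r [T2 + T1]addrC => ->.
Qed.

Lemma reach_wait G T y : 0 <= T -> reach G T y y (G (cell y) * T).
Proof.
move=> T0; split => //; exists (fun x => y + x *: 0); split.
- exact: lip_line.
- by rewrite scaler0 addr0.
- by rewrite scaler0 addr0.
- rewrite (@cost_cst _ _ _ _ _ (G (cell y)))// ?subr0//.
  by move=> x _; rewrite /lagr derive1_line Kz add0r scaler0 addr0.
Qed.

Lemma reach_line G T y z rho k : env G -> 0 <= T -> `|z - y| <= rho * T ->
  (forall w, `|w| <= rho -> K w <= k) -> reach G T y z ((k + dl) * T).
Proof.
move=> eG T0 yz Kk; split => //.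
have [T1|Tn] := eqVneq T 0.
  exists (fun x => y + x *: 0); split.
  - exact: lip_line.
  - by rewrite scaler0 addr0.
  - rewrite scaler0 addr0; move: yz; rewrite T1 mulr0 normr_le0 subr_eq0 => /eqP ->.
    by [].
  - by rewrite cost_empty ?T1 ?mulr0.
have T1 : 0 < T by rewrite lt_neqAle eq_sym Tn.
pose w : V := T^-1 *: (z - y).
have wr : `|w| <= rho by rewrite normrZ normfV (gtr0_norm T1) ler_pdivrMl// mulrC.
exists (fun x => y + x *: w); split.
- exact: lip_line.
- by rewrite scale0r addr0.
- by rewrite scalerA divff// scale1r addrC subrK.
- have gl := @lip_line T y w.
  have cc : continuous (fun _ : V => K w) by exact: cst_continuous.
  have Gd : bounded_cells (d := d) (fun=> dl) by exists dl => k'; rewrite ger0_norm.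
  apply: (@le_trans _ _ (cost (fun=> K w) (fun=> dl) (fun x => y + x *: w) 0 T)).
    rewrite (_ : cost K G _ _ _ = cost (fun=> K w) G (fun x => y + x *: w) 0 T); last first.
      by apply: eq_Rintegral => x _; rewrite /lagr derive1_line.
    apply: (@le_cost _ _ (fun=> K w) (fun=> K w) G (fun=> dl) T _ 0 T) => //.
      exact: env_bounded.
    by move=> k'; have /andP[] := eG k'.
  rewrite (@cost_cst _ _ _ _ _ (K w + dl))// subr0 ler_wpM2r//.
  by rewrite lerD2r Kk.
Qed.

(** The sup norm of the displacement is attained at some coordinate. The linear function of that
    coordinate with slope M and the right sign lies below [K + c], and its cost is the displacement
    times M. *)
Lemma cost_lower G T gam r s M c : env G -> lip_path T gam -> 0 <= M -> 0 <= r -> r <= s -> s <= T ->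
  (forall z, M * `|z| <= K z + c) ->
  M * `|gam s - gam r| - c * (s - r) <= cost K G gam r s.
Proof.
move=> eG gl M0 r0 rs sT KM.
have T0 : 0 <= T by lra.
have c0 : 0 <= c by have := KM 0; rewrite Kz normr0 mulr0 add0r.
have [q0|qn] := eqVneq (gam s - gam r) 0.
  rewrite q0 normr0 mulr0 sub0r (le_trans _ (cost_nonneg _ _ _ eG))//.
  by rewrite oppr_le0 mulr_ge0// subr_ge0.
have [i qi] := rV_norm_coord qn.
pose sg : R := if 0 <= (gam s - gam r) ord0 i then 1 else - 1.
have sgE : sg * (gam s - gam r) ord0 i = `|gam s - gam r|.
  rewrite qi /sg; case: ifPn => [h|]; first by rewrite ger0_norm// mul1r.
  by rewrite -ltNge => h; rewrite ltr0_norm// mulN1r.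
have sgle (u : R) : sg * u <= `|u|.
  by rewrite /sg; case: ifP => _; rewrite ?mul1r ?mulN1r ?ler_norm// -normrN ler_norm.
have cc : continuous (fun z : V => (M * sg) * z ord0 i).
  exact: continuous_coordM.
have kc : continuous (fun _ : V => c) by exact: cst_continuous.
have B0 : bounded_cells (d := d) (fun=> 0 : R) by exists 0 => k; rewrite normr0.
have Kcc : continuous (fun z : V => K z + c).
  by move=> z; apply: continuousD; [exact: Kc|exact: cst_continuous].
have GB := env_bounded eG.
have h1 := @costD _ _ K (fun=> c) G (fun=> 0) T gam r s Kc GB kc B0 gl r0 sT T0.
have h2 := @le_cost _ _ (fun z => (M * sg) * z ord0 i) (fun z => K z + c) (fun=> 0)
  (fun k => G k + 0) T gam r s cc B0 Kcc (bounded_cellsD GB B0) gl r0 sT T0.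
have h3 : cost (fun=> c) (fun=> 0) gam r s = c * (s - r).
  by apply: cost_cst => // x _; rewrite /lagr addr0.
have h4 := @cost_coord _ _ (M * sg) 0 i T gam r s gl r0 rs sT.
have : cost (fun z => (M * sg) * z ord0 i) (fun=> 0) gam r s <= cost K G gam r s + c * (s - r).
  rewrite -h3 -h1; apply: h2 => [z|k]; last by rewrite addr0 env_ge0.
  apply: le_trans (KM z); rewrite -mulrA ler_wpM2l//.
  exact: le_trans (sgle _) (rV_coord_le _ _).
rewrite h4 mul0r addr0 -mulrA (_ : sg * _ = `|gam s - gam r|); last first.
  by rewrite -sgE !mxE.
lra.
Qed.

Hypothesis Ksup : forall M, exists c, forall z, M * `|z| <= K z + c.

Lemma K_lower M : exists2 c, 0 <= c & forall z, M * `|z| <= K z + c.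
Proof.
have [c Hc] := Ksup M; exists c => //.
by have := Hc 0; rewrite Kz normr0 mulr0 add0r.
Qed.

Definition valueG G (g : V -> \bar R) (t : R) (x : V) : \bar R :=
  ereal_sup [set (g (gam t) - (cost K G gam 0 t)%:E)%E | gam in
    [set gam | gam 0 = x /\ lip_path t gam]].

(** Only [B] enters the constants below, which makes them uniform in [g], [x] and [H]. *)
Definition growth (g : V -> \bar R) (x : V) (H B : R) :=
  g x = H%:E /\ forall y, (g y <= (H + B * (1 + `|y - x|))%:E)%E.

(* [H'] is [g (gam t)], which is finite along near-optimal paths. *)
Definition near_opt G (g : V -> \bar R) t x e gam H' :=
  [/\ gam 0 = x, lip_path t gam, g (gam t) = H'%:E &
      fine (valueG G g t x) <= H' - cost K G gam 0 t + e].

Lemma value_reach G g t x z c H' : reach G t x z c -> g z = H'%:E ->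
  ((H' - c)%:E <= valueG G g t x)%E.
Proof.
move=> [t0 [gam [gl gx gz gc]]] Hz.
apply: (@le_trans _ _ (H' - cost K G gam 0 t)%:E); first by rewrite lee_fin lerD2l lerN2.
by apply: ereal_sup_ubound; exists gam => //; rewrite gz Hz EFinB.
Qed.

Lemma value_lower G g x H B t : env G -> growth g x H B -> 0 <= t ->
  ((H - dl * t)%:E <= valueG G g t x)%E.
Proof.
move=> eG [gx _] t0; apply: value_reach gx; apply: reach_le (reach_wait _ _ t0) _.
by rewrite ler_wpM2r//; have /andP[] := eG (cell x).
Qed.

(** Superlinearity lets the cost charge slope B for displacement, which offsets the linear growth of
    [g]. *)
Lemma value_upper (B : R) : 0 <= B -> exists2 A, 0 <= A & forall G g x H t,
  env G -> growth g x H B -> 1 <= t -> (valueG G g t x <= (H + A * t)%:E)%E.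
Proof.
move=> B0; have [c c0 Kc'] := K_lower B.
exists (B + c); first exact: addr_ge0.
move=> G g x H t eG [gx gB] t1; apply: ge_ereal_sup => _ [gam [g0 gl] <-].
have t0 : 0 <= t by lra.
have := @cost_lower G t gam 0 t B c eG gl B0 (lexx _) t0 (lexx _) Kc'.
rewrite subr0 g0 => hc.
apply: (@le_trans _ _ ((H + B * (1 + `|gam t - x|))%:E - (cost K G gam 0 t)%:E)%E).
  exact: leeB.
rewrite -EFinB lee_fin.
have : B <= B * t by rewrite ler_peMr.
by move: hc; rewrite !mulrDr mulr1 mulrDl; lra.
Qed.

Lemma value_fin G g x H B t : 0 <= B -> env G -> growth g x H B -> 1 <= t ->
  valueG G g t x \is a fin_num.
Proof.
move=> B0 eG gr t1; have [A _ HA] := value_upper B0.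
have t0 : 0 <= t by lra.
rewrite fin_numElt; apply/andP; split.
  by apply: lt_le_trans (value_lower eG gr t0); rewrite ltNyr.
by apply: le_lt_trans (HA _ _ _ _ _ eG gr t1) _; rewrite ltry.
Qed.

Lemma value_ge_fin G g x H B t z c H' : 0 <= B -> env G -> growth g x H B -> 1 <= t ->
  reach G t x z c -> g z = H'%:E -> H' - c <= fine (valueG G g t x).
Proof.
move=> B0 eG gr t1 re gz.
by rewrite -lee_fin fineK ?(value_fin B0 eG gr t1)//; exact: value_reach gz.
Qed.

Lemma near_opt_ex G g x H B t e : 0 <= B -> env G -> growth g x H B -> 1 <= t -> 0 < e ->
  exists gam H', near_opt G g t x e gam H'.
Proof.
move=> B0 eG gr t1 e0; have vf := value_fin B0 eG gr t1.
have [_ [gam [g0 gl] <-]] := ub_ereal_sup_adherent e0 vf.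
rewrite -/(valueG G g t x) => hv.
have [gx gB] := gr.
have glt : (g (gam t) < +oo)%E by apply: le_lt_trans (gB _) _; rewrite ltry.
have gfin : g (gam t) \is a fin_num.
  rewrite fin_numElt glt andbT ltNye; apply/eqP => gN.
  by move: hv; rewrite gN addNye -[X in (_ < X)%E]/(-oo)%E ltNge leNye.
exists gam, (fine (g (gam t))); split => //; first by rewrite fineK.
rewrite -(fineK vf) -(fineK gfin) -!EFinB lte_fin in hv.
by lra.
Qed.

(** Slope B + 1 in the lower bound on [K] beats the growth of [g] and leaves one unit of
    displacement, which bounds the end point and then the cost. Slope 1 then bounds the displacement
    at intermediate times by that cost. *)
Lemma near_opt_bounds (B : R) : 0 <= B -> exists2 A, 0 <= A & forall G g x H t e gam H',
  env G -> growth g x H B -> 1 <= t -> e <= 1 -> near_opt G g t x e gam H' ->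
  cost K G gam 0 t <= A * t /\ forall s, 0 <= s <= t -> `|gam s - x| <= A * t.
Proof.
move=> B0; have [c c0 Kc'] := K_lower (B + 1); have [c1 c10 Kc1] := K_lower 1.
pose a := c + B + dl + 1; pose A := B + B * a + dl + 1.
have a0 : 0 <= a by rewrite /a; move: (dl0) => ?; lra.
have Ba : 0 <= B * a by exact: mulr_ge0.
have A0 : 0 <= A by rewrite /A; move: (dl0) => ?; lra.
exists (A + c1); first exact: addr_ge0.
move=> G g x H t e gam H' eG gr t1 e1 [g0 gl gt nopt].
have t0 : 0 <= t by lra.
have vf := value_fin B0 eG gr t1.
have vlow : H - dl * t <= fine (valueG G g t x).
  by rewrite -lee_fin fineK//; exact: value_lower gr t0.
have [_ /(_ (gam t))] := gr; rewrite gt lee_fin => hB.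
have B1 : 0 <= B + 1 by lra.
have := @cost_lower G t gam 0 t (B + 1) c eG gl B1 (lexx _) t0 (lexx _) Kc'.
rewrite subr0 g0 => hc.
have t0B : B <= B * t by rewrite ler_peMr.
have q : `|gam t - x| <= a * t.
  by move: hc hB; rewrite /a !mulrDl !mulrDr !mul1r !mulr1; lra.
have cA : cost K G gam 0 t <= A * t.
  have Bq : B * `|gam t - x| <= B * (a * t) by exact: ler_wpM2l.
  have -> : A * t = B * t + B * (a * t) + dl * t + t by rewrite /A; ring.
  by move: hB; rewrite !mulrDr mulr1; lra.
have c1t : 0 <= c1 * t by exact: mulr_ge0.
split; first by rewrite mulrDl; lra.
move=> s /andP[s0 st].
have := @cost_lower G t gam 0 s 1 c1 eG gl ler01 (lexx _) s0 st Kc1.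
rewrite subr0 g0 mul1r.
have := @cost_split _ _ K G t gam 0 s t Kc (env_bounded eG) gl (lexx _) s0 st (lexx _).
have := @cost_nonneg G gam s t eG.
have : c1 * s <= c1 * t by rewrite ler_wpM2l.
by rewrite mulrDl; lra.
Qed.

Implicit Types (S : 'rV[int]_d -> bool) (g : V -> \bar R) (t e l D kap rho B H q : R) (x p : V).

(** First and last visits need not exist, since cells are not closed. Visits within 1 of the infimum
    and the supremum serve instead, and [tau] over the leftovers at each end is at most [dl]. *)
Lemma visit_span (P : R -> Prop) r s : (exists2 q, r <= q <= s & P q) ->
  exists s1 s2, [/\ r <= s1, s1 <= s2, s2 <= s, P s1 /\ P s2 &
    forall q, r <= q <= s -> P q -> s1 - 1 <= q <= s2 + 1].
Proof.
move=> [q0 q0I Pq0]; pose S : set R := [set q | r <= q <= s /\ P q].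
have S0 : S !=set0 by exists q0.
have Slb : has_lbound S by exists r => q [/andP[]].
have Sub : has_ubound S by exists s => q [/andP[]].
have [a [/andP[ra as_] Pa] ainf] := inf_adherent ltr01 (conj S0 Slb).
have [b [/andP[rb bs] Pb] bsup] := sup_adherent ltr01 (conj S0 Sub).
have key q : S q -> a - 1 <= q <= b + 1.
  move=> Sq; have := ge_inf Slb Sq; have := ub_le_sup Sub Sq => h1 h2.
  by apply/andP; split; lra.
have [ab|ba] := leP a b.
  by exists a, b; split => // q qI Pq; apply: key.
exists b, a; split => //; first exact: ltW.
by move=> q qI Pq; have /andP[h1 h2] := key q (conj qI Pq); apply/andP; split; lra.
Qed.

(* [tau S] is [dl] times the time spent in the cells of [S]. *)
Definition tau (S : 'rV[int]_d -> bool) gam r s : R :=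
  cost (fun=> 0) (fun k => dl * (S k)%:R) gam r s.

Lemma tau_env S : env (fun k => dl * (S k)%:R).
Proof. by move=> k; case: (S k); rewrite ?mulr1 ?mulr0 ?lexx ?dl0. Qed.

Lemma cst0_continuous : continuous (fun _ : V => 0 : R).
Proof. exact: cst_continuous. Qed.

Lemma tau_ge0 S gam r s : 0 <= tau S gam r s.
Proof. by apply: cost_ge0 => // k; have /andP[] := tau_env S k. Qed.

Lemma tau_split S T gam r q s : lip_path T gam -> 0 <= r -> r <= q -> q <= s -> s <= T ->
  tau S gam r s = tau S gam r q + tau S gam q s.
Proof. by apply: cost_split; [exact: cst0_continuous|exact: env_bounded (tau_env S)]. Qed.

Lemma tau_le S T gam r s : lip_path T gam -> 0 <= r -> r <= s -> s <= T ->
  tau S gam r s <= dl * (s - r).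
Proof.
move=> gl r0 rs sT; have T0 : 0 <= T by lra.
rewrite -(@cost_cst (fun=> 0) (fun=> dl) gam r s dl rs) => [|x _]; last by rewrite /lagr add0r.
have Gd : bounded_cells (d := d) (fun=> dl) by exists dl => k'; rewrite ger0_norm.
apply: (le_cost (T := T)) => //; try exact: cst0_continuous.
  exact: env_bounded (tau_env S).
by move=> k; have /andP[] := tau_env S k.
Qed.

Lemma tau_out S gam r s : (forall x : R, r < x < s -> ~~ S (cell (gam x))) -> tau S gam r s = 0.
Proof.
move=> H; have [rs|sr] := leP r s; last by rewrite /tau cost_empty// ltW.
rewrite /tau (@cost_cst _ _ _ _ _ 0)// ?mul0r// => x /H.
by rewrite /lagr => /negbTE ->; rewrite mulr0 addr0.
Qed.

Lemma cost_tau G G' S T gam r s : env G -> env G' -> lip_path T gam -> 0 <= r -> s <= T -> 0 <= T ->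
  (forall k, G' k <= G k + dl * (S k)%:R) ->
  cost K G' gam r s <= cost K G gam r s + tau S gam r s.
Proof.
move=> eG eG' gl r0 sT T0 GG.
have bS := env_bounded (tau_env S).
have := @costD _ _ K (fun=> 0) G (fun k => dl * (S k)%:R) T gam r s Kc (env_bounded eG)
  cst0_continuous bS gl r0 sT T0.
rewrite /tau => <-; apply: (le_cost (T := T)) => //.
- exact: env_bounded.
- by move=> z; apply: continuousD; [exact: Kc|exact: cst_continuous].
- exact: (bounded_cellsD (env_bounded eG) bS).
- by move=> z; rewrite addr0.
Qed.

(** The span of the visits to [S] is either at most [l], and then so is the time in [S] up to 2, or
    it is replaced by a straight line at unit speed in time [D]. The summand [2 * dl] pays for the
    change from [G] to [G'] on the two outer pieces. *)
Lemma detour G G' S t gam r s l D kap : env G -> env G' -> lip_path t gam ->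
  0 <= r -> r <= s -> s <= t -> 0 <= D -> (forall w, `|w| <= 1 -> K w <= kap) ->
  (forall k, G' k <= G k + dl * (S k)%:R) -> 0 <= l ->
  (forall q q', r <= q <= s -> r <= q' <= s -> S (cell (gam q)) -> S (cell (gam q')) ->
     `|gam q - gam q'| <= D) ->
  tau S gam r s <= dl * (l + 2) \/
  exists s1 s2, [/\ r <= s1, s2 <= s, l < s2 - s1, tau S gam r s1 <= dl /\ tau S gam s2 s <= dl &
    reach G' ((s1 - r) + D + (s - s2)) (gam r) (gam s)
      (cost K G gam r s1 + cost K G gam s2 s + (kap + dl) * D + 2 * dl)].
Proof.
move=> eG eG' gl r0 rs st D0 Kk GG l0 SD.
have t0 : 0 <= t by lra.
have d0 := dl0.
have [vis|nvis] := pselect (exists2 q, r <= q <= s & S (cell (gam q))); last first.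
  left; rewrite tau_out; first by apply: mulr_ge0 => //; lra.
  move=> x /andP[rx xs]; apply/negP => Sx; apply: nvis; exists x => //.
  by rewrite !ltW.
have [s1 [s2 [rs1 s12 s2s [S1 S2] span]]] := visit_span vis.
have t1 : tau S gam r s1 <= dl.
  have [h|h] := leP r (s1 - 1).
    rewrite (@tau_split S t gam r (s1 - 1) s1)//; [|lra..].
    rewrite tau_out ?add0r => [|x /andP[rx xs]]; last first.
      have xI : r <= x <= s by apply/andP; split; lra.
      by apply/negP => Sx; have /andP[] := span x xI Sx; lra.
    have := @tau_le S t gam (s1 - 1) s1 gl; rewrite opprB addrCA subrr addr0 mulr1.
    by apply; lra.
  have : tau S gam r s1 <= dl * (s1 - r) by apply: tau_le gl _ _ _; lra.
  have : dl * (s1 - r) <= dl * 1 by apply: ler_wpM2l => //; lra.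
  by rewrite mulr1; lra.
have t2 : tau S gam s2 s <= dl.
  have [h|h] := leP (s2 + 1) s.
    rewrite (@tau_split S t gam s2 (s2 + 1) s)//; [|lra..].
    rewrite [X in _ + X]tau_out ?addr0 => [|x /andP[rx xs]]; last first.
      have xI : r <= x <= s by apply/andP; split; lra.
      by apply/negP => Sx; have /andP[] := span x xI Sx; lra.
    have := @tau_le S t gam s2 (s2 + 1) gl; rewrite addrAC subrr add0r mulr1.
    by apply; lra.
  have : tau S gam s2 s <= dl * (s - s2) by apply: tau_le gl _ _ _; lra.
  have : dl * (s - s2) <= dl * 1 by apply: ler_wpM2l => //; lra.
  by rewrite mulr1; lra.
have [sl|sl] := leP (s2 - s1) l.
  left; rewrite (@tau_split S t gam r s1 s)//; [|lra..].
  rewrite (@tau_split S t gam s1 s2 s)//; [|lra..].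
  have : tau S gam s1 s2 <= dl * (s2 - s1) by apply: tau_le gl _ _ _; lra.
  have : dl * (s2 - s1) <= dl * l by apply: ler_wpM2l.
  by rewrite mulrDr; lra.
right; exists s1, s2; split => //.
have c1 : cost K G' gam r s1 <= cost K G gam r s1 + dl.
  apply: (@le_trans _ _ (cost K G gam r s1 + tau S gam r s1)); last by rewrite lerD2l.
  by apply: cost_tau gl _ _ _ _ => //; lra.
have c2 : cost K G' gam s2 s <= cost K G gam s2 s + dl.
  apply: (@le_trans _ _ (cost K G gam s2 s + tau S gam s2 s)); last by rewrite lerD2l.
  by apply: cost_tau gl _ _ _ _ => //; lra.
have r1 : reach G' (s1 - r) (gam r) (gam s1) (cost K G' gam r s1).
  by apply: reach_sub gl _ _ _ => //; lra.
have r2 : reach G' D (gam s1) (gam s2) ((kap + dl) * D).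
  apply: (@reach_line G' D (gam s1) (gam s2) 1) => //.
  by rewrite mul1r; apply: SD => //; apply/andP; split; lra.
have r3 : reach G' (s - s2) (gam s2) (gam s) (cost K G' gam s2 s).
  by apply: reach_sub gl _ _ _ => //; lra.
apply: reach_le (reach_trans eG' (reach_trans eG' r1 r2) r3) _.
lra.
Qed.

(** This is [detour] with [l = D = 1]. If the span is short, the old path is kept and pays at most
    [3 * dl] more; otherwise the line costs [kap + dl] and the outer pieces [2 * dl]. *)
Lemma compress G G' S t gam r s kap : env G -> env G' -> lip_path t gam ->
  0 <= r -> r <= s -> s <= t -> (forall w, `|w| <= 1 -> K w <= kap) ->
  (forall k, G' k <= G k + dl * (S k)%:R) ->
  (forall q q', r <= q <= s -> r <= q' <= s -> S (cell (gam q)) -> S (cell (gam q')) ->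
     `|gam q - gam q'| <= 1) ->
  exists2 T', T' <= s - r & reach G' T' (gam r) (gam s) (cost K G gam r s + kap + 3 * dl).
Proof.
move=> eG eG' gl r0 rs st Kk GG SD; have t0 : 0 <= t by lra.
have k0 : 0 <= kap by apply: le_trans (K0 0) (Kk 0 _); rewrite normr0.
have d0 := dl0.
have [tl|[s1 [s2 [rs1 s2s s12 _ re]]]] := detour eG eG' gl r0 rs st ler01 Kk GG ler01 SD.
  exists (s - r) => //.
  apply: reach_le (reach_sub eG' gl r0 rs st) _.
  have := cost_tau eG eG' gl r0 st t0 GG; lra.
exists (s1 - r + 1 + (s - s2)); first lra.
apply: reach_le re _; rewrite mulr1.
have cg := env_bounded eG.
have := @cost_split _ _ K G t gam r s1 s Kc cg gl r0 rs1 _ st.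
have := @cost_split _ _ K G t gam s1 s2 s Kc cg gl _ _ s2s st.
have := cost_nonneg gam s1 s2 eG.
move=> h1 h2 h3.
have e2 : cost K G gam s1 s = cost K G gam s1 s2 + cost K G gam s2 s by apply: h2; lra.
have e3 : cost K G gam r s = cost K G gam r s1 + cost K G gam s1 s by apply: h3; lra.
by rewrite e3 e2; clear -h1 k0 d0; lra.
Qed.

(** The path is compressed once before [q] and once after it, whence the factor 2, and the time
    saved is spent at the point that it occupies at time [q]. *)
Lemma infl_visit G G' S g x H B t e gam H' q kap : env G -> env G' ->
  growth g x H B -> 0 <= B -> 1 <= t -> near_opt G g t x e gam H' ->
  (forall w, `|w| <= 1 -> K w <= kap) -> (forall k, G' k <= G k + dl * (S k)%:R) ->
  (forall q q', 0 <= q <= t -> 0 <= q' <= t -> S (cell (gam q)) -> S (cell (gam q')) ->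
     `|gam q - gam q'| <= 1) ->
  0 <= q <= t -> G' (cell (gam q)) = 0 ->
  fine (valueG G g t x) - fine (valueG G' g t x) <= e + 2 * (kap + 3 * dl).
Proof.
move=> eG eG' gr B0 t1 [g0 gl gt nopt] Kk GG SD /andP[q0 qt] Gq.
have t0 : 0 <= t by lra.
have [T1 T1q r1] : exists2 T', T' <= q - 0 & reach G' T' (gam 0) (gam q) (cost K G gam 0 q + kap + 3 * dl).
  apply: (compress (S := S) eG eG' gl) => // a b /andP[h1 h2] /andP[h3 h4].
  by apply: SD; apply/andP; split; lra.
have [T2 T2q r2] : exists2 T', T' <= t - q & reach G' T' (gam q) (gam t) (cost K G gam q t + kap + 3 * dl).
  apply: (compress (S := S) eG eG' gl) => // a b /andP[h1 h2] /andP[h3 h4].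
  by apply: SD; apply/andP; split; lra.
have W0 : 0 <= t - T1 - T2 by lra.
have rw := reach_wait G' (gam q) W0; rewrite Gq mul0r in rw.
have := reach_trans eG' (reach_trans eG' r1 rw) r2.
rewrite (_ : T1 + (t - T1 - T2) + T2 = t); last by ring.
rewrite g0 => re.
have := value_ge_fin B0 eG' gr t1 re gt.
have := @cost_split _ _ K G t gam 0 q t Kc (env_bounded eG) gl (lexx _) q0 qt (lexx _).
lra.
Qed.

Lemma infl_tau G G' S g x H B t e gam H' : env G -> env G' ->
  growth g x H B -> 0 <= B -> 1 <= t -> near_opt G g t x e gam H' ->
  (forall k, G' k <= G k + dl * (S k)%:R) ->
  fine (valueG G g t x) - fine (valueG G' g t x) <= e + tau S gam 0 t.
Proof.
move=> eG eG' gr B0 t1 [g0 gl gt nopt] GG.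
have t0 : 0 <= t by lra.
have := reach_sub eG' gl (lexx _) t0 (lexx _); rewrite subr0 g0 => re.
have := value_ge_fin B0 eG' gr t1 re gt.
have := cost_tau eG eG' gl (lexx _) (lexx _) t0 GG; lra.
Qed.

Lemma infl_near G G' S g x H B t e gam H' p rho kap : env G -> env G' ->
  growth g x H B -> 0 <= B -> 1 <= t -> near_opt G g t x e gam H' ->
  (forall w, `|w| <= 1 -> K w <= kap) -> (forall k, G' k <= G k + dl * (S k)%:R) ->
  (forall q q', 0 <= q <= t -> 0 <= q' <= t -> S (cell (gam q)) -> S (cell (gam q')) ->
     `|gam q - gam q'| <= 1) ->
  `|p - x| <= rho -> G' (cell p) = 0 ->
  fine (valueG G g t x) - fine (valueG G' g t x) <= e + (kap + 3 * dl) * (2 * rho + 1).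
Proof.
move=> eG eG' gr B0 t1 no Kk GG SD px Gp.
have [g0 gl gt nopt] := no.
have t0 : 0 <= t by lra.
have r0 : 0 <= rho by apply: le_trans px.
have k0 : 0 <= kap by apply: le_trans (K0 0) (Kk 0 _); rewrite normr0.
have d0 := dl0.
have kr : 0 <= kap * rho by exact: mulr_ge0.
have dr : 0 <= dl * rho by exact: mulr_ge0.
(* The threshold is the time of the round trip to [p] plus the unit of time of the straight line: a
   longer span frees enough time for both. *)
have l0 : 0 <= 2 * rho + 1 by lra.
have [tl|[s1 [s2 [s10 s2t s12 _ re]]]] := detour eG eG' gl (lexx _) t0 (lexx _) ler01 Kk GG l0 SD.
  have := infl_tau eG eG' gr B0 t1 no GG.
  by lra.
have W0 : 0 <= t - 2 * rho - (s1 - 0 + 1 + (t - s2)) by lra.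
have rw := reach_wait G' p W0; rewrite Gp mul0r in rw.
have ra : reach G' rho x p ((kap + dl) * rho).
  by apply: (@reach_line G' rho x p 1) => //; rewrite mul1r.
have rb : reach G' rho p x ((kap + dl) * rho).
  by apply: (@reach_line G' rho p x 1) => //; rewrite mul1r distrC.
rewrite g0 in re.
have := reach_trans eG' (reach_trans eG' (reach_trans eG' ra rw) rb) re.
set TT := (X in reach G' X); have -> : TT = t by rewrite /TT; ring.
move=> rr; have := value_ge_fin B0 eG' gr t1 rr gt.
have cg := env_bounded eG.
have := @cost_split _ _ K G t gam 0 s1 t Kc cg gl (lexx _) s10 ltac:(lra) (lexx _).
have := @cost_split _ _ K G t gam s1 s2 t Kc cg gl ltac:(lra) ltac:(lra) s2t (lexx _).
have := cost_nonneg gam s1 s2 eG.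
lra.
Qed.

(** Here the environment is unchanged. The piece from [s1] to [s2] competes with a straight line and
    a round trip to [p], so near-optimality bounds the cost of the path on that piece. A cheap piece
    visits few cells. *)
Lemma infl_box G S g x H B t e gam H' p rho D kap : env G ->
  growth g x H B -> 0 <= B -> 1 <= t -> near_opt G g t x e gam H' ->
  (forall w, `|w| <= 1 -> K w <= kap) -> 0 <= D ->
  (forall q q', 0 <= q <= t -> 0 <= q' <= t -> S (cell (gam q)) -> S (cell (gam q')) ->
     `|gam q - gam q'| <= D) ->
  `|p - x| <= rho -> G (cell p) = 0 ->
  tau S gam 0 t <= dl * (D + 2 * rho + 2) \/
  exists s1 s2, [/\ 0 <= s1, s1 <= s2, s2 <= t, tau S gam 0 s1 <= dl /\ tau S gam s2 t <= dl &
    cost K G gam s1 s2 <= e + (kap + dl) * (D + 2 * rho) + 2 * dl].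
Proof.
move=> eG gr B0 t1 no Kk D0 SD px Gp.
have [g0 gl gt nopt] := no.
have t0 : 0 <= t by lra.
have r0 : 0 <= rho by apply: le_trans px.
have d0 := dl0.
have GG k : G k <= G k + dl * (S k)%:R by rewrite lerDl; have /andP[] := tau_env S k.
have l0 : 0 <= D + 2 * rho by lra.
have [tl|[s1 [s2 [s10 s2t s12 tt re]]]] := detour eG eG gl (lexx _) t0 (lexx _) D0 Kk GG l0 SD.
  by left.
right; exists s1, s2; split => //; first lra.
have W0 : 0 <= t - 2 * rho - (s1 - 0 + D + (t - s2)) by lra.
have rw := reach_wait G p W0; rewrite Gp mul0r in rw.
have ra : reach G rho x p ((kap + dl) * rho).
  by apply: (@reach_line G rho x p 1) => //; rewrite mul1r.
have rb : reach G rho p x ((kap + dl) * rho).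
  by apply: (@reach_line G rho p x 1) => //; rewrite mul1r distrC.
rewrite g0 in re.
have := reach_trans eG (reach_trans eG (reach_trans eG ra rw) rb) re.
set TT := (X in reach G X); have -> : TT = t by rewrite /TT; ring.
move=> rr; have := value_ge_fin B0 eG gr t1 rr gt.
have cg := env_bounded eG.
have := @cost_split _ _ K G t gam 0 s1 t Kc cg gl (lexx _) s10 ltac:(lra) (lexx _).
have := @cost_split _ _ K G t gam s1 s2 t Kc cg gl ltac:(lra) ltac:(lra) s2t (lexx _).
lra.
Qed.

Lemma cheap_window G gam t (n : nat) L A : env G -> lip_path t gam -> 0 <= L ->
  (0 < n)%N -> n%:R * L <= t -> cost K G gam 0 (n%:R * L) <= A * (n%:R * L) ->
  exists j : nat, (j < n)%N /\ cost K G gam (j%:R * L) (j.+1%:R * L) <= A * L.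
Proof.
move=> eG gl L0 + + cA; elim: n cA => // n IH cA _ nL.
have nS : n.+1%:R * L = n%:R * L + L by rewrite -natr1 mulrDl mul1r.
have n0 : 0 <= n%:R * L by apply: mulr_ge0.
have [h|h] := leP (cost K G gam (n%:R * L) (n.+1%:R * L)) (A * L).
  by exists n.
have sp : cost K G gam 0 (n.+1%:R * L) = cost K G gam 0 (n%:R * L) + cost K G gam (n%:R * L) (n.+1%:R * L).
  by apply: (cost_split (T := t)) => //; [exact: env_bounded|rewrite nS; lra].
have cn : cost K G gam 0 (n%:R * L) < A * (n%:R * L).
  by move: cA h; rewrite sp nS; clear; lra.
case: n IH nS n0 h sp cn nL cA => [|n] IH nS n0 h sp cn nL cA.
  by move: cn; rewrite mul0r cost_empty// mulr0 ltxx.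
have [|//||j [jn hj]] := IH.
- exact: ltW.
- by move: nL; rewrite nS; lra.
by exists j; split => //; apply: ltnW.
Qed.

(* Some time window of length [2 * l] has cost O(l), hence displacement O(l), and a
   straight line crosses it in time [l]. *)
Lemma timesave A : 0 <= A -> exists2 C, 0 <= C & forall G gam t l,
  env G -> lip_path t gam -> 0 < l -> 4 * l <= t -> cost K G gam 0 t <= A * t ->
  reach G (t - l) (gam 0) (gam t) (cost K G gam 0 t + C * l).
Proof.
move=> A0; have [c c0 Kc1] := K_lower 1.
have [kap Hk] := continuous_rV_bounded (4 * A + 4 * c) Kc.
have k0 : 0 <= kap by apply: le_trans (normr_ge0 _) (Hk 0 _); rewrite normr0; lra.
have d0 := dl0.
exists (4 * (kap + dl)); first lra.
move=> G gam t l eG gl l0 lt4 cA.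
have t0 : 0 < t by lra.
(* The interval is cut into [n] windows of length [L = t / n], between [2 * l] and [4 * l]. The
   cheapest one is crossed in time [L - l], which is at least [l]. *)
pose n := Num.truncn (t / (2 * l)).
have ln : n%:R <= t / (2 * l) < n.+1%:R.
  by apply: truncn_itv; apply: ltW; rewrite divr_gt0//; lra.
have n1 : (0 < n)%N.
  by rewrite truncn_gt0 ler_pdivlMr; lra.
have nR : 1 <= n%:R :> R by rewrite ler1n.
have n0 : 0 < n%:R :> R by lra.
pose L := t / n%:R.
have L2 : 2 * l <= L.
  rewrite /L ler_pdivlMr// mulrC -ler_pdivlMr; last lra.
  by case/andP: ln.
have L4 : L <= 4 * l.
  rewrite /L ler_pdivrMr//.
  have /andP[_] := ln; rewrite ltr_pdivrMr; last lra.
  rewrite -natr1 mulrDl mul1r => h.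
  have : 2 * l <= n%:R * (2 * l) by rewrite ler_peMl//; lra.
  lra.
have nL : n%:R * L = t by rewrite /L mulrC divfK// gt_eqF.
have L0 : 0 <= L by lra.
have [j [jn hj]] : exists j : nat, (j < n)%N /\ cost K G gam (j%:R * L) (j.+1%:R * L) <= A * L.
  by apply: (@cheap_window G gam t n L A eG gl L0 n1); rewrite nL.
set s1 := j%:R * L in hj; set s2 := j.+1%:R * L in hj.
have s12 : s2 = s1 + L by rewrite /s2 /s1 -natr1 mulrDl mul1r.
have s10 : 0 <= s1 by rewrite mulr_ge0.
have s2t : s2 <= t by rewrite -nL ler_wpM2r// ler_nat.
have s1s2 : s1 <= s2 by lra.
have q : `|gam s2 - gam s1| <= (4 * A + 4 * c) * (L - l).
  have := cost_lower eG gl ler01 s10 s1s2 s2t Kc1.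
  have -> : s2 - s1 = L by rewrite s12; ring.
  have h1 : A * L <= A * (4 * l) by rewrite ler_wpM2l.
  have h2 : c * L <= c * (4 * l) by rewrite ler_wpM2l.
  have h3 : (4 * A + 4 * c) * l <= (4 * A + 4 * c) * (L - l) by rewrite ler_wpM2l; lra.
  rewrite mul1r; clear - hj h1 h2 h3; lra.
have r1 := reach_sub eG gl (lexx 0) s10 (le_trans s1s2 s2t).
have r3 := reach_sub eG gl (le_trans s10 s1s2) s2t (lexx _).
have r2 : reach G (L - l) (gam s1) (gam s2) ((kap + dl) * (L - l)).
  apply: (reach_line eG _ q); first lra.
  by move=> w /Hk; apply: le_trans; exact: ler_norm.
have := reach_trans eG (reach_trans eG r1 r2) r3.
have -> : s1 - 0 + (L - l) + (t - s2) = t - l by rewrite s12; ring.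
move=> re; apply: reach_le re _.
have cg := env_bounded eG.
have e1 := @cost_split _ _ K G t gam 0 s1 t Kc cg gl (lexx _) s10 (le_trans s1s2 s2t) (lexx _).
have e2 := @cost_split _ _ K G t gam s1 s2 t Kc cg gl s10 s1s2 s2t (lexx _).
have e3 := cost_nonneg gam s1 s2 eG.
have : (kap + dl) * (L - l) <= (kap + dl) * (4 * l).
  by rewrite ler_wpM2l ?addr_ge0// (le_trans _ L4)// lerBlDr lerDl ltW.
rewrite e1 e2; clear -e3; lra.
Qed.

Lemma lip_addc T gam w : lip_path T gam -> lip_path T (fun s => gam s + w).
Proof. by move=> [L gL]; exists L => s1 s2 h1 h2; rewrite opprD addrACA subrr addr0; exact: gL. Qed.

Lemma reach_translate G T y z c (k : 'rV[int]_d) : reach G T y z c ->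
  reach (fun j => G (j + k)) T (y - map_mx intr k) (z - map_mx intr k) c.
Proof.
move=> [T0 [gam [gl g0 gT gc]]]; split => //.
exists (fun s => gam s - map_mx intr k); split; [exact: lip_addc|by rewrite g0|by rewrite gT|].
rewrite cost_translate; apply: le_trans gc.
by rewrite (@eq_cost _ _ K G _ gam)// => s _; rewrite subrK.
Qed.

Lemma env_translate G (k : 'rV[int]_d) : env G -> env (fun j => G (j + k)).
Proof. by move=> eG j; exact: eG. Qed.

(** Since [g] and [x] stay in place, the translated path must be joined to [x] and led back to the
    old end point. Each walk takes time [m], and [timesave] provides [2 * m]; it requires
    [8 * m <= t]. *)
Lemma value_shift B : 0 <= B -> exists2 C, 0 <= C & forall G g x H t m (k : 'rV[int]_d),
  env G -> growth g x H B -> 1 <= m -> 8 * m <= t -> `|map_mx intr k : V| <= m ->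
  fine (valueG G g t x) - C * m <= fine (valueG (fun j => G (j + k)) g t x).
Proof.
move=> B0; have [A A0 HA] := near_opt_bounds B0; have [C C0 HC] := timesave A0.
have [kap Hk] := continuous_rV_bounded 1 Kc.
have k0 : 0 <= kap by apply: le_trans (normr_ge0 _) (Hk 0 _); rewrite normr0; lra.
have d0 := dl0.
exists (2 * C + 2 * (kap + dl) + 1); first lra.
move=> G g x H t m k eG gr m1 mt km.
have t1 : 1 <= t by lra.
have [gam [H' no]] := near_opt_ex B0 eG gr t1 ltr01.
have [cA _] := HA _ _ _ _ _ _ _ _ eG gr t1 (lexx _) no.
have [g0 gl gt nopt] := no.
have eG' := env_translate k eG.
set G' := fun j => G (j + k).
have r2 : reach G (t - 2 * m) x (gam t) (cost K G gam 0 t + C * (2 * m)).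
  by rewrite -[in X in reach G _ X]g0; apply: HC => //; lra.
have {}r2 := reach_translate k r2.
have Hk1 w : `|w| <= 1 -> K w <= kap by move=> /Hk; apply: le_trans; exact: ler_norm.
have m0 : 0 <= m by lra.
have r1 : reach G' m x (x - map_mx intr k) ((kap + dl) * m).
  by apply: (reach_line eG' m0 (rho := 1)) => //; rewrite mul1r addrAC subrr add0r normrN.
have r3 : reach G' m (gam t - map_mx intr k) (gam t) ((kap + dl) * m).
  by apply: (reach_line eG' m0 (rho := 1)) => //; rewrite mul1r opprB addrC subrK.
have := reach_trans eG' (reach_trans eG' r1 r2) r3.
have -> : m + (t - 2 * m) + m = t by ring.
move=> re; have := value_ge_fin B0 eG' gr t1 re gt.
move: nopt m1; clear; lra.
Qed.

(** With the visits sorted by time, each step moves by at least 1 and so costs at least [lam] minus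
    [c] times its duration; the steps are added up. *)
Lemma count_separated (I : finType) (sig : I -> R) (W : {set I}) G gam t s1 s2 lam c :
  env G -> lip_path t gam -> 0 <= lam -> (forall z, lam * `|z| <= K z + c) ->
  0 <= s1 -> s1 <= s2 -> s2 <= t ->
  (forall i, i \in W -> s1 <= sig i <= s2) ->
  (forall i j, i \in W -> j \in W -> i != j -> 1 <= `|gam (sig i) - gam (sig j)|) ->
  lam * (#|W|%:R - 1) <= cost K G gam s1 s2 + c * (s2 - s1).
Proof.
move=> eG gl l0 Kl s10 s12 s2t sW dW.
have c0 : 0 <= c by have := Kl 0; rewrite Kz normr0 mulr0 add0r.
have cg := env_bounded eG.
have main (l : seq I) (x : I) : path (fun i j => sig i <= sig j) x l -> uniq (x :: l) ->
    (forall i, i \in x :: l -> i \in W) ->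
    lam * (size l)%:R <= cost K G gam (sig x) s2 + c * (s2 - sig x).
  elim: l x => [|y l IH] x /=.
    move=> _ _ xW; have /andP[_ xs] := sW x (xW _ (mem_head _ _)).
    rewrite mulr0 addr_ge0 ?cost_nonneg// mulr_ge0// subr_ge0//.
  move=> /andP[xy pl] /andP[xnl ul] xW.
  have xW' : x \in W by apply: xW; rewrite mem_head.
  have yW' : y \in W by apply: xW; rewrite inE mem_head orbT.
  have /andP[xs1 xs2] := sW _ xW'; have /andP[ys1 ys2] := sW _ yW'.
  have ih := IH y pl ul (fun i il => xW i (mem_behead (s := x :: y :: l) il)).
  have xny : y != x.
    by apply: contraNneq xnl => <-; rewrite mem_head.
  have d1 := dW _ _ yW' xW' xny.
  have cl := cost_lower eG gl l0 (le_trans s10 xs1) xy (le_trans ys2 s2t) Kl.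
  have cs := cost_split Kc cg gl (le_trans s10 xs1) xy ys2 s2t.
  have : lam * 1 <= lam * `|gam (sig y) - gam (sig x)| by rewrite ler_wpM2l.
  rewrite -natr1 cs mulr1 mulrDr mulr1; move: ih cl; clear; lra.
have eW := enum_uniq W.
pose l := sort (fun i j => sig i <= sig j) (enum W).
have ls : sorted (fun i j => sig i <= sig j) l by apply: sort_sorted => i j; exact: le_total.
have lu : uniq l by rewrite sort_uniq.
have lW i : i \in l -> i \in W by rewrite mem_sort mem_enum.
have lsz : size l = #|W| by rewrite size_sort -cardE.
case: l ls lu lW lsz => [|x l] ls lu lW lsz.
  rewrite -lsz /=; have := cost_nonneg gam s1 s2 eG.
  have : 0 <= c * (s2 - s1) by rewrite mulr_ge0// subr_ge0.
  move: l0; clear; lra.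
have := main l x ls lu lW.
have /andP[xs1 xs2] := sW x (lW _ (mem_head _ _)).
have cs := cost_split Kc cg gl s10 xs1 xs2 s2t.
have := cost_nonneg gam s1 (sig x) eG.
have : c * (s2 - sig x) <= c * (s2 - s1) by rewrite ler_wpM2l//; lra.
rewrite -lsz /= cs -natr1; clear; lra.
Qed.

End Reach.

(** * Cells wrapped on a torus *)

Section Torus.
Context {R : realType} {d : nat}.
Local Notation V := 'rV[R]_d.
Implicit Types (y z x : V) (k : 'rV[int]_d).

Lemma cell_itv y i : (cell y ord0 i)%:~R <= y ord0 i < (cell y ord0 i)%:~R + 1.
Proof. by have := floor_itv (y ord0 i); rewrite mxE intrD. Qed.

Lemma cell_close y z (m : R) : 0 <= m ->
  (forall i, `|(cell y ord0 i - cell z ord0 i)%:~R| <= m) -> `|y - z| <= m + 1.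
Proof.
move=> m0 H; apply: rV_norm_le => [|i]; first lra.
have := H i; rewrite !mxE intrB.
have := cell_itv y i; have := cell_itv z i; rewrite !mxE.
by move=> /andP[a1 a2] /andP[b1 b2]; rewrite !ler_norml => /andP[c1 c2]; lra.
Qed.

Lemma same_cell y z : cell y = cell z -> `|y - z| <= 1.
Proof. by move=> e; rewrite -[1]add0r; apply: cell_close => // i; rewrite e subrr normr0. Qed.

Lemma cell_dist y z i : `|(cell y ord0 i - cell z ord0 i)%:~R| <= `|y - z| + 1 :> R.
Proof.
have := rV_coord_le (y - z) i; rewrite !mxE intrB.
have := cell_itv y i; have := cell_itv z i; rewrite !mxE.
by move=> /andP[a1 a2] /andP[b1 b2]; rewrite !ler_norml => /andP[c1 c2]; lra.
Qed.

Lemma cell_parity y z : cell y != cell z ->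
  (forall i, (2 %| cell y ord0 i - cell z ord0 i)%Z) -> 1 <= `|y - z|.
Proof.
move=> ne par; have [i nei] : exists i, cell y ord0 i - cell z ord0 i != 0.
  apply/existsP; apply: contraNT ne; rewrite negb_exists => /forallP H.
  apply/eqP/rowP => i; apply/eqP; rewrite -subr_eq0; apply/eqP.
  by have /negPn/eqP := H i.
have := rV_coord_le (y - z) i; apply: le_trans; rewrite !mxE.
have /dvdzP[q qE] := par i.
have q1 : 1 <= `|q| by rewrite -gtz0_ge1 normr_gt0; apply: contraNneq nei => q0; rewrite qE q0 mul0r.
have : 2 <= `|(cell y ord0 i - cell z ord0 i)%:~R| :> R.
  rewrite qE intrM normrM -intr_norm.
  have : 1 <= `|q|%:~R :> R by rewrite -[1]/(1%:~R) ler_int.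
  by rewrite ger0_norm//; lra.
rewrite intrB.
have := cell_itv y i; have := cell_itv z i; rewrite !mxE.
move=> /andP[a1 a2] /andP[b1 b2].
rewrite !ler_normr => /orP[] h; apply/orP; [left|right]; lra.
Qed.

Variable N : nat.
Hypothesis N1 : (1 < N)%N.
Local Notation lab := 'rV['Z_N]_d.

(** Labels are sites modulo N. Translations by lattice vectors become bijections of a finite set,
    and a region of diameter less than N is still labelled injectively. *)
Definition wrap k : lab := map_mx intr k.

Lemma wrapD k k' : wrap (k + k') = wrap k + wrap k'. Proof. exact: map_mxD. Qed.
Lemma wrapB k k' : wrap (k - k') = wrap k - wrap k'. Proof. exact: map_mxB. Qed.

Lemma intr_Zp_eq0 (j : int) : (j%:~R == 0 :> 'Z_N) -> `|j| < N%:Z -> j = 0.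
Proof.
wlog j0 : j / 0 <= j => [H|].
  have [|jn] := lerP 0 j; first exact: H.
  move=> e jN; apply/eqP; rewrite -oppr_eq0; apply/eqP; apply: H; rewrite ?normrN//.
    by rewrite oppr_ge0 ltW.
  by rewrite intrN oppr_eq0.
case: j j0 => // n _; rewrite -[Posz n]/(n%:Z) => /eqP e nN.
have nN' : (n < N)%N by rewrite -ltz_nat; apply: le_lt_trans nN; rewrite ler_norm.
have := congr1 val e; rewrite /= val_Zp_nat// modn_small//.
by move=> ->.
Qed.

Lemma wrap_inj k k' : (forall i, `|k ord0 i - k' ord0 i| < N%:Z) -> wrap k = wrap k' -> k = k'.
Proof.
move=> H e; apply/eqP; rewrite -subr_eq0; apply/eqP/rowP => i.
have := congr1 (fun l : lab => l ord0 i) (wrapB k k'); rewrite e subrr !mxE => h.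
by apply: intr_Zp_eq0; rewrite ?h//; exact: H.
Qed.

Lemma rowB k k' i : (k - k') ord0 i = k ord0 i - k' ord0 i.
Proof. by rewrite !mxE. Qed.

Section Box.
Variables (x : V) (rad : R) (m : nat).
(** Cells of two points of the ball of radius [rad] differ by at most [2 * rad + 1] in each
    coordinate, and [m] leaves room for the offsets in a box. *)
Hypothesis radN : 2 * rad + 1 + m%:R < N%:R.
Local Notation Z := 'rV['I_m]_d.
Definition offset (o : Z) : 'rV[int]_d := map_mx (fun a : 'I_m => (a : nat)%:Z) o.

Lemma int_ltN (j : int) : `|j%:~R| < N%:R :> R -> `|j| < N%:Z.
Proof. by rewrite -intr_norm -[N%:R]/(N%:Z%:~R) ltr_int. Qed.

Lemma offset_diff (o o' : Z) i : `|(offset o ord0 i - offset o' ord0 i)%:~R| <= m%:R - 1 :> R.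
Proof.
rewrite !mxE intrB; have := ltn_ord (o ord0 i); have := ltn_ord (o' ord0 i).
rewrite -!(ler_nat R) -!natr1 => h1 h2.
have := ler0n R (o ord0 i); have := ler0n R (o' ord0 i).
by rewrite ler_norml; move=> h3 h4; apply/andP; split; lra.
Qed.

Lemma wrap_offset_inj (l : lab) : 0 <= rad -> injective (fun o : Z => l - wrap (offset o)).
Proof.
move=> r0 o o' /addrI/oppr_inj e; have oo : offset o = offset o'.
  apply: wrap_inj e => i; apply: int_ltN; have := offset_diff o o' i; move: radN r0; lra.
apply/rowP => i; apply: val_inj; have := congr1 (fun l : 'rV_d => l ord0 i) oo.
by rewrite !mxE => -[].
Qed.

Lemma cell_wrap_inj y y' : `|y - x| <= rad -> `|y' - x| <= rad ->
  wrap (cell y) = wrap (cell y') -> cell y = cell y'.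
Proof.
move=> yx yx' e.
have yy : `|y - y'| <= 2 * rad.
  have := ler_distD x y y'; rewrite [`|x - y'|]distrC; lra.
apply: wrap_inj e => i; apply: int_ltN; apply: le_lt_trans (cell_dist y y' i) _.
have := ler0n R m; move: radN; lra.
Qed.

Lemma cells_of_box (l : lab) (o o' : Z) y y' : `|y - x| <= rad -> `|y' - x| <= rad ->
  wrap (cell y) = l - wrap (offset o) -> wrap (cell y') = l - wrap (offset o') ->
  cell y - cell y' = offset o' - offset o.
Proof.
move=> yx yx' e e'; have r0 : 0 <= rad by apply: le_trans yx.
have yy : `|y - y'| <= 2 * rad.
  have := ler_distD x y y'; rewrite [`|x - y'|]distrC; lra.
apply: wrap_inj => [i|]; last first.
  by rewrite !wrapB e e' opprB addrC addrA subrK.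
apply: int_ltN; rewrite !rowB.
have := cell_dist y y' i; have := offset_diff o' o i.
have := ler_normD ((cell y ord0 i - cell y' ord0 i)%:~R : R) (- (offset o' ord0 i - offset o ord0 i)%:~R).
rewrite normrN -intrB.
move: radN; lra.
Qed.

Lemma box_close (l : lab) (o o' : Z) y y' : `|y - x| <= rad -> `|y' - x| <= rad ->
  wrap (cell y) = l - wrap (offset o) -> wrap (cell y') = l - wrap (offset o') ->
  `|y - y'| <= m%:R + 1.
Proof.
move=> yx yx' e e'; have H := cells_of_box yx yx' e e'.
apply: cell_close => // i; have := congr1 (fun k : 'rV_d => k ord0 i) H.
rewrite !rowB => ->; have := offset_diff o' o i; lra.
Qed.

End Box.
End Torus.

Lemma dvd2_sub (a b : int) : (2 %| b)%Z = (2 %| a)%Z -> (2 %| a - b)%Z.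
Proof. lia. Qed.

Lemma lower_block (n j M : nat) : (j < n -> 2 * n < M -> (j.+1 <= 2 * n) && (j.+1 < M))%N.
Proof. lia. Qed.

Lemma upper_block (n j M : nat) : (j < n -> 2 * n < M -> ((n + j).+1 <= 2 * n) && ((n + j).+1 < M))%N.
Proof. lia. Qed.

Lemma int_addl_dist (a : int) (j j' M : nat) : (j < M)%N -> (j' < M)%N ->
  `|a + j%:Z - (a + j'%:Z)| < M%:Z.
Proof. lia. Qed.

(** * Influences of the labels on the value *)

Section Influence.
Context {R : realType} {d : nat}.
Local Notation V := 'rV[R]_d.
Variables (K : V -> R) (dl : R).
Hypotheses (Kc : continuous K) (K0 : forall z, 0 <= K z) (Kz : K 0 = 0) (dl0 : 0 <= dl).
Hypothesis (Ksup : forall M, exists c, forall z, M * `|z| <= K z + c).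
Variable N : nat.
Hypothesis N1 : (1 < N)%N.
Local Notation lab := 'rV['Z_N]_d.
Local Notation conf := {ffun lab -> bool}.
Local Notation env := (env dl).
Implicit Types (c : conf) (i l : lab) (gam : R -> V).

Definition envc c (k : 'rV[int]_d) : R := if c (wrap N k) then 0 else dl.

Lemma env_envc c : env (envc c).
Proof. by move=> k; rewrite /envc; case: ifP => _; rewrite ?lexx ?dl0. Qed.

Definition lbl i (k : 'rV[int]_d) := wrap N k == i.

Lemma envc_upd c i b k : envc (upd c i b) k <= envc c k + dl * (lbl i k)%:R.
Proof.
rewrite /envc /lbl; have d0 := dl0; have [->|ne] := eqVneq (wrap N k) i; last by rewrite updN// mulr0 addr0.
by rewrite updE mulr1; case: (b); case: (c i); lra.
Qed.

Lemma tau_labels (S : {set lab}) t gam r s : 0 <= t -> lip_path t gam -> 0 <= r -> s <= t ->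
  \sum_(i in S) tau dl (lbl i) gam r s = tau dl (fun k => wrap N k \in S) gam r s.
Proof.
move=> t0 gl r0 st; rewrite -big_enum /=.
have -> : tau dl (fun k => wrap N k \in S) gam r s = tau dl (fun k => wrap N k \in enum S) gam r s.
  by congr (tau _ _ _ _ _); apply/funext => k; rewrite mem_enum.
elim: (enum S) (enum_uniq S) => [_|i u IH /andP[iu uu]].
  by rewrite big_nil tau_out.
rewrite big_cons IH//.
have b (S' : _ -> bool) : bounded_cells (fun k => dl * (S' k)%:R) by exact: env_bounded (tau_env dl0 S').
rewrite /tau -(@costD _ _ _ _ _ _ t)//; try exact: cst_continuous.
rewrite (_ : (fun _ => 0 + 0) = (fun=> 0)); last by apply/funext => ?; rewrite addr0.
congr (cost _ _ _ _ _); apply/funext => k; rewrite inE /lbl -mulrDr; congr (_ * _).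
by case: eqP => [->|_] /=; rewrite ?(negbTE iu) ?addr0 ?add0r.
Qed.

Variables (g : V -> \bar R) (x : V) (H B t A : R) (m : nat).
Hypotheses (gr : growth g x H B) (B0 : 0 <= B) (t1 : 1 <= t).
Hypothesis (A0 : 0 <= A).
Hypothesis HA : forall G e gam H', env G -> e <= 1 -> near_opt K G g t x e gam H' ->
  forall s, 0 <= s <= t -> `|gam s - x| <= A * t.
Hypothesis radN : 2 * (A * t) + 1 + m%:R < N%:R.
Variable kap : R.
Hypothesis Kk : forall w, `|w| <= 1 -> K w <= kap.

Let t0 : 0 <= t. Proof. by move: t1; lra. Qed.
Let kap0 : 0 <= kap. Proof. by apply: le_trans (K0 0) (Kk _); rewrite normr0. Qed.

Definition cvalue c : R := fine (valueG K (envc c) g t x).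

(** Making a cell good lowers the potential; this is [infl_tau] with no cell at all in [S]. *)
Lemma cvalue_infl_ge0 i c : 0 <= infl i cvalue c.
Proof.
rewrite /infl subr_ge0; apply/ler_addgt0Pr => e e0.
have [gam [H' no]] := near_opt_ex Kc K0 Kz Ksup B0 (env_envc (upd c i false)) gr t1 e0.
rewrite -lerBlDl; apply: le_trans (infl_tau Kc K0 Kz dl0 Ksup (S := fun=> false)
  (env_envc _) (env_envc (upd c i true)) gr B0 t1 no _) _; last by rewrite tau_out// addr0.
move=> k; rewrite mulr0 addr0 /envc; have d0 := dl0.
have [->|ne] := eqVneq (wrap N k) i; first by rewrite !updE.
by rewrite !updN.
Qed.

Lemma cvalue_infl c i : c i -> infl i cvalue c = cvalue c - cvalue (upd c i false).
Proof. by move=> ci; rewrite /infl; congr (cvalue _ - _); rewrite -[RHS](upd_id c i) ci. Qed.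

Lemma envc_good c k : c (wrap N k) -> envc c k = 0.
Proof. by rewrite /envc => ->. Qed.

Lemma envc_upd_good c i k : c (wrap N k) -> wrap N k != i -> envc (upd c i false) k = 0.
Proof. by move=> ck ne; rewrite /envc updN// ck. Qed.

Let kp := kap + 3 * dl.
Let kp0 : 0 <= kp. Proof. by move: dl0 kap0; rewrite /kp; lra. Qed.

Section NearOptimal.
Variables (c : conf) (e : R) (gam : R -> V) (H' : R).
Hypotheses (e0 : 0 < e) (e1 : e <= 1) (no : near_opt K (envc c) g t x e gam H').

Let gl : lip_path t gam. Proof. by case: no. Qed.

Let gx q : 0 <= q <= t -> `|gam q - x| <= A * t.
Proof. exact: (HA (env_envc c) e1 no). Qed.

Let same i q q' : 0 <= q <= t -> 0 <= q' <= t -> lbl i (cell (gam q)) -> lbl i (cell (gam q')) ->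
  `|gam q - gam q'| <= 1.
Proof.
move=> hq hq' /eqP iq /eqP iq'; apply: same_cell.
by apply: (cell_wrap_inj N1 radN (gx hq) (gx hq')); rewrite iq.
Qed.

Lemma infl_le_tau i : c i -> infl i cvalue c <= e + tau dl (lbl i) gam 0 t.
Proof.
move=> ci; rewrite cvalue_infl//.
exact: (infl_tau Kc K0 Kz dl0 Ksup (env_envc c) (env_envc _) gr B0 t1 no (envc_upd c i false)).
Qed.

Lemma infl_le_visit i q : c i -> 0 <= q <= t -> c (wrap N (cell (gam q))) ->
  wrap N (cell (gam q)) != i -> infl i cvalue c <= e + 2 * kp.
Proof.
move=> ci qt cq ne; rewrite cvalue_infl//.
apply: (infl_visit Kc K0 Kz dl0 Ksup (env_envc c) (env_envc _) gr B0 t1 no Kk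
  (envc_upd c i false) (@same i) qt).
exact: envc_upd_good.
Qed.

Lemma infl_le_near i p rho : c i -> `|p - x| <= rho -> c (wrap N (cell p)) ->
  wrap N (cell p) != i -> infl i cvalue c <= e + kp * (2 * rho + 1).
Proof.
move=> ci px cp ne; rewrite cvalue_infl//.
apply: (infl_near Kc K0 Kz dl0 Ksup (env_envc c) (env_envc _) gr B0 t1 no Kk
  (envc_upd c i false) (@same i) px).
exact: envc_upd_good.
Qed.

(* [i0] is a good label met by the path, if there is one: the time saved by compressing the
   visits to another label is then spent at [i0]. Labels that are not met have no influence. *)
Lemma infl_exceptional : exists i0, forall i, c i -> i != i0 -> infl i cvalue c <= e + 2 * kp.
Proof.
have [[q qt cq]|H1] := pselect (exists2 q, 0 <= q <= t & c (wrap N (cell (gam q)))).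
  by exists (wrap N (cell (gam q))) => i ci ne; apply: (infl_le_visit ci qt cq); rewrite eq_sym.
exists 0 => i ci _; apply: le_trans (infl_le_tau ci) _; rewrite lerD2l tau_out ?mulr_ge0//.
move=> q /andP[q0 qt]; apply/negP => /eqP iq; apply: H1; exists q; last by rewrite iq.
by rewrite !ltW.
Qed.

Lemma sum_infl_le (S : {set lab}) : \sum_(i in S | c i) infl i cvalue c <=
  e * #|lab|%:R + tau dl (fun k => wrap N k \in S) gam 0 t.
Proof.
have d0 := dl0.
apply: (@le_trans _ _ (\sum_(i in S) (e + tau dl (lbl i) gam 0 t))).
  rewrite [leRHS](bigID (fun i => c i)) /= -[leLHS]addr0; apply: lerD.
    by apply: ler_sum => i /andP[_ ci]; exact: infl_le_tau.
  by apply: sumr_ge0 => i _; rewrite addr_ge0 ?(tau_ge0 d0)// ltW.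
rewrite big_split /= (tau_labels S t0 gl)// lerD2r sumr_const -[e *+ _]mulr_natr ler_wpM2l ?(ltW e0)//.
by rewrite ler_nat max_card.
Qed.

End NearOptimal.

(** The error [e] is so small that its sum over all labels is at most 1. This keeps the bounds free
    of N. *)
Lemma near_opt_small c : exists (e : R) gam H', [/\ 0 < e, e <= 1, e * #|lab|%:R <= 1 & near_opt K (envc c) g t x e gam H'].
Proof.
pose e : R := (#|lab|%:R + 1)^-1.
have e0 : 0 < e by rewrite invr_gt0 ltr_wpDl.
have [gam [H' no]] := near_opt_ex Kc K0 Kz Ksup B0 (env_envc c) gr t1 e0.
have h : e * #|lab|%:R + e = 1 by rewrite -[X in _ + X]mulr1 -mulrDr mulVf// gt_eqF// ltr_wpDl.
have h1 : 0 <= e * #|lab|%:R by rewrite mulr_ge0// ltW.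
by exists e, gam, H'; split => //; move: h h1 e0; lra.
Qed.

Lemma sum_infl_total c : \sum_(i | c i) infl i cvalue c <= 1 + dl * t.
Proof.
have [e [gam [H' [e0 e1 eN no]]]] := near_opt_small c.
have [_ gl _ _] := no.
have := sum_infl_le e0 no [set: lab].
rewrite (eq_bigl (fun i => c i)); last by move=> i; rewrite inE.
move=> /le_trans; apply; apply: lerD => //.
by have := tau_le dl0 (fun k => wrap N k \in [set: lab]%SET) gl (lexx _) t0 (lexx _); rewrite subr0.
Qed.

(** A crude bound, quadratic in [t], reserved for the unlikely configurations without good cells
    near [x]. *)
Lemma sum_sqr_infl_total c : \sum_(i | c i) infl i cvalue c ^+ 2 <= (1 + dl * t) ^+ 2.
Proof.
have d0 := dl0; have S0 := sum_infl_total c.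
have S1 : 0 <= \sum_(i | c i) infl i cvalue c by apply: sumr_ge0 => i _; exact: cvalue_infl_ge0.
apply: (@le_trans _ _ ((\sum_(i | c i) infl i cvalue c) ^+ 2)); last first.
  by rewrite lerXn2r ?nnegrE//; lra.
rewrite [leRHS]expr2 mulr_suml; apply: ler_sum => i ci.
rewrite expr2 ler_wpM2l ?cvalue_infl_ge0// (bigD1 i)//= lerDl.
by apply: sumr_ge0 => j _; exact: cvalue_infl_ge0.
Qed.

(** Two labels are required because one of them may be the label whose influence is estimated; the
    other then remains good. *)
Definition two_near rho c := exists p1 p2, [/\ `|p1 - x| <= rho, `|p2 - x| <= rho,
  c (wrap N (cell p1)), c (wrap N (cell p2)) & wrap N (cell p1) != wrap N (cell p2)].

Lemma infl_two_near e gam H' rho c i : e <= 1 -> near_opt K (envc c) g t x e gam H' ->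
  two_near rho c -> c i -> infl i cvalue c <= e + kp * (2 * rho + 1).
Proof.
move=> e1 no [p1 [p2 [h1 h2 c1 c2 ne]]] ci.
have [E|E] := eqVneq (wrap N (cell p1)) i.
  by apply: (infl_le_near e1 no ci h2 c2); rewrite -E eq_sym.
exact: (infl_le_near e1 no ci h1 c1 E).
Qed.

(** Apart from one label the squares are at most a constant times the influences, whose sum is
    linear in [t]. The exceptional label contributes the last square. *)
Lemma sum_sqr_infl rho c : 0 <= rho -> two_near rho c ->
  \sum_(i | c i) infl i cvalue c ^+ 2 <=
  (1 + dl * t) * (1 + 2 * kp) + (1 + kp * (2 * rho + 1)) ^+ 2.
Proof.
move=> r0 tn; have d0 := dl0.
have [e [gam [H' [e0 e1 eN no]]]] := near_opt_small c.
have [i0 hi0] := infl_exceptional e1 no.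
have p2 := kp0.
have p1 : 0 <= kp * (2 * rho + 1) by rewrite mulr_ge0 ?kp0//; lra.
apply: (@le_trans _ _ ((\sum_(i | c i) infl i cvalue c * (1 + 2 * kp)) + \sum_(i | i == i0) (1 + kp * (2 * rho + 1)) ^+ 2)).
  rewrite (bigID (fun i => i == i0)) /= addrC; apply: lerD.
    rewrite [leRHS](bigID (fun i => i == i0)) /= -[leLHS]add0r; apply: lerD.
      by apply: sumr_ge0 => i _; rewrite mulr_ge0 ?cvalue_infl_ge0//; lra.
    apply: ler_sum => i /andP[ci ne]; rewrite expr2 ler_wpM2l ?cvalue_infl_ge0//.
    by apply: le_trans (hi0 _ ci ne) _; rewrite lerD2r.
  rewrite [leRHS](bigID (fun i => c i)) /= -[leLHS]addr0; apply: lerD.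
    rewrite [leRHS](eq_bigl (fun i => c i && (i == i0))); last by move=> i; rewrite andbC.
    apply: ler_sum => i /andP[ci _]; rewrite lerXn2r ?nnegrE ?cvalue_infl_ge0//; first lra.
    by apply: le_trans (infl_two_near e1 no tn ci) _; rewrite lerD2r.
  by apply: sumr_ge0 => i _; exact: sqr_ge0.
rewrite -mulr_suml big_pred1_eq lerD2r ler_wpM2r//; first lra.
exact: sum_infl_total.
Qed.

(** The influence of [l] on the averaged function involves the influences of the labels [l] minus an
    offset, whence the sign. *)
Definition box l : {set lab} := [set l - wrap N (offset o) | o : 'rV['I_m]_d].

(* Two distinct cells of equal parities are at distance at least 1. *)
Lemma card_visited e gam H' l (W : {set lab}) s1 s2 lam lc :
  e <= 1 -> forall c, near_opt K (envc c) g t x e gam H' -> 0 < lam -> (forall z, lam * `|z| <= K z + lc) ->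
  0 <= s1 -> s1 <= s2 -> s2 <= t ->
  (forall i, i \in W -> i \in box l /\ exists q, s1 <= q <= s2 /\ wrap N (cell (gam q)) = i) ->
  #|W|%:R <= 2 ^+ d * (1 + (cost K (envc c) gam s1 s2 + lc * t) / lam).
Proof.
move=> e1 c no l0 Kl s10 s12 s2t HW; have [_ gl _ _] := no.
have lc0 : 0 <= lc by have := Kl 0; rewrite Kz normr0 mulr0 add0r.
have HWs i : exists q : R, i \in W -> s1 <= q <= s2 /\ wrap N (cell (gam q)) = i.
  by have [/HW[_ [q hq]]|_] := boolP (i \in W); [exists q|exists 0].
have [sig hs] := choice HWs.
pose par i : {ffun 'I_d -> bool} := [ffun j => (2 %| cell (gam (sig i)) ord0 j)%Z].
have cW f : #|[set i in W | par i == f]|%:R <= 1 + (cost K (envc c) gam s1 s2 + lc * t) / lam.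
  rewrite -lerBlDl ler_pdivlMr// mulrC.
  apply: le_trans (@count_separated _ _ K dl Kc K0 Kz _ sig [set i in W | par i == f] (envc c) gam t s1 s2 lam lc
    (env_envc c) gl (ltW l0) Kl s10 s12 s2t _ _) _.
  - by move=> i; rewrite inE => /andP[/(hs i)[]].
  - move=> i j; rewrite !inE => /andP[iW /eqP pi] /andP[jW /eqP pj] ne.
    have [qi ei] := hs i iW; have [qj ej] := hs j jW.
    apply: cell_parity => [|a]; first by apply: contraNneq ne => E; rewrite -ei -ej E.
    have := congr1 (fun h : {ffun 'I_d -> bool} => h a) pi; rewrite -pj !ffunE => hp.
    exact: dvd2_sub.
  - by rewrite lerD2l ler_wpM2l//; lra.
rewrite -sum1_card natr_sum (partition_big par xpredT)//=.
have -> : 2 ^+ d = #|{ffun 'I_d -> bool}|%:R :> R.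
  by rewrite card_ffun card_bool card_ord natrX.
rewrite mulr_natl -sumr_const; apply: ler_sum => f _.
apply: le_trans (cW f); rewrite -natr_sum sum1dep_card ler_nat subset_leq_card//.
Qed.

(** If the path spends little time in the box, that time bounds the sum. Otherwise the piece from
    [s1] to [s2] is cheap: the labels that it meets are few and, but for one, of bounded influence.
    The remaining labels of the box are met only before [s1] or after [s2], where the time spent in
    the box is bounded. *)
Lemma sum_infl_box lam lc rho c l : 0 < lam -> (forall z, lam * `|z| <= K z + lc) ->
  0 <= rho -> two_near rho c ->
  \sum_(i in box l | c i) infl i cvalue c <=
   (1 + dl * (m%:R + 1 + 2 * rho + 2)) + (1 + 2 * dl) +
   (2 ^+ d * (1 + (1 + (kap + dl) * (m%:R + 1 + 2 * rho) + 2 * dl + lc * t) / lam) * (1 + 2 * kp)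
     + (1 + kp * (2 * rho + 1))).
Proof.
move=> l0 Kl r0 tn; have d0 := dl0; have k0 := kap0; have p0 := kp0.
have lc0 : 0 <= lc by have := Kl 0; rewrite Kz normr0 mulr0 add0r.
have [e [gam [H' [e0 e1 eN no]]]] := near_opt_small c.
have [_ gl _ _] := no.
have [i0 hi0] := infl_exceptional e1 no.
have gx q : 0 <= q <= t -> `|gam q - x| <= A * t by exact: (HA (env_envc c) e1 no).
have p1 : 0 <= kp * (2 * rho + 1) by rewrite mulr_ge0//; lra.
have m0 : 0 <= m%:R :> R by [].
have T1 : 0 <= dl * (m%:R + 1 + 2 * rho + 2) by rewrite mulr_ge0//; lra.
have T3 : 0 <= (kap + dl) * (m%:R + 1 + 2 * rho) by rewrite mulr_ge0//; lra.
have T4 : 0 <= lc * t by rewrite mulr_ge0.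
have T2 : 0 <= 2 ^+ d * (1 + (1 + (kap + dl) * (m%:R + 1 + 2 * rho) + 2 * dl + lc * t) / lam) * (1 + 2 * kp).
  by rewrite !mulr_ge0 ?exprn_ge0//; [rewrite addr_ge0// divr_ge0 ?ltW//; lra|lra].
have SD q q' : 0 <= q <= t -> 0 <= q' <= t -> wrap N (cell (gam q)) \in box l ->
    wrap N (cell (gam q')) \in box l -> `|gam q - gam q'| <= m%:R + 1.
  move=> hq hq' /imsetP[b1 _ ho] /imsetP[b2 _ ho'].
  exact: (box_close N1 radN (gx _ hq) (gx _ hq') ho ho').
have [p [_ [px _ cp _ _]]] := tn.
have D0 : 0 <= m%:R + 1 :> R by lra.
have [h|[s1 [s2 [s10 s12 s2t [ta tb] cst]]]] := infl_box Kc K0 Kz dl0 Ksup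
  (S := fun k => wrap N k \in box l) (env_envc c) gr B0 t1 no Kk D0 SD px (envc_good cp).
  have := sum_infl_le e0 no (box l); lra.
(* The labels of the box that the cheap piece meets. *)
pose W : {set lab} := [set i in box l | `[< exists q, s1 <= q <= s2 /\ wrap N (cell (gam q)) = i >]].
have cW : #|W|%:R <= 2 ^+ d * (1 + (cost K (envc c) gam s1 s2 + lc * t) / lam).
  by apply: (card_visited (l := l) e1 no l0 Kl s10 s12 s2t) => i; rewrite inE => /andP[? /asboolP].
rewrite (bigID (fun i => i \in W)) /= addrC.
set T := 2 ^+ d * _ * _ in T2 *; rewrite -addrA [leRHS]addrC -addrA addrC.
have X1 : \sum_(i in box l | c i && (i \notin W)) infl i cvalue c <= 1 + 2 * dl.
  apply: (@le_trans _ _ (\sum_(i in box l) (e + tau dl (lbl i) gam 0 s1 + tau dl (lbl i) gam s2 t))).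
    rewrite [leRHS](bigID (fun i => c i && (i \notin W))) /= -[leLHS]addr0; apply: lerD.
      apply: ler_sum => i /andP[iB /andP[ci iW]].
      apply: le_trans (infl_le_tau no ci) _; rewrite -addrA lerD2l.
      rewrite (tau_split dl0 (lbl i) gl (lexx _) s10 (le_trans s12 s2t) (lexx _)) lerD2l.
      rewrite (tau_split dl0 (lbl i) gl s10 s12 s2t (lexx _)) (tau_out _ (r := s1)) ?add0r// => q /andP[h1 h2].
      apply: contra iW => /eqP iq; rewrite inE iB; apply/asboolP; exists q; split => //.
      by rewrite !ltW.
    by apply: sumr_ge0 => i _; rewrite !addr_ge0 ?(tau_ge0 d0)// ltW.
  rewrite !big_split /= (tau_labels _ t0 gl)//; last exact: le_trans s12 s2t.
  rewrite (tau_labels _ t0 gl)//; last exact: le_trans s12.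
  rewrite sumr_const -[e *+ _]mulr_natr.
  have : e * #|box l|%:R <= e * #|lab|%:R by rewrite ler_wpM2l ?(ltW e0)// ler_nat max_card.
  by move: ta tb eN; rewrite /=; lra.
have X2 : \sum_(i in W | c i) infl i cvalue c <= T + (1 + kp * (2 * rho + 1)).
  rewrite (bigID (fun i => i == i0)) /= addrC; apply: lerD.
    apply: (@le_trans _ _ (\sum_(i in W) (1 + 2 * kp))).
      rewrite [leRHS](bigID (fun i => c i && (i != i0))) /= -[leLHS]addr0; apply: lerD.
        rewrite [leRHS](eq_bigl (fun i => (i \in W) && c i && (i != i0))); last by move=> i; rewrite andbA.
        apply: ler_sum => i /andP[/andP[_ ci] ne].
        by apply: le_trans (hi0 _ ci ne) _; rewrite lerD2r.
      by apply: sumr_ge0 => i _; lra.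
    rewrite sumr_const -[(1 + _) *+ _]mulr_natl /T ler_wpM2r//; first lra.
    apply: le_trans cW _; rewrite ler_wpM2l ?exprn_ge0// lerD2l ler_wpM2r ?invr_ge0 ?(ltW l0)//.
    lra.
  apply: (@le_trans _ _ (\sum_(i | i == i0) (1 + kp * (2 * rho + 1)))); last by rewrite big_pred1_eq.
  rewrite [leRHS](bigID (fun i => (i \in W) && c i)) /= -[leLHS]addr0; apply: lerD.
    rewrite [leRHS](eq_bigl (fun i => (i \in W) && c i && (i == i0))); last by move=> i; rewrite andbC.
    apply: ler_sum => i /andP[/andP[_ ci] _].
    by apply: le_trans (infl_two_near e1 no tn ci) _; rewrite lerD2r.
  by apply: sumr_ge0 => i _; lra.
have -> : \sum_(i | (i \in box l) && c i && (i \in W)) infl i cvalue c = \sum_(i in W | c i) infl i cvalue c.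
  by apply: eq_bigl => i; rewrite !inE; case: (i \in box l) => //=; rewrite andbC.
have -> : \sum_(i | (i \in box l) && c i && (i \notin W)) infl i cvalue c =
    \sum_(i in box l | c i && (i \notin W)) infl i cvalue c.
  by apply: eq_bigl => i; rewrite andbA.
move: X1 X2 T1; lra.
Qed.

Section Probability.
Variables (al : R) (i1 : 'I_d) (n : nat).
Hypotheses (al0 : 0 < al) (al1 : al < 1) (nN : (2 * n < N)%N).

Definition site (j : nat) : V := x + j%:R *: delta_mx ord0 i1.

Lemma site_dist j : `|site j - x| <= j%:R.
Proof.
rewrite /site addrAC subrr add0r; apply: rV_norm_le => // i; rewrite !mxE eqxx /=.
by case: eqP; rewrite ?mulr1 ?mulr0 ?normr0// ger0_norm.
Qed.

Lemma site_label_inj j j' : (j < N)%N -> (j' < N)%N ->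
  wrap N (cell (site j)) = wrap N (cell (site j')) -> j = j'.
Proof.
move=> jN jN' e.
have cE (i : 'I_d) (l : nat) : cell (site l) ord0 i = cell x ord0 i + (if i == i1 then l%:Z else 0).
  rewrite !mxE eqxx /=; case: eqP => _; last by rewrite mulr0 !addr0.
  by rewrite mulr1 -[l%:R]/(l%:Z%:~R) floorDrz ?intr_int// intrKfloor.
have ce : cell (site j) = cell (site j').
  apply: wrap_inj e => // i; rewrite !cE; case: eqP => _; first exact: int_addl_dist.
  by rewrite subrr normr0 ltz_nat (leq_ltn_trans _ jN).
by have := congr1 (fun k : 'rV_d => k ord0 i1) ce; rewrite !cE eqxx => /addrI [].
Qed.

(** Two disjoint blocks of [n] consecutive sites along a coordinate axis from [x], each containing a
    good one. Since [2 * n < N], the two good labels are distinct. *)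
Definition near_ev c := [exists j : 'I_n, c (wrap N (cell (site j.+1)))] &&
  [exists j : 'I_n, c (wrap N (cell (site (n + j).+1)))].

Lemma near_ev_two c : near_ev c -> two_near (2 * n%:R) c.
Proof.
move=> /andP[/existsP[j cj] /existsP[j' cj']].
exists (site j.+1), (site (n + j').+1); split => //.
- by apply: le_trans (site_dist _) _; rewrite -natrM ler_nat; have /andP[] := lower_block (ltn_ord j) nN.
- by apply: le_trans (site_dist _) _; rewrite -natrM ler_nat; have /andP[] := upper_block (ltn_ord j') nN.
- have /andP[_ h] := lower_block (ltn_ord j) nN; have /andP[_ h'] := upper_block (ltn_ord j') nN.
  apply/eqP => /(site_label_inj h h') [] E.
  by have := ltn_ord j; rewrite E ltnNge leq_addr.
Qed.

Lemma expect_no_good (h : 'I_n -> nat) : injective h -> (forall j, h j < N)%N ->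
  expect al (fun c => (~~ [exists j, c (wrap N (cell (site (h j))))])%:R) = (1 - al) ^+ n.
Proof.
move=> hi hN; pose S := [set wrap N (cell (site (h j))) | j : 'I_n].
have Sn : #|S| = n.
  rewrite card_imset ?card_ord// => j j' /site_label_inj E; apply: hi; exact: E.
rewrite -[in RHS]Sn -(expect_none al S); apply: eq_expect => c; congr (nat_of_bool _)%:R.
rewrite negb_exists; apply/idP/idP => /forallP H1; apply/forallP.
  by move=> l; apply/implyP => /imsetP[j _ ->].
by move=> j; apply: (implyP (H1 _)); apply: imset_f.
Qed.

Lemma expect_near_ev : expect al (fun c => (~~ near_ev c)%:R) <= 2 * (1 - al) ^+ n.
Proof.
rewrite mulr_natl mulr2n -[X in X + _](@expect_no_good (fun j => j.+1)).
- rewrite -[X in _ + X](@expect_no_good (fun j => (n + j).+1)).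
  + rewrite -expectD; apply: le_expect => // c; rewrite /near_ev negb_and.
    by do 2 case: (~~ _) => /=; lra.
  + by move=> j j' [] /addnI/val_inj.
  + by move=> j; have /andP[] := upper_block (ltn_ord j) nN.
- by move=> j j' [] /val_inj.
- by move=> j; have /andP[] := lower_block (ltn_ord j) nN.
Qed.

Lemma expect_split (X : conf -> R) b1 b2 : 0 <= b1 -> 0 <= b2 ->
  (forall c, near_ev c -> X c <= b1) -> (forall c, X c <= b2) ->
  expect al X <= b1 + 2 * (1 - al) ^+ n * b2.
Proof.
move=> b10 b20 H1 H2.
apply: (@le_trans _ _ (expect al (fun c => b1 + b2 * (~~ near_ev c)%:R))).
  apply: le_expect => // c; case: (boolP (near_ev c)) => [/H1|_] /=; rewrite ?mulr0 ?addr0// mulr1.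
  by have := H2 c; lra.
rewrite expectD expect_cst expectZ lerD2l mulrC ler_wpM2r//; exact: expect_near_ev.
Qed.

Lemma sum_expect_given (S : pred lab) (phi : lab -> conf -> R) :
  (forall i c b, phi i (upd c i b) = phi i c) ->
  \sum_(i | S i) expect al (phi i) = al^-1 * expect al (fun c => \sum_(i | S i && c i) phi i c).
Proof.
move=> Hp.
rewrite (eq_expect al (g := fun c => \sum_(i | S i) (if c i then phi i c else 0))).
  by rewrite expect_sum mulr_sumr; apply: eq_bigr => i _; exact: expect_given.
by move=> c; rewrite big_mkcondr.
Qed.

Lemma infl_upd i (f : conf -> R) c b : infl i f (upd c i b) = infl i f c.
Proof. by rewrite /infl !updK. Qed.

Lemma energy_cvalue : energy al cvalue <= al^-1 *
((1 + dl * t) * (1 + 2 * kp) + (1 + kp * (2 * (2 * n%:R) + 1)) ^+ 2 + 2 * (1 - al) ^+ n * (1 + dl * t) ^+ 2).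
Proof.
rewrite /energy sum_expect_given => [|i c b]; last by rewrite infl_upd.
have d0 := dl0; have p0 := kp0; have n0 : 0 <= n%:R :> R by [].
have dt : 0 <= dl * t by rewrite mulr_ge0.
rewrite ler_pM2l ?invr_gt0//; apply: expect_split => [|||c].
- by rewrite addr_ge0 ?sqr_ge0// mulr_ge0//; lra.
- exact: sqr_ge0.
- by move=> c /near_ev_two tn; apply: (sum_sqr_infl _ tn); lra.
- exact: sum_sqr_infl_total.
Qed.

Lemma norm_infl_cvalue i c : `|infl i cvalue c| = infl i cvalue c.
Proof. by rewrite ger0_norm// cvalue_infl_ge0. Qed.

Lemma sum_expect_infl : \sum_i expect al (fun c => `|infl i cvalue c|) <= al^-1 * (1 + dl * t).
Proof.
rewrite sum_expect_given => [|i c b]; last by rewrite infl_upd.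
rewrite ler_pM2l ?invr_gt0// -[leRHS](expect_cst lab al); apply: le_expect => // c.
by rewrite (eq_bigr _ (fun i _ => norm_infl_cvalue i c)) sum_infl_total.
Qed.

Lemma sum_expect_infl_box lam lc l : 0 < lam -> (forall z, lam * `|z| <= K z + lc) ->
  \sum_(i in box l) expect al (fun c => `|infl i cvalue c|) <= al^-1 *
   ((1 + dl * (m%:R + 1 + 2 * (2 * n%:R) + 2)) + (1 + 2 * dl) +
   (2 ^+ d * (1 + (1 + (kap + dl) * (m%:R + 1 + 2 * (2 * n%:R)) + 2 * dl + lc * t) / lam) * (1 + 2 * kp)
     + (1 + kp * (2 * (2 * n%:R) + 1))) + 2 * (1 - al) ^+ n * (1 + dl * t)).
Proof.
move=> l0 Kl; rewrite sum_expect_given => [|i c b]; last by rewrite infl_upd.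
have d0 := dl0; have p0 := kp0; have n0 : 0 <= n%:R :> R by []; have m0 : 0 <= m%:R :> R by [].
have k0 := kap0.
have dt : 0 <= dl * t by rewrite mulr_ge0.
have lc0 : 0 <= lc by have := Kl 0; rewrite Kz normr0 mulr0 add0r.
have S1 c : \sum_(i in box l | c i) `|infl i cvalue c| = \sum_(i in box l | c i) infl i cvalue c.
  by apply: eq_bigr => i _; exact: norm_infl_cvalue.
rewrite ler_pM2l ?invr_gt0//; apply: expect_split => [|||c].
- have : 0 <= lc * t by rewrite mulr_ge0.
  have : 0 <= (kap + dl) * (m%:R + 1 + 2 * (2 * n%:R)) by rewrite mulr_ge0//; lra.
  move=> h1 h2; rewrite !(addr_ge0, mulr_ge0) ?exprn_ge0 ?invr_ge0 ?(ltW l0)//; lra.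
- lra.
- by move=> c /near_ev_two tn; rewrite S1; apply: sum_infl_box => //; lra.
- rewrite S1; apply: le_trans (sum_infl_total c).
  rewrite [leRHS](bigID (fun i => i \in box l)) /= -[leLHS]addr0; apply: lerD.
    by under eq_bigl do rewrite andbC.
  by apply: sumr_ge0 => i _; exact: cvalue_infl_ge0.
Qed.

End Probability.

End Influence.

(** * Averaging over translations of the torus *)

Section Translations.
Context {R : realType} {L : finZmodType}.
Variable al : R.
Hypotheses (al0 : 0 < al) (al1 : al < 1).
Local Notation conf := {ffun L -> bool}.
Implicit Types (c : conf) (i l : L) (f : conf -> R).

Definition shift_conf l c : conf := [ffun i => c (i + l)].

Lemma shift_upd l c i b : shift_conf l (upd c i b) = upd (shift_conf l c) (i - l) b.
Proof. by apply/ffunP => j; rewrite !ffunE eq_sym -subr_eq eq_sym; case: eqP. Qed.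

Lemma infl_shift i l f c : infl i (f \o shift_conf l) c = infl (i - l) f (shift_conf l c).
Proof. by rewrite /infl /= !shift_upd. Qed.

Lemma shift_confK l : cancel (shift_conf l) (shift_conf (- l)).
Proof. by move=> c; apply/ffunP => i; rewrite !ffunE subrK. Qed.

Lemma shift_confVK l : cancel (shift_conf (- l)) (shift_conf l).
Proof. by move=> c; apply/ffunP => i; rewrite !ffunE addrK. Qed.

Lemma expect_shift l f : expect al (f \o shift_conf l) = expect al f.
Proof.
rewrite /expect [RHS](reindex (shift_conf l)) /=; last first.
  by exists (shift_conf (- l)) => c _; [exact: shift_confK|exact: shift_confVK].
apply: eq_bigr => c _; congr (_ * _); rewrite /weight (reindex (fun i => i + l)) /=.
  by apply: eq_bigr => i _; rewrite ffunE.
by exists (fun i => i - l) => i _; rewrite ?addrK ?subrK.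
Qed.

Lemma sum_subr l (h : L -> R) : \sum_i h (i - l) = \sum_i h i.
Proof.
rewrite [RHS](reindex (fun i => i - l)) //=.
by exists (fun i => i + l) => i _; rewrite ?addrK ?subrK.
Qed.

Lemma energy_shift l f : energy al (f \o shift_conf l) = energy al f.
Proof.
rewrite /energy -(sum_subr l (fun i => expect al (fun c => infl i f c ^+ 2))).
apply: eq_bigr => i _; rewrite -[RHS](expect_shift l); apply: eq_expect => c /=.
by rewrite infl_shift.
Qed.

Section Average.
Context {Z : finType} (s : Z -> L).
Hypothesis Z0 : (0 < #|Z|)%N.
Let nZ : R := #|Z|%:R.
Let nZ0 : 0 < nZ. Proof. by rewrite ltr0n. Qed.

Definition shift_avg f c : R := nZ^-1 * \sum_o f (shift_conf (s o) c).

Lemma sqr_sum_le (a : Z -> R) : (\sum_o a o) ^+ 2 <= nZ * \sum_o a o ^+ 2.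
Proof.
have E : nZ * (\sum_o a o ^+ 2) = \sum_o \sum_o' (a o ^+ 2 + a o' ^+ 2) / 2.
  transitivity (\sum_o (nZ * a o ^+ 2 + \sum_o' a o' ^+ 2) / 2); last first.
    apply: eq_bigr => o _; rewrite -mulr_suml big_split /= sumr_const.
    by rewrite -[X in _ = (X + _) / _]mulr_natl.
  rewrite -mulr_suml big_split /= -mulr_sumr sumr_const -[X in _ + X]mulr_natl -/nZ.
  by field.
rewrite E expr2 mulr_suml; apply: ler_sum => o _; rewrite mulr_sumr; apply: ler_sum => o' _.
by have := sqr_ge0 (a o - a o'); rewrite sqrrB; lra.
Qed.

Lemma infl_shift_avg i f c : infl i (shift_avg f) c = nZ^-1 * \sum_o infl (i - s o) f (shift_conf (s o) c).
Proof.
rewrite /infl /shift_avg -mulrBr -sumrB; congr (_ * _); apply: eq_bigr => o _.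
by rewrite !shift_upd.
Qed.

Lemma expect_shift_avg f : expect al (shift_avg f) = expect al f.
Proof.
rewrite /shift_avg expectZ expect_sum.
under eq_bigr do rewrite (expect_shift _ f).
by rewrite sumr_const -[_ *+ _]mulr_natl mulKf// gt_eqF.
Qed.

(** The energy is a convex function, by Cauchy-Schwarz, and it is invariant under translations. *)
Lemma energy_shift_avg f : energy al (shift_avg f) <= energy al f.
Proof.
apply: (@le_trans _ _ (\sum_i expect al (fun c => nZ^-1 * \sum_o infl (i - s o) f (shift_conf (s o) c) ^+ 2))).
  apply: ler_sum => i _; apply: le_expect => // c; rewrite infl_shift_avg exprMn.
  rewrite -[X in X * _]mulr1 expr2 -!mulrA ler_pM2l ?invr_gt0// mul1r mulrC ler_pdivrMr// mulrC.
  exact: sqr_sum_le.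
under eq_bigr do rewrite expectZ expect_sum.
rewrite -mulr_sumr exchange_big /=.
rewrite (eq_bigr (fun=> energy al f)) => [|o _].
  by rewrite sumr_const -[_ *+ _]mulr_natl mulKf// gt_eqF.
rewrite -(energy_shift (s o)); apply: eq_bigr => i _; apply: eq_expect => c.
by rewrite infl_shift.
Qed.

Lemma expect_infl_shift_avg i f : expect al (fun c => `|infl i (shift_avg f) c|) <=
  nZ^-1 * \sum_o expect al (fun c => `|infl (i - s o) f c|).
Proof.
apply: (@le_trans _ _ (expect al (fun c => nZ^-1 * \sum_o `|infl (i - s o) f (shift_conf (s o) c)|))).
  apply: le_expect => // c; rewrite infl_shift_avg normrM gtr0_norm ?invr_gt0// ler_pM2l ?invr_gt0//.
  exact: ler_norm_sum.
rewrite expectZ expect_sum ler_pM2l ?invr_gt0//; apply: ler_sum => o _.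
by rewrite -(expect_shift (s o) (fun c => `|infl (i - s o) f c|)).
Qed.

Lemma sum_infl_shift_avg f : \sum_i expect al (fun c => `|infl i (shift_avg f) c|) <=
  \sum_i expect al (fun c => `|infl i f c|).
Proof.
apply: (le_trans (ler_sum _ (fun i _ => expect_infl_shift_avg i f))).
rewrite -mulr_sumr exchange_big /=.
rewrite (eq_bigr (fun=> \sum_i expect al (fun c => `|infl i f c|))) => [|o _].
  by rewrite sumr_const -[_ *+ _]mulr_natl mulKf// gt_eqF.
exact: (sum_subr (s o) (fun i => expect al (fun c => `|infl i f c|))).
Qed.

(** Each L1 influence of the average is at most [Q / nZ], so the sum of their squares is at most
    this times their sum. The average is within [D] of [f], and the factors 2 come from (a + b)^2 <=
    2 a^2 + 2 b^2. *)
Lemma variance_shift f lam Q D : 1 < lam -> 0 <= Q ->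
  (forall i, \sum_o expect al (fun c => `|infl (i - s o) f c|) <= Q) ->
  (forall o c, `|f (shift_conf (s o) c) - f c| <= D) ->
  variance_fin al f <= 2 / ln lam * (2 * energy al f +
    lam * (Q / nZ * \sum_i expect al (fun c => `|infl i f c|))) + 2 * D ^+ 2.
Proof.
move=> lam1 Q0 HQ HD; have lam0 : 0 < lam by lra.
have ll : 0 < ln lam by rewrite ln_gt0.
have D1 c : `|shift_avg f c - f c| <= D.
  have -> : shift_avg f c - f c = nZ^-1 * \sum_o (f (shift_conf (s o) c) - f c).
    rewrite sumrB mulrBr sumr_const -[f c *+ _]mulr_natl mulKf//; exact: lt0r_neq0.
  rewrite normrM gtr0_norm ?invr_gt0// ler_pdivrMl// mulrC.
  apply: le_trans (ler_norm_sum _ _ _) _; apply: (le_trans (ler_sum _ (fun o _ => HD o c))).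
  by rewrite sumr_const -[_ *+ _]mulr_natr.
have V1 : variance_fin al f <= 2 * variance_fin al (shift_avg f) + 2 * D ^+ 2.
  rewrite /variance_fin expect_shift_avg -expectZ -(expect_cst L al (2 * D ^+ 2)) -expectD.
  apply: le_expect => // c.
  have : (shift_avg f c - f c) ^+ 2 <= D ^+ 2.
    by rewrite -real_normK ?num_real// lerXn2r ?nnegrE ?(le_trans _ (D1 c)).
  have := sqr_ge0 (shift_avg f c - expect al f + (shift_avg f c - f c)).
  set E := expect al f; set a := shift_avg f c; set b := f c.
  have -> : b - E = (a - E) - (a - b) by ring.
  by rewrite sqrrD sqrrB; lra.
have V2 := variance_energy al0 al1 (shift_avg f) lam0.
have V3 := energy_shift_avg f.
have V4 : \sum_i expect al (fun c => `|infl i (shift_avg f) c|) ^+ 2 <= Q / nZ * \sum_i expect al (fun c => `|infl i f c|).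
  apply: (@le_trans _ _ (\sum_i Q / nZ * expect al (fun c => `|infl i (shift_avg f) c|))).
    apply: ler_sum => i _; rewrite expr2 ler_wpM2r ?expect_ge0//.
    apply: le_trans (expect_infl_shift_avg i f) _; by rewrite mulrC ler_wpM2r// invr_ge0 ltW.
  rewrite -mulr_sumr ler_wpM2l//; first by rewrite divr_ge0// ltW.
  exact: sum_infl_shift_avg.
apply: le_trans V1 _; rewrite lerD2r -mulrA ler_pM2l// mulrC ler_pdivlMr//.
apply: le_trans V2 _; apply: lerD; first by rewrite ler_pM2l.
by rewrite ler_pM2l.
Qed.

End Average.
End Translations.

(** * Choice of scales *)

Section Powers.
Context {R : realType}.
Implicit Types (t s x : R).

Lemma ln_le_powR t s : 1 <= t -> 0 < s -> ln t <= s^-1 * t `^ s.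
Proof.
move=> t1 s0; have t0 : 0 < t by lra.
rewrite mulrC ler_pdivlMr// mulrC -ln_powR.
by have := @ln_sub1 R _ (powR_gt0 s t0); lra.
Qed.

(** Used with [q = 1 - al] and n^2 comparable to [t]: the probability that a block contains no good
    site is O(1 / t). *)
Lemma expr_geometric_le (q : R) n : 0 < q -> q < 1 -> q ^+ n * n%:R ^+ 2 <= 4 / ln q ^+ 2.
Proof.
move=> q0 q1; have l0 : 0 < - ln q by rewrite oppr_gt0 ln_lt0// q0.
rewrite -[ln q]opprK sqrrN; set L := - ln q in l0 *.
have E : q = expR (- L) by rewrite /L opprK lnK// posrE.
have -> : q ^+ n = (expR (L * n%:R / 2) ^+ 2)^-1.
  by rewrite E -expRM_natr -expRM_natr -expRN; congr expR; field.
have n0 : 0 <= n%:R :> R by [].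
have h : 1 + L * n%:R / 2 <= expR (L * n%:R / 2) by exact: expR_ge1Dx.
have L0 : 0 <= L * n%:R / 2 by rewrite divr_ge0// mulr_ge0// ltW.
rewrite ler_pdivlMr ?exprn_gt0// -[leLHS]mulrA ler_pdivrMl ?exprn_gt0 ?expR_gt0//.
have : (L * n%:R / 2) ^+ 2 <= expR (L * n%:R / 2) ^+ 2.
  rewrite lerXn2r ?nnegrE ?expR_ge0//; lra.
have -> : n%:R ^+ 2 * L ^+ 2 = (L * n%:R / 2) ^+ 2 * 4 by field.
by rewrite ler_pM2r.
Qed.

Lemma dist_le_two_sided (u v w : R) : u - w <= v -> v - w <= u -> `|v - u| <= w.
Proof. by rewrite ler_norml => h1 h2; apply/andP; split; lra. Qed.

(** At an integer this is one more than [x]; only the bounds by [x] and [2 * x] matter. *)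
Definition natceil x : nat := (Num.truncn x).+1.

Lemma natceil_bounds x : 1 <= x -> x <= (natceil x)%:R <= 2 * x.
Proof.
move=> x1; have x0 : 0 <= x by lra.
have /andP[h1 h2] := truncn_itv x0.
apply/andP; split; first exact: ltW.
by rewrite /natceil -natr1; lra.
Qed.

End Powers.

Section Shift.
Context {R : realType} {d : nat}.
Local Notation V := 'rV[R]_d.
Variables (K : V -> R) (dl : R).
Hypotheses (Kc : continuous K) (K0 : forall z, 0 <= K z) (Kz : K 0 = 0) (dl0 : 0 <= dl).
Hypothesis (Ksup : forall M, exists c, forall z, M * `|z| <= K z + c).

Lemma envc_shift (N : nat) (c : {ffun 'rV['Z_N]_d -> bool}) (k : 'rV[int]_d) :
  envc dl (shift_conf (wrap N k) c) = (fun j => envc dl c (j + k)).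
Proof. by apply/funext => j; rewrite /envc ffunE wrapD. Qed.

Lemma norm_offset m (o : 'rV['I_m]_d) : `|map_mx intr (offset o) : V| <= m%:R.
Proof.
apply: rV_norm_le => // i; rewrite !mxE /= ger0_norm ?ler0n//.
by rewrite -[leLHS]/(((o ord0 i : nat)%:R : R)) ler_nat ltnW.
Qed.

Lemma cvalue_shift B : 0 <= B -> exists2 C, 0 <= C & forall g x H t N m
   (c : {ffun 'rV['Z_N]_d -> bool}) (o : 'rV['I_m]_d),
  growth g x H B -> (0 < m)%N -> 8 * m%:R <= t ->
  `|cvalue K dl g x t (shift_conf (wrap N (offset o)) c) - cvalue K dl g x t c| <= C * m%:R.
Proof.
move=> B0; have [C C0 HC] := value_shift Kc K0 Kz dl0 Ksup B0.
exists C => // g x H t N m c o gr m0 mt.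
have m1 : 1 <= m%:R :> R by rewrite ler1n.
rewrite /cvalue envc_shift.
have h1 := HC _ _ _ _ _ _ _ (env_envc dl0 c) gr m1 mt (norm_offset o).
have no : `|map_mx intr (- offset o) : V| <= m%:R.
  by rewrite map_mxN normrN norm_offset.
have h2 := HC _ _ _ _ _ _ _ (env_translate (offset o) (env_envc dl0 c)) gr m1 mt no.
have E : (fun j => envc dl c (j - offset o + offset o)) = envc dl c.
  by apply/funext => j; rewrite subrK.
rewrite E in h2; exact: dist_le_two_sided h1 h2.
Qed.

End Shift.

Section Assembly.
Context {R : realType} {d : nat}.
Local Notation V := 'rV[R]_d.
Variables (K : V -> R) (dl : R).
Hypotheses (Kc : continuous K) (K0 : forall z, 0 <= K z) (Kz : K 0 = 0) (dl0 : 0 <= dl).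
Hypothesis (Ksup : forall M, exists c, forall z, M * `|z| <= K z + c).
Variables (al : R) (i1 : 'I_d) (B A kap : R).
Hypotheses (al0 : 0 < al) (al1 : al < 1) (B0 : 0 <= B) (A0 : 0 <= A).
Hypothesis HA : forall G g x H t e gam H', env dl G -> growth g x H B -> 1 <= t -> e <= 1 ->
  near_opt K G g t x e gam H' -> forall s, 0 <= s <= t -> `|gam s - x| <= A * t.
Hypothesis Kk : forall w, `|w| <= 1 -> K w <= kap.

Let kap0 : 0 <= kap. Proof. by apply: le_trans (K0 0) (Kk _); rewrite normr0. Qed.

Lemma sqrt_natceil (t : R) : 1 <= t -> [/\ 1 <= (natceil (Num.sqrt t))%:R :> R,
  t <= (natceil (Num.sqrt t))%:R ^+ 2 , (natceil (Num.sqrt t))%:R ^+ 2 <= 4 * t &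
  (natceil (Num.sqrt t))%:R <= 2 * Num.sqrt t].
Proof.
move=> t1; have t0 : 0 <= t by lra.
have s1 : 1 <= Num.sqrt t by rewrite -[1]sqrtr1 ler_wsqrtr.
have /andP[h1 h2] := natceil_bounds s1.
have E := sqr_sqrtr t0.
split => //; first lra.
  by rewrite -[leLHS]E lerXn2r ?nnegrE ?sqrtr_ge0.
by rewrite -[X in 4 * X]E (_ : 4 * _ = (2 * Num.sqrt t) ^+ 2); [rewrite lerXn2r ?nnegrE//; lra|ring].
Qed.

Lemma energy_linear : exists2 CE, 0 <= CE & forall g x H t N, (1 < N)%N -> growth g x H B ->
  1 <= t -> 2 * (A * t) + 1 < N%:R -> (2 * natceil (Num.sqrt t) < N)%N ->
  energy al (cvalue K dl g x t : {ffun 'rV['Z_N]_d -> bool} -> R) <= CE * t.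
Proof.
pose kp := kap + 3 * dl; pose q := 4 / ln (1 - al) ^+ 2.
have d0 := dl0; have k0 := kap0.
have kp0 : 0 <= kp by rewrite /kp; lra.
have q0 : 0 <= q by rewrite divr_ge0// sqr_ge0.
pose CE := al^-1 * ((1 + dl) * (1 + 2 * kp) + 4 * (1 + 5 * kp) ^+ 2 + 2 * q * (1 + dl) ^+ 2).
exists CE.
  have p1 : 0 <= 1 + dl by lra.
  have p2 : 0 <= 1 + 2 * kp by lra.
  apply: mulr_ge0; first by rewrite invr_ge0 ltW.
  apply: addr_ge0; last by apply: mulr_ge0; [exact: mulr_ge0|exact: sqr_ge0].
  by apply: addr_ge0; [exact: mulr_ge0|apply: mulr_ge0 => //; exact: sqr_ge0].
move=> g x H t N N1 gr t1 AN nN; set n := natceil _ in nN.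
have [n1 tn nt _] := sqrt_natceil t1; rewrite -/n in n1 tn nt.
have t0 : 0 <= t by lra.
(* The energy involves no boxes, so the bound is taken with [m = 0]. *)
have AN' : 2 * (A * t) + 1 + 0%:R < N%:R by rewrite addr0.
have HA' G e gam H' : env dl G -> e <= 1 -> near_opt K G g t x e gam H' ->
    forall s, 0 <= s <= t -> `|gam s - x| <= A * t.
  by move=> eG e1; exact: HA eG gr t1 e1.
apply: le_trans (energy_cvalue Kc K0 Kz dl0 Ksup N1 gr B0 t1 HA' AN' Kk i1 al0 al1 nN) _.
rewrite /CE -[leRHS]mulrA ler_wpM2l ?invr_ge0 ?(ltW al0)// -/kp.
have dt : 0 <= dl * t by rewrite mulr_ge0.
have h1 : (1 + dl * t) * (1 + 2 * kp) <= (1 + dl) * (1 + 2 * kp) * t.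
  rewrite mulrAC ler_wpM2r//; first lra.
  by rewrite mulrDl mul1r lerD2r.
have h2 : (1 + kp * (2 * (2 * n%:R) + 1)) ^+ 2 <= 4 * (1 + 5 * kp) ^+ 2 * t.
  apply: (@le_trans _ _ (((1 + 5 * kp) * n%:R) ^+ 2)).
    rewrite lerXn2r ?nnegrE ?addr_ge0 ?mulr_ge0//; try lra.
    have : kp <= kp * n%:R by rewrite ler_peMr.
    lra.
  rewrite exprMn [leRHS](_ : _ = (1 + 5 * kp) ^+ 2 * (4 * t)); last by ring.
  by rewrite ler_wpM2l// sqr_ge0.
have h3 : 2 * (1 - al) ^+ n * (1 + dl * t) ^+ 2 <= 2 * q * (1 + dl) ^+ 2 * t.
  have hq : (1 - al) ^+ n * n%:R ^+ 2 <= q by apply: expr_geometric_le; [rewrite subr_gt0|rewrite ltrBlDr ltrDl].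
  have hp : 0 <= (1 - al) ^+ n by rewrite exprn_ge0// subr_ge0 ltW.
  have h4 : (1 + dl * t) ^+ 2 <= (1 + dl) ^+ 2 * (n%:R ^+ 2 * t).
    apply: (@le_trans _ _ (((1 + dl) * t) ^+ 2)).
      by rewrite lerXn2r ?nnegrE ?addr_ge0 ?mulr_ge0//; lra.
    by rewrite exprMn ler_wpM2l ?sqr_ge0// expr2 ler_wpM2r.
  apply: (@le_trans _ _ (2 * ((1 - al) ^+ n * ((1 + dl) ^+ 2 * (n%:R ^+ 2 * t))))).
    by rewrite -mulrA ler_pM2l// ler_wpM2l.
  rewrite [leLHS](_ : _ = (1 - al) ^+ n * n%:R ^+ 2 * (2 * (1 + dl) ^+ 2 * t)); last by ring.
  rewrite [leRHS](_ : _ = q * (2 * (1 + dl) ^+ 2 * t)); last by ring.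
  by rewrite ler_wpM2r//; apply: mulr_ge0 => //; apply: mulr_ge0 => //; exact: sqr_ge0.
by rewrite [leRHS]mulrDl [X in _ <= X + _]mulrDl; apply: lerD => //; exact: lerD.
Qed.

Lemma influence_linear : exists2 CS, 0 <= CS & forall g x H t N, growth g x H B -> 1 <= t ->
  \sum_i expect al (fun c => `|infl i (cvalue K dl g x t : {ffun 'rV['Z_N]_d -> bool} -> R) c|) <= CS * t.
Proof.
have d0 := dl0.
exists (al^-1 * (1 + dl)); first by rewrite mulr_ge0 ?invr_ge0 ?(ltW al0)//; lra.
move=> g x H t N gr t1; apply: le_trans (sum_expect_infl Kc K0 Kz dl0 Ksup N gr B0 t1 al0 al1) _.
by rewrite -[leRHS]mulrA ler_wpM2l ?invr_ge0 ?(ltW al0)// mulrDl mul1r lerD2r.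
Qed.

(** The exponents of the range of translations, of [lam] and of the influence of a box. The
    inequality [kq + ep <= d%:R * th] makes [lam] times the influence of a box, divided by the
    number of translations, bounded. The inequality [th < 1 / 2] makes the squared error of the
    averaging O(t / ln t). *)
Variables (th ep kq CQ : R).
Hypotheses (th0 : 0 < th) (th1 : th < 1 / 2) (ep0 : 0 < ep) (kqth : kq + ep <= d%:R * th) (CQ0 : 0 <= CQ).
Hypothesis HQ : forall g x H t N m (l : 'rV['Z_N]_d), (1 < N)%N -> growth g x H B -> 256 <= t ->
  t `^ th <= m%:R <= 2 * t `^ th -> 2 * (A * t) + 1 + m%:R < N%:R ->
  (2 * natceil (Num.sqrt t) < N)%N ->
  \sum_(i in box m l) expect al (fun c => `|infl i (cvalue K dl g x t) c|) <= CQ * t `^ kq.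

Definition shift_range (t : R) := natceil (t `^ th).

Lemma variance_large : exists2 C, 0 <= C & forall g x H t N, (1 < N)%N -> growth g x H B ->
  256 <= t -> 2 * (A * t) + 1 + (shift_range t)%:R < N%:R -> (2 * natceil (Num.sqrt t) < N)%N ->
  variance_fin al (cvalue K dl g x t : {ffun 'rV['Z_N]_d -> bool} -> R) <= C * (t / ln t).
Proof.
have [CE CE0 HE] := energy_linear; have [CS CS0 HS] := influence_linear.
have [Ch Ch0 Hh] := cvalue_shift Kc K0 Kz dl0 Ksup B0.
have th2 : 0 < 1 - 2 * th by move: th1; lra.
(* The first summand bounds the variance of the average, with [lam = t ^ ep] and so ln lam = ep ln
   t. The second is the error of the averaging: [m] is at most twice [t ^ th], and 8 = 2 * 2^2. *)
exists (2 / ep * (2 * CE + CQ * CS) + 8 * Ch ^+ 2 / (1 - 2 * th)).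
  apply: addr_ge0; apply: mulr_ge0.
  - by rewrite divr_ge0// ltW.
  - by rewrite addr_ge0 ?mulr_ge0.
  - by rewrite mulr_ge0// sqr_ge0.
  - by rewrite invr_ge0 ltW.
move=> g x H t N N1 gr t256 AN nN; set m := shift_range t in AN *.
have t1 : 1 <= t by lra.
have t0 : 0 < t by lra.
have lnt : 0 < ln t by rewrite ln_gt0//; lra.
have tth : 1 <= t `^ th by rewrite -(powRr0 t) ler_powR// ltW.
have /andP[m1 m2] := natceil_bounds tth; rewrite -/(shift_range t) -/m in m1 m2.
have m01 : 1 <= m%:R :> R by lra.
have m0 : (0 < m)%N by rewrite -(ler1n R).
(* The threshold 256 = 16^2 serves here: 8 m <= 16 t^th <= 16 sqrt t <= t. *)
have tm : 8 * m%:R <= t.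
  have h : t `^ th <= t `^ 2^-1 by rewrite ler_powR//; lra.
  have E : t `^ 2^-1 * t `^ 2^-1 = t
    by rewrite -powRD ?gt_eqF ?implybT// (_ : 2^-1 + 2^-1 = 1); [rewrite powRr1// ltW|field].
  have h16 : 16 <= t `^ 2^-1.
    rewrite leNgt; apply/negP => hlt; have p0 := powR_ge0 t 2^-1.
    have : t `^ 2^-1 * t `^ 2^-1 < 16 * 16 by rewrite ltr_pM.
    by rewrite E; lra.
  have : 16 * t `^ 2^-1 <= t `^ 2^-1 * t `^ 2^-1 by rewrite ler_wpM2r// powR_ge0.
  by rewrite E; lra.
have AN' : 2 * (A * t) + 1 < N%:R by lra.
have r0 : 0 <= A * t by rewrite mulr_ge0// ltW.
have lam1 : 1 < t `^ ep by rewrite /powR gt_eqF// expR_gt1 mulr_gt0.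
have CQt : 0 <= CQ * t `^ kq by rewrite mulr_ge0// powR_ge0.
have HQ' (i : 'rV['Z_N]_d) : \sum_(o : 'rV['I_m]_d)
    expect al (fun c => `|infl (i - wrap N (offset o)) (cvalue K dl g x t) c|) <= CQ * t `^ kq.
  have inj := @wrap_offset_inj R d N N1 (A * t) m AN i r0.
  apply: le_trans (HQ i N1 gr t256 _ AN nN); last by rewrite m1 m2.
  rewrite /box big_imset//= => o o' _ _; exact: inj.
have HD (o : 'rV['I_m]_d) (c : {ffun 'rV['Z_N]_d -> bool}) := Hh _ _ _ _ _ _ c o gr m0 tm.
have Zn : #|{: 'rV['I_m]_d}| = (m ^ d)%N by rewrite card_mx card_ord mul1n.
have Z0 : (0 < #|{: 'rV['I_m]_d}|)%N by rewrite Zn expn_gt0 m0.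
apply: le_trans (variance_shift al0 al1 Z0 lam1 CQt HQ' HD) _.
rewrite Zn natrX ln_powR.
have pw : t `^ ep * t `^ kq / m%:R ^+ d <= 1.
  have mm : 0 < m%:R :> R by lra.
  rewrite ler_pdivrMr ?exprn_gt0//.
  rewrite mul1r -powRD; last by rewrite (gt_eqF t0) implybT.
  apply: (@le_trans _ _ (t `^ (th * d%:R))).
    by rewrite ler_powR// addrC [th * _]mulrC.
  rewrite powRrM powR_mulrn ?powR_ge0// lerXn2r ?nnegrE ?powR_ge0//; lra.
have S1 := HS _ _ _ _ N gr t1.
have E1 := HE _ _ _ _ _ N1 gr t1 AN' nN.
rewrite [leRHS]mulrDl; apply: lerD.
  have -> : 2 / ep * (2 * CE + CQ * CS) * (t / ln t) = 2 / (ep * ln t) * (2 * (CE * t) + CQ * (CS * t)).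
    by field; rewrite !gt_eqF.
  rewrite ler_wpM2l//; first by rewrite divr_ge0// mulr_ge0// ltW.
  apply: lerD; first by rewrite ler_pM2l.
  set S := \sum_i _ in S1 *.
  have S0 : 0 <= S by apply: sumr_ge0 => i _; exact: expect_ge0.
  apply: (@le_trans _ _ (1 * (CQ * S))).
    apply: le_trans (ler_wpM2r (mulr_ge0 CQ0 S0) pw); rewrite le_eqVlt; apply/orP; left.
    by apply/eqP; ring.
  by rewrite mul1r ler_wpM2l.
have pD r s : t `^ r * t `^ s = t `^ (r + s) by rewrite powRD// (gt_eqF t0) implybT.
have h2 : (t `^ th) ^+ 2 <= (1 - 2 * th)^-1 * (t / ln t).
  rewrite mulrA ler_pdivlMr//; apply: le_trans (ler_wpM2l (sqr_ge0 _) (ln_le_powR t1 th2)) _.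
  rewrite mulrCA ler_wpM2l ?invr_ge0 ?(ltW th2)// expr2 !pD.
  by rewrite (_ : th + th + (1 - 2 * th) = 1); [rewrite powRr1// ltW|ring].
have h3 : 2 * (Ch * m%:R) ^+ 2 <= 8 * Ch ^+ 2 * (t `^ th) ^+ 2.
  apply: (@le_trans _ _ (2 * (Ch * (2 * t `^ th)) ^+ 2)); last by rewrite le_eqVlt; apply/orP; left; apply/eqP; ring.
  by rewrite ler_pM2l// lerXn2r ?nnegrE ?mulr_ge0 ?powR_ge0// ler_wpM2l.
by apply: le_trans h3 _; rewrite -[leRHS]mulrA ler_wpM2l// mulr_ge0// sqr_ge0.
Qed.

(** For bounded [t] all values lie within a constant of [H], and t / ln t is at least 1. *)
Lemma variance_small (T : R) : exists2 C, 0 <= C & forall g x H t N, growth g x H B ->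
  2 <= t -> t <= T -> variance_fin al (cvalue K dl g x t : {ffun 'rV['Z_N]_d -> bool} -> R) <= C * (t / ln t).
Proof.
have [A' A'0 HA'] := value_upper dl Kc K0 Kz Ksup B0.
have d0 := dl0.
exists (4 * ((A' + dl) * T) ^+ 2); first by rewrite mulr_ge0// sqr_ge0.
move=> g x H t N gr t2 tT; have t1 : 1 <= t by lra.
have t0 : 0 < t by lra.
have lnt : 0 < ln t by rewrite ln_gt0//; lra.
have b c : `|cvalue K dl g x t (c : {ffun 'rV['Z_N]_d -> bool}) - H| <= (A' + dl) * T.
  have e := env_envc dl0 c.
  have f := value_fin Kc K0 Kz Ksup B0 e gr t1.
  have := HA' _ _ _ _ _ e gr t1; have := value_lower Kz e gr (ltW t0).
  rewrite -(fineK f) !lee_fin -/(cvalue _ _ _ _ _ _).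
  have h1 : A' * t <= A' * T by rewrite ler_wpM2l.
  have h2 : dl * t <= dl * T by rewrite ler_wpM2l.
  have h3 : 0 <= A' * t by rewrite mulr_ge0// ltW.
  have h4 : 0 <= dl * t by rewrite mulr_ge0// ltW.
  move: h1 h2 h3 h4; rewrite ler_norml mulrDl => *; apply/andP; split; lra.
have V : variance_fin al (cvalue K dl g x t : {ffun 'rV['Z_N]_d -> bool} -> R) <= ((2 * ((A' + dl) * T)) ^+ 2).
  rewrite /variance_fin -[leRHS](expect_cst 'rV['Z_N]_d al); apply: le_expect => // c.
  rewrite -real_normK ?num_real// lerXn2r ?nnegrE//.
    by rewrite mulr_ge0// (le_trans _ (b c)).
  have bE : `|expect al (cvalue K dl g x t : {ffun 'rV['Z_N]_d -> bool} -> R) - H| <= (A' + dl) * T.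
    rewrite ler_norml lerBrDr lerBlDr -(expect_cst 'rV['Z_N]_d al (_ + H)) -[X in _ && (_ <= X)](expect_cst 'rV['Z_N]_d al).
    by apply/andP; split; apply: le_expect => // c'; have := b c'; rewrite ler_norml => /andP[]; lra.
  move: (b c) bE; rewrite !ler_norml => /andP[a1 a2] /andP[b1 b2]; apply/andP; split; lra.
apply: (le_trans V); rewrite exprMn -natrX -[leLHS]mulr1 ler_wpM2l//; first by rewrite mulr_ge0// sqr_ge0.
by rewrite ler_pdivlMr// mul1r; have := @ln_sub1 _ _ t0; lra.
Qed.

(** The size of the torus depends on [t], but the constant is fixed before it. *)
Lemma variance_sublinear : exists2 C, 0 < C & forall t, 2 <= t -> exists N0, forall g x H N,
  (N0 <= N)%N -> growth g x H B ->
  variance_fin al (cvalue K dl g x t : {ffun 'rV['Z_N]_d -> bool} -> R) <= C * (t / ln t).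
Proof.
have [C1 C10 H1] := variance_large; have [C2 C20 H2] := variance_small 256.
exists (C1 + C2 + 1); first by rewrite ltr_wpDl// addr_ge0.
move=> t t2; have t0 : 0 < t by lra.
have tl : 0 <= t / ln t by rewrite divr_ge0 ?(ltW t0)// ln_ge0; lra.
have [N1 hN1] : exists n : nat, 2 * (A * t) + 1 + (shift_range t)%:R < n%:R.
  have a : 0 <= 2 * (A * t) + 1 + (shift_range t)%:R by rewrite !addr_ge0// !mulr_ge0// ltW.
  by have /andP[_ h] := truncn_itv a; exists (Num.truncn (2 * (A * t) + 1 + (shift_range t)%:R)).+1.
exists (N1 + 2 * natceil (Num.sqrt t) + 2)%N => g x H N hN gr.
have [t256|t256] := leP t 256.
  apply: le_trans (H2 _ _ _ _ N gr t2 t256) _; rewrite ler_wpM2r//; lra.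
apply: (@le_trans _ _ (C1 * (t / ln t))); last by rewrite ler_wpM2r//; lra.
apply: (H1 _ _ _ _ _ _ gr (ltW t256)).
- by apply: leq_trans hN; rewrite addn2 ltnS.
- by apply: lt_le_trans hN1 _; rewrite ler_nat (leq_trans _ hN)// -addnA leq_addr.
- by apply: leq_trans hN; rewrite addn2 ltnW// !ltnS leq_addl.
Qed.

End Assembly.

(** The arithmetic of the box bound: [s] is sqrt t, [T] is t^kq, [D] is 2^d, [L] is the error term
    of the lower bound on [K] over time [t], and [E] is the contribution of the unlikely event. *)
Lemma box_terms_le {R : realFieldType} (dl kp k D lam s T n m a L E Q : R) :
  0 <= dl -> 0 <= kp -> 0 <= k -> 0 <= D -> 0 < lam -> 1 <= s -> s <= T ->
  n <= 2 * s -> m <= 2 * s -> lam^-1 * s = a * T -> L / lam = T / 4 -> 0 <= Q -> E <= Q ->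
  1 + dl * (m + 1 + 2 * (2 * n) + 2) + (1 + 2 * dl) +
    (D * (1 + (1 + k * (m + 1 + 2 * (2 * n)) + 2 * dl + L) / lam) * (1 + 2 * kp) +
     (1 + kp * (2 * (2 * n) + 1))) + E <=
  (1 + 13 * dl + (1 + 2 * dl) + D * ((1 + 2 * kp) * (1 + (1 + 11 * k + 2 * dl) * a + 1 / 4)) +
    (1 + 9 * kp) + Q) * T.
Proof.
move=> dl0 kp0 k0 D0 lam0 s1 sT ns ms sl el Q0 EQ.
have T1 : 1 <= T by lra.
have dn : dl * n <= dl * (2 * T) by rewrite ler_wpM2l//; lra.
have dm : dl * m <= dl * (2 * T) by rewrite ler_wpM2l//; lra.
have dT : dl <= dl * T by rewrite ler_peMr.
have p1 : kp * n <= kp * (2 * T) by rewrite ler_wpM2l//; lra.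
have p2 : kp <= kp * T by rewrite ler_peMr.
have QT : Q <= Q * T by rewrite ler_peMr.
have U : (1 + k * (m + 1 + 2 * (2 * n)) + 2 * dl) / lam <= (1 + 11 * k + 2 * dl) * a * T.
  have -> : (1 + 11 * k + 2 * dl) * a * T = (1 + 11 * k + 2 * dl) * s / lam by rewrite -mulrA -sl; ring.
  rewrite ler_wpM2r ?invr_ge0 ?(ltW lam0)//.
  have : k * (m + 1 + 2 * (2 * n)) <= k * (11 * s) by rewrite ler_wpM2l//; lra.
  have : dl <= dl * s by rewrite ler_peMr.
  lra.
have W : D * (1 + (1 + k * (m + 1 + 2 * (2 * n)) + 2 * dl + L) / lam) * (1 + 2 * kp) <=
    D * ((1 + 2 * kp) * (1 + (1 + 11 * k + 2 * dl) * a + 1 / 4)) * T.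
  rewrite -[leLHS]mulrA -[leRHS]mulrA ler_wpM2l// -[leRHS]mulrA [leLHS]mulrC.
  by rewrite ler_wpM2l//; [lra|rewrite mulrDl el; lra].
rewrite [leRHS]mulrDl; apply: lerD; last exact: le_trans QT.
rewrite [leRHS]mulrDl [leLHS]addrA; apply: lerD; last by rewrite mulrDl; lra.
rewrite [leRHS]mulrDl; apply: lerD => //.
by rewrite [leRHS]mulrDl; lra.
Qed.

(** * Influence of a box under a power lower bound on the cost *)

Section BoxInfluence.
Context {R : realType} {d : nat}.
Local Notation V := 'rV[R]_d.
Variables (K : V -> R) (dl : R).
Hypotheses (Kc : continuous K) (K0 : forall z, 0 <= K z) (Kz : K 0 = 0) (dl0 : 0 <= dl).
Hypothesis (Ksup : forall M, exists c, forall z, M * `|z| <= K z + c).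
Variables (al : R) (i1 : 'I_d) (B A kap : R).
Hypotheses (al0 : 0 < al) (al1 : al < 1) (B0 : 0 <= B).
Hypothesis HA : forall G g x H t e gam H', env dl G -> growth g x H B -> 1 <= t -> e <= 1 ->
  near_opt K G g t x e gam H' -> forall s, 0 <= s <= t -> `|gam s - x| <= A * t.
Hypothesis Kk : forall w, `|w| <= 1 -> K w <= kap.

Let kap0 : 0 <= kap. Proof. by apply: le_trans (K0 0) (Kk _); rewrite normr0. Qed.

Variable nu : R.
Hypothesis nu1 : 1 < nu.
Hypothesis Knu : forall e, 0 < e -> e <= 1 / 4 -> forall z, e `^ (nu - 1) * `|z| <= K z + e `^ (nu - 1) * e.

Let th := 1 / 2 - (8 * nu)^-1.
Let kq := 1 - (2 * nu)^-1.

Lemma box_influence_low : exists2 CQ, 0 <= CQ & forall g x H t N m (l : 'rV['Z_N]_d), (1 < N)%N ->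
  growth g x H B -> 1 <= t ->
  t `^ th <= m%:R <= 2 * t `^ th -> 2 * (A * t) + 1 + m%:R < N%:R ->
  (2 * natceil (Num.sqrt t) < N)%N ->
  \sum_(i in box m l) expect al (fun c => `|infl i (cvalue K dl g x t) c|) <= CQ * t `^ kq.
Proof.
pose kp := kap + 3 * dl; pose q := 4 / ln (1 - al) ^+ 2.
have d0 := dl0; have k0 := kap0; have n1 := nu1.
have kp0 : 0 <= kp by rewrite /kp; lra.
have q0 : 0 <= q by rewrite divr_ge0// sqr_ge0.
pose a := 4 `^ (nu - 1) : R; have a0 : 0 <= a by exact: powR_ge0.
pose Kn := 1 + 11 * (kap + dl) + 2 * dl.
have Kn0 : 0 <= Kn by rewrite /Kn; lra.
have inu : 0 < nu^-1 by rewrite invr_gt0; lra.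
have inu1 : nu^-1 < 1 by rewrite invf_lt1//; lra.
have i2 : (2 * nu)^-1 = nu^-1 / 2 by rewrite invfM mulrC.
have i8 : (8 * nu)^-1 = nu^-1 / 8 by rewrite invfM mulrC.
have D0 : 0 <= 2 ^+ d * ((1 + 2 * kp) * (1 + Kn * a + 1 / 4)).
  by rewrite mulr_ge0 ?exprn_ge0// mulr_ge0 ?addr_ge0 ?mulr_ge0//; lra.
have Q2 : 0 <= 2 * (q * (1 + dl)) by rewrite mulr_ge0// mulr_ge0//; lra.
exists (al^-1 * ((1 + 13 * dl) + (1 + 2 * dl) + 2 ^+ d * ((1 + 2 * kp) * (1 + Kn * a + 1 / 4)) +
  (1 + 9 * kp) + 2 * (q * (1 + dl)))).
  by rewrite mulr_ge0 ?invr_ge0 ?(ltW al0)//; lra.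
move=> g x H t N m l N1 gr t1 /andP[m1 m2] AN nN.
have t0 : 0 <= t by lra.
have tp : 0 < t by lra.
have HA' G e gam H' : env dl G -> e <= 1 -> near_opt K G g t x e gam H' ->
    forall s, 0 <= s <= t -> `|gam s - x| <= A * t.
  by move=> eG e1; exact: HA eG gr t1 e1.
set n := natceil _ in nN.
have [n1' tn _ ns] := sqrt_natceil t1; rewrite -/n in n1' tn ns.
pose T := t `^ kq; pose r := t `^ ((2 * nu)^-1).
have sE : Num.sqrt t = t `^ (1 / 2) by rewrite mul1r powR12_sqrt.
have s1 : 1 <= Num.sqrt t by rewrite -[1]sqrtr1 ler_wsqrtr.
have sT : Num.sqrt t <= T by rewrite sE ler_powR// /kq i2; lra.
have ms : m%:R <= 2 * Num.sqrt t.
  by apply: le_trans m2 _; rewrite ler_pM2l// sE ler_powR// /th i8; lra.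
have r1 : 1 <= r by rewrite -(powRr0 t) ler_powR// i2; lra.
have r0 : 0 < r by lra.
(* With slope lam = e^(nu - 1) and error lam * e, the count of visited cells is of order sqrt t /
   lam + e t. For e of order t^(-1/(2 nu)) both terms are of order t^(1 - 1/(2 nu)) = T; the factor
   4 ensures [e <= 1 / 4]. *)
pose e := (4 * r)^-1.
have e0 : 0 < e by rewrite invr_gt0 mulr_gt0.
have e4 : e <= 1 / 4 by rewrite /e mul1r lef_pV2 ?posrE//; lra.
pose lam := e `^ (nu - 1).
have lam0 : 0 < lam by rewrite powR_gt0.
have lamV : lam^-1 = a * r `^ (nu - 1).
  apply: (mulfI (lt0r_neq0 lam0)); rewrite divff ?gt_eqF//.
  have r00 : 0 <= r by lra.
  have e00 : 0 <= e by lra.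
  rewrite /lam /a -powRM// -powRM//; last by rewrite mulr_ge0.
  by rewrite /e mulVf ?powR1// mulf_neq0// gt_eqF.
have sl : lam^-1 * Num.sqrt t = a * T.
  rewrite lamV /r -powRrM sE -mulrA -powRD ?(gt_eqF tp) ?implybT//; congr (_ * _ `^ _).
  by rewrite /kq; field; rewrite gt_eqF//; lra.
have el : lam * e * t / lam = T / 4.
  rewrite (_ : lam * e * t / lam = e * t); last by field; rewrite gt_eqF.
  rewrite /e /T /kq invfM -mulrA mulrC; congr (_ / _).
  by rewrite /r -powRN -[X in _ * X](powRr1 t0) -powRD ?(gt_eqF tp) ?implybT// addrC.
apply: le_trans (sum_expect_infl_box Kc K0 Kz dl0 Ksup N1 gr B0 t1 HA' AN Kk i1 al0 al1 nN l lam0 (Knu e0 e4)) _.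
rewrite -[leRHS]mulrA ler_wpM2l ?invr_ge0 ?(ltW al0)// -/T -/kp.
have hq : (1 - al) ^+ n * n%:R ^+ 2 <= q.
  by apply: expr_geometric_le; [rewrite subr_gt0|rewrite ltrBlDr ltrDl].
have hp : 0 <= (1 - al) ^+ n by rewrite exprn_ge0// subr_ge0 ltW.
have dl1 : 0 <= 1 + dl by rewrite addr_ge0.
have h : (1 - al) ^+ n * (1 + dl * t) <= q * (1 + dl).
  apply: (@le_trans _ _ ((1 - al) ^+ n * ((1 + dl) * n%:R ^+ 2))).
    rewrite ler_wpM2l// mulrDl mul1r; apply: lerD; first by rewrite expr_ge1.
    by rewrite ler_wpM2l.
  by rewrite mulrCA mulrC ler_wpM2r.
apply: (box_terms_le d0 kp0 (addr_ge0 k0 d0) (exprn_ge0 _ _) lam0 s1 sT ns ms sl el Q2) => //.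
by rewrite -mulrA ler_pM2l.
Qed.

End BoxInfluence.

Section Sublinear.
Context {R : realType} {d : nat}.
Local Notation V := 'rV[R]_d.
Variables (K : V -> R) (dl : R).
Hypotheses (Kc : continuous K) (K0 : forall z, 0 <= K z) (Kz : K 0 = 0) (dl0 : 0 <= dl).
Hypothesis (Ksup : forall M, exists c, forall z, M * `|z| <= K z + c).

Theorem cell_variance_sublinear (al B : R) : 0 < al -> al < 1 -> 0 <= B -> (2 <= d)%N ->
  (2 < d)%N \/ (exists2 nu, 1 < nu &
    forall e, 0 < e -> e <= 1 / 4 -> forall z, e `^ (nu - 1) * `|z| <= K z + e `^ (nu - 1) * e) ->
  exists2 C, 0 < C & forall t, 2 <= t -> exists N0, forall g x H N, (N0 <= N)%N -> growth g x H B ->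
    variance_fin al (cvalue K dl g x t : {ffun 'rV['Z_N]_d -> bool} -> R) <= C * (t / ln t).
Proof.
move=> al0 al1 B0 d2 Hd.
have i1 : 'I_d by exact: (Ordinal (ltnW d2)).
have [A A0 HA0] := near_opt_bounds Kc K0 Kz dl0 Ksup B0.
have HA G g x H t e gam H' : env dl G -> growth g x H B -> 1 <= t -> e <= 1 ->
    near_opt K G g t x e gam H' -> forall s, 0 <= s <= t -> `|gam s - x| <= A * t.
  by move=> eG gr t1 e1 no; have [_] := HA0 _ _ _ _ _ _ _ _ eG gr t1 e1 no.
have [kap Hk] := continuous_rV_bounded 1 Kc.
have Kk w : `|w| <= 1 -> K w <= kap by move=> /Hk; apply: le_trans; exact: ler_norm.
case: Hd => [d3|[nu nu1 Knu]].
  have [CS CS0 HS] := influence_linear Kc K0 Kz dl0 Ksup al0 al1 B0.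
  (* The influence of a box is bounded by the total influence, so [kq = 1], and 1 + 1/5 = 3 *
     2/5. *)
  apply: (variance_sublinear Kc K0 Kz dl0 Ksup i1 al0 al1 B0 A0 HA Kk
    (th := 2 / 5) (ep := 1 / 5) (kq := 1) (CQ := CS)) => //; try lra.
    have d3' : 3 <= d%:R :> R by rewrite ler_nat.
    lra.
  move=> g x H t N m l N1 gr t256 _ _ _; rewrite powRr1; last lra.
  apply: le_trans (HS g x H t N gr _); last lra.
  rewrite [leRHS](bigID (fun i => i \in box m l)) /= lerDl.
  by apply: sumr_ge0 => i _; exact: expect_ge0.
have [CQ CQ0 HQ] := box_influence_low Kc K0 Kz dl0 Ksup i1 al0 al1 B0 HA Kk nu1 Knu.
have inu : 0 < nu^-1 by rewrite invr_gt0; lra.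
have inu1 : nu^-1 < 1 by rewrite invf_lt1//; lra.
have i2 : (2 * nu)^-1 = nu^-1 / 2 by rewrite invfM mulrC.
have i8 : (8 * nu)^-1 = nu^-1 / 8 by rewrite invfM mulrC.
have i4 : (4 * nu)^-1 = nu^-1 / 4 by rewrite invfM mulrC.
(* In dimension 2 these exponents give equality: 2 th = 1 - 1/(4 nu) = kq + ep. *)
apply: (variance_sublinear Kc K0 Kz dl0 Ksup i1 al0 al1 B0 A0 HA Kk
    (th := 1 / 2 - (8 * nu)^-1) (ep := (4 * nu)^-1) (kq := 1 - (2 * nu)^-1) (CQ := CQ)) => //.
- lra.
- lra.
- lra.
- have d2' : 2 <= d%:R :> R by rewrite ler_nat.
  apply: (@le_trans _ _ (2 * (1 / 2 - (8 * nu)^-1))); first lra.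
  by rewrite ler_wpM2r//; lra.
- by move=> g x H t N m l N1 gr t256; apply: (HQ g x H t N m l N1 gr); lra.
Qed.

End Sublinear.

(** * Convex costs *)

Section Norms.
Context {R : realType} {d : nat}.
Local Notation V := 'rV[R]_d.
Implicit Types (y z x p : V).

Lemma enorm_ge0 z : 0 <= enorm z. Proof. exact: sqrtr_ge0. Qed.

Lemma norm_le_enorm z : `|z| <= enorm z.
Proof.
apply: rV_norm_le => [|i]; first exact: enorm_ge0.
rewrite -sqrtr_sqr ler_wsqrtr// (bigD1 i)//= lerDl.
by apply: sumr_ge0 => j _; exact: sqr_ge0.
Qed.

Lemma enorm_le_norm z : enorm z <= d%:R * `|z|.
Proof.
have H : 0 <= \sum_(i < d) `|z ord0 i| by apply: sumr_ge0.
apply: (@le_trans _ _ (\sum_(i < d) `|z ord0 i|)); last first.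
  apply: (@le_trans _ _ (\sum_(i < d) `|z|)); first by apply: ler_sum => i _; exact: rV_coord_le.
  by rewrite sumr_const card_ord mulr_natl.
rewrite -[leRHS](ger0_norm H) -sqrtr_sqr ler_wsqrtr// [leRHS]expr2 mulr_suml.
apply: ler_sum => i _; rewrite -real_normK ?num_real// expr2 ler_wpM2l//.
by rewrite (bigD1 i)//= lerDl sumr_ge0.
Qed.

Lemma enormZ (a : R) z : enorm (a *: z) = `|a| * enorm z.
Proof.
rewrite /enorm -sqrtr_sqr -sqrtrM ?sqr_ge0// mulr_sumr; congr Num.sqrt.
by apply: eq_bigr => i _; rewrite mxE exprMn.
Qed.

Definition dot p z : R := \sum_(i < d) p ord0 i * z ord0 i.

Lemma dotZ p (a : R) z : dot p (a *: z) = a * dot p z.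
Proof. by rewrite /dot mulr_sumr; apply: eq_bigr => i _; rewrite mxE mulrCA. Qed.

Lemma dotD p y z : dot p (y + z) = dot p y + dot p z.
Proof. by rewrite /dot -big_split; apply: eq_bigr => i _; rewrite mxE mulrDr. Qed.

Lemma dot_le p z : `|dot p z| <= d%:R * `|p| * `|z|.
Proof.
apply: le_trans (ler_norm_sum _ _ _) _.
apply: (@le_trans _ _ (\sum_(i < d) `|p| * `|z|)); last by rewrite sumr_const card_ord -mulrA mulr_natl.
by apply: ler_sum => i _; rewrite normrM ler_pM ?rV_coord_le.
Qed.

End Norms.

Section Convex.
Context {R : realType} {d : nat}.
Local Notation V := 'rV[R]_d.
Implicit Types (y z x p : V).
Variable K : V -> R.
Hypothesis Kcvx : convex_fun K.

(** The span of the first [j] basis vectors. It allows induction on the dimension inside a fixed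
    space. *)
Definition supported (j : nat) z := forall i : 'I_d, (j <= i)%N -> z ord0 i = 0.

Lemma supported0 z : supported 0 z -> z = 0.
Proof. by move=> H; apply/rowP => i; rewrite mxE H. Qed.

Lemma supported_all z : supported d z.
Proof. by move=> i; rewrite leqNgt ltn_ord. Qed.

Lemma supported_split j (i1 : 'I_d) z : i1 = j :> nat -> supported j.+1 z ->
  exists2 y, supported j y & z = y + z ord0 i1 *: delta_mx ord0 i1 /\ y ord0 i1 = 0 /\ `|y| <= `|z|.
Proof.
move=> ij sz; exists (\row_i (if i == i1 then 0 else z ord0 i)).
  move=> i ji; rewrite mxE; case: eqP => // ne; apply: sz; rewrite ltn_neqAle ji andbT.
  by apply/eqP => e; apply: ne; apply: val_inj; rewrite /= ij.
split; [|split].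
- by apply/rowP => i; rewrite !mxE eqxx /=; case: eqP => [->|_]; rewrite ?mulr1 ?add0r// mulr0 addr0.
- by rewrite mxE eqxx.
- by apply: rV_norm_le => // i; rewrite mxE; case: eqP; rewrite ?normr0// rV_coord_le.
Qed.

Lemma convex_segment x (w : V) (r s : R) : 0 < r -> `|s| <= r ->
  K (x + s *: w) <= `|K (x + r *: w)| + `|K (x - r *: w)|.
Proof.
move=> r0; rewrite ler_norml => /andP[s1 s2]; pose l := (s + r) / (2 * r).
have r2 : 0 < 2 * r by lra.
have l01 : 0 <= l <= 1 by rewrite divr_ge0 ?ler_pdivrMr ?mul1r//=; lra.
have E : x + s *: w = l *: (x + r *: w) + (1 - l) *: (x - r *: w).
  apply/rowP => i; rewrite !mxE /l; field; rewrite gt_eqF//.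
rewrite E; apply: le_trans (Kcvx _ _ l01) _; move/andP: l01 => [l0 l1].
apply: lerD; apply: le_trans (ler_norm _) _; rewrite normrM.
  by rewrite ger0_norm// ler_piMl.
by rewrite ger0_norm ?ler_piMl//; lra.
Qed.

(** A vector of the larger subspace is the midpoint of a vector of the smaller one and a point of a
    coordinate axis; on a segment of the axis, the two end points bound [K]. *)
Lemma convex_bounded_above (r : R) : exists M, forall z, `|z| <= r -> K z <= M.
Proof.
suff H (j : nat) : (j <= d)%N -> forall r, exists M, forall z, supported j z -> `|z| <= r -> K z <= M.
  by have [M HM] := H d (leqnn _) r; exists M => z; apply: HM; exact: supported_all.
elim: j => [|j IH] jd {}r.
  by exists (K 0) => z /supported0 ->.
have [M HM] := IH (ltnW jd) (2 * r).
pose i1 : 'I_d := Ordinal jd; pose e : V := delta_mx ord0 i1.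
pose r' := 2 * `|r| + 1; have r'0 : 0 < r' by rewrite ltr_wpDl// mulr_ge0.
exists (`|M| + (`|K (0 + r' *: e)| + `|K (0 - r' *: e)|)) => z sz zr.
have [y sy [zE [yi yz]]] := @supported_split j i1 z erefl sz.
have hf : 0 <= (2^-1 : R) <= 1 by rewrite invr_ge0 ler0n invf_le1//; lra.
have -> : z = 2^-1 *: (2 *: y) + (1 - 2^-1) *: (0 + (2 * z ord0 i1) *: e).
  by rewrite [LHS]zE; apply/rowP => i; rewrite !mxE; field.
apply: le_trans (Kcvx _ _ hf) _.
have h1 : K (2 *: y) <= M.
  apply: HM => [i ji|]; first by rewrite mxE sy// mulr0.
  by rewrite normrZ ger0_norm// ler_pM2l//; apply: le_trans zr.
have h2 : K (0 + (2 * z ord0 i1) *: e) <= `|K (0 + r' *: e)| + `|K (0 - r' *: e)|.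
  apply: convex_segment => //; rewrite normrM ger0_norm// /r'.
  have := rV_coord_le z i1; have := ler_norm r; lra.
have := ler_norm M; have := normr_ge0 M; have := normr_ge0 (K (0 + r' *: e)).
have := normr_ge0 (K (0 - r' *: e)); move: h1 h2; lra.
Qed.

(** Let w be the unit vector along h. Since x + h lies between x and x + w, a bound above gives the
    upper estimate. Since x lies between x + h and x - w, the same bound gives the lower one. *)
Lemma convex_lipschitz_at x : exists2 C, 0 <= C & forall h, `|h| <= 1 -> `|K (x + h) - K x| <= C * `|h|.
Proof.
have [M HM] := convex_bounded_above (`|x| + 1).
have Kx : K x <= M by apply: HM; lra.
exists (M - K x); first lra.
move=> h h1; have [->|hn] := eqVneq h 0; first by rewrite addr0 subrr !normr0 mulr0.
have h0 : 0 < `|h| by rewrite normr_gt0.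
pose w := `|h|^-1 *: h.
have w1 : `|w| = 1 by rewrite normrZ ger0_norm ?invr_ge0// mulVf// gt_eqF.
have hw : h = `|h| *: w by rewrite scalerA mulfV ?gt_eqF// scale1r.
have Kp : K (x + w) <= M by apply: HM; apply: le_trans (ler_normD _ _) _; rewrite w1.
have Km : K (x - w) <= M by apply: HM; apply: le_trans (ler_normB _ _) _; rewrite w1.
have l1 : 0 <= `|h| <= 1 by rewrite normr_ge0.
have E1 : x + h = `|h| *: (x + w) + (1 - `|h|) *: x.
  by rewrite scalerDr -hw scalerBl scale1r addrAC addrCA subrr addr0 addrC.
have := Kcvx (x + w) x l1; rewrite -E1 => U.
pose l := (1 + `|h|)^-1.
have L0 : 0 < 1 + `|h| by lra.
have l2 : 0 <= l <= 1 by rewrite /l invr_ge0 invf_le1//; lra.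
have E2 : x = l *: (x + h) + (1 - l) *: (x - w).
  rewrite [X in _ *: (x + X)]hw; apply/rowP => i; rewrite !mxE /l; field.
  by rewrite !gt_eqF.
have := Kcvx (x + h) (x - w) l2; rewrite -E2 => U2.
have U3 : (1 + `|h|) * K x <= K (x + h) + `|h| * K (x - w).
  rewrite (_ : _ + _ * K (x - w) = (1 + `|h|) * (l * K (x + h) + (1 - l) * K (x - w))).
    by rewrite ler_pM2l.
  by rewrite /l; field; rewrite gt_eqF.
have U4 : `|h| * K (x - w) <= `|h| * M by rewrite ler_wpM2l.
have U5 : `|h| * K (x + w) <= `|h| * M by rewrite ler_wpM2l.
rewrite ler_norml; apply/andP; split; lra.
Qed.

Lemma convex_continuous : continuous K.
Proof.
move=> x; have [C C0 HC] := convex_lipschitz_at x.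
apply/(@cvgrPdist_lt R R^o _ (nbhs x)) => e e0; near=> z.
have hz : `|z - x| < 1 /\ (C + 1) * `|z - x| < e.
  have zx : `|x - z| < Num.min 1 (e / (C + 1)).
    near: z; apply: (@cvgr_dist_lt R V _ (nbhs x) _ id x); first exact: cvg_id.
    by rewrite lt_min ltr01 divr_gt0// ltr_wpDl.
  move: zx; rewrite lt_min distrC => /andP[-> h]; split => //.
  by rewrite mulrC -ltr_pdivlMr// ltr_wpDl.
rewrite distrC; have -> : K z = K (x + (z - x)) by rewrite addrC subrK.
have := HC (z - x) (ltW hz.1).
have : 0 <= `|z - x| by [].
move: hz.2; rewrite mulrDl mul1r; lra.
Unshelve. all: by end_near. Qed.

Hypothesis K0 : K 0 = 0.

(** The Hahn-Banach argument, one coordinate at a time. Convexity puts every left difference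
    quotient (the set [L]) below every right one, and the new slope is the supremum of the left
    ones. *)
Lemma convex_subgradient0 : exists p, forall z, dot p z <= K z.
Proof.
suff H (j : nat) : (j <= d)%N -> exists p, forall z, supported j z -> dot p z <= K z.
  by have [p Hp] := H d (leqnn _); exists p => z; apply: Hp; exact: supported_all.
elim: j => [|j IH] jd.
  by exists 0 => z /supported0 ->; rewrite K0 /dot big1// => i _; rewrite mxE mul0r.
have [p Hp] := IH (ltnW jd).
pose i1 : 'I_d := Ordinal jd; pose e : V := delta_mx ord0 i1.
pose L := [set a | exists y s, [/\ supported j y, 0 < s & a = (dot p y - K (y - s *: e)) / s]].
have LU a y' s' : L a -> supported j y' -> 0 < s' -> a <= (K (y' + s' *: e) - dot p y') / s'.
  move=> [y [s [sy s0 ->]]] sy' s'0.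
  have ss : 0 < s + s' by rewrite addr_gt0.
  rewrite ler_pdivrMr// mulrAC ler_pdivlMr//.
  pose l := s' / (s + s').
  have l1 : 0 <= l <= 1 by rewrite /l divr_ge0 ?ler_pdivrMr ?mul1r ?ltW//; lra.
  have U := Kcvx (y - s *: e) (y' + s' *: e) l1.
  have E : l *: (y - s *: e) + (1 - l) *: (y' + s' *: e) = l *: y + (1 - l) *: y'.
    by apply/rowP => i; rewrite !mxE /l; field; rewrite gt_eqF.
  have W : dot p (l *: y + (1 - l) *: y') <= K (l *: y + (1 - l) *: y').
    by apply: Hp => i ji; rewrite !mxE sy// sy'// !mulr0 addr0.
  have hl1 : (s + s') * l = s' by rewrite /l; field; rewrite gt_eqF.
  have hl2 : (s + s') * (1 - l) = s by rewrite /l; field; rewrite gt_eqF.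
  move: (l) U E W hl1 hl2 => {l l1} l U E W hl1 hl2.
  rewrite E in U; have := le_trans W U; rewrite dotD !dotZ.
  rewrite -(ler_pM2l ss) !mulrDr !mulrA.
  rewrite hl1 hl2 !mulrBl; lra.
have supp0 : supported j 0 by move=> i _; rewrite mxE.
have L0 : L !=set0 by exists ((dot p 0 - K (0 - 1 *: e)) / 1), 0, 1; split.
have ubL : ubound L ((K (0 + 1 *: e) - dot p 0) / 1) by move=> a La; exact: LU.
pose a := sup L.
exists (\row_i (if i == i1 then a else p ord0 i)) => z sz.
have [y sy [zE [yi _]]] := @supported_split j i1 z erefl sz.
set s := z ord0 i1 in zE.
have -> : dot (\row_i (if i == i1 then a else p ord0 i)) z = dot p y + a * s.
  rewrite /dot (bigD1 i1)//= [X in _ = X + _](bigD1 i1)//= yi mulr0 add0r mxE eqxx addrC; congr (_ + _).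
  apply: eq_bigr => i ne; rewrite mxE (negbTE ne) [in LHS]zE !mxE eqxx /= (negbTE ne) mulr0 addr0//.
have hs : has_sup L by split => //; exists ((K (0 + 1 *: e) - dot p 0) / 1).
rewrite [in leRHS]zE -/e; have [s0|s0|s0] := ltgtP s 0.
- have : L ((dot p y - K (y - (- s) *: e)) / (- s)) by exists y, (- s); split => //; rewrite oppr_gt0.
  move=> /(ub_le_sup hs.2); rewrite -/a scaleNr opprK ler_pdivrMr ?oppr_gt0//; lra.
- have : a <= (K (y + s *: e) - dot p y) / s.
    by apply: ge_sup => // b Lb; exact: LU.
  rewrite ler_pdivlMr//; lra.
- by rewrite s0 mulr0 scale0r !addr0; exact: Hp.
Qed.

Lemma convex_sub_dot p : convex_fun (fun z => K z - dot p z).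
Proof. by move=> y z l l01; have := Kcvx y z l01; rewrite dotD !dotZ; lra. Qed.

Lemma superlinear_sub_dot p : superlinear K -> (forall z, dot p z <= K z) ->
  forall M, exists c, forall z, M * `|z| <= (K z - dot p z) + c.
Proof.
move=> Ks Kp M; have [r Hr] := Ks (`|M| + d%:R * `|p|).
exists (`|M| * `|r|) => z; have [zr|zr] := leP (enorm z) `|r|.
  have h : M * `|z| <= `|M| * `|r|.
    by apply: le_trans (ler_norm _) _; rewrite normrM normr_id ler_wpM2l// (le_trans (norm_le_enorm z)).
  by have := Kp z; lra.
have z0 : 0 < enorm z by apply: le_lt_trans zr.
have := Hr z (le_lt_trans (ler_norm _) zr); rewrite ltr_pdivlMr// => hK.
have h1 := dot_le p z; have h2 := ler_norm (dot p z).
have h3 : (d%:R * `|p|) * `|z| <= (d%:R * `|p|) * enorm z.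
  by rewrite ler_wpM2l ?mulr_ge0// norm_le_enorm.
have h4 : M * `|z| <= `|M| * enorm z.
  by apply: le_trans (ler_norm _) _; rewrite normrM normr_id ler_wpM2l// norm_le_enorm.
have h5 : 0 <= `|M| * `|r| by rewrite mulr_ge0.
by rewrite mulrDl in hK; lra.
Qed.

Section PowerLowerBound.
Variable nu : R.
Hypotheses (nu1 : 1 < nu) (Knu : forall z, enorm z < 1 / 2 -> enorm z `^ nu <= K z).

Let powS (u : R) : 0 < u -> u `^ nu = u `^ (nu - 1) * u.
Proof.
move=> u0; rewrite -[X in _ * X](powRr1 (ltW u0)) -powRD ?subrK//.
by rewrite (gt_eqF u0) implybT.
Qed.

(* Beyond radius 1/2 the bound follows by convexity along the segment to the origin. *)
Lemma power_lower_bound (e : R) z : 0 < e -> e <= 1 / 4 ->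
  e `^ (nu - 1) * enorm z <= K z + e `^ (nu - 1) * e /\ 0 <= K z.
Proof.
move=> e0 e4; have ep : 0 < e `^ (nu - 1) by rewrite powR_gt0.
have nn : 0 <= nu - 1 by move: nu1; lra.
have [zs|zl] := ltP (enorm z) (1 / 2).
  have Kz := Knu zs; split; last by apply: le_trans Kz; exact: powR_ge0.
  have [ze|ze] := leP (enorm z) e.
    have : e `^ (nu - 1) * enorm z <= e `^ (nu - 1) * e by rewrite ler_wpM2l// ltW.
    have := powR_ge0 (enorm z) nu; lra.
  have z0 : 0 < enorm z by lra.
  have : e `^ (nu - 1) * enorm z <= enorm z `^ (nu - 1) * enorm z.
    by rewrite ler_wpM2r ?(ltW z0)// ge0_ler_powR// ?nnegrE// ?ltW.
  rewrite -powS//; have : 0 < e `^ (nu - 1) * e by rewrite mulr_gt0.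
  lra.
have z0 : 0 < enorm z by lra.
(* The point [s *: z] has norm 1/4, inside the region where the power bound holds. *)
pose s := (4 * enorm z)^-1.
have s0 : 0 < s by rewrite invr_gt0 mulr_gt0.
have s1 : s <= 1 by rewrite invf_le1 ?mulr_gt0//; lra.
have sz : enorm (s *: z) = 4^-1.
  by rewrite enormZ gtr0_norm// /s; field; rewrite gt_eqF.
have h1 : 4^-1 `^ nu <= K (s *: z) by rewrite -sz Knu// sz; lra.
have l01 : 0 <= s <= 1 by rewrite ltW.
have := Kcvx z 0 l01; rewrite K0 scaler0 addr0 mulr0 addr0 => h2.
have h3 : 4^-1 `^ (nu - 1) * 4^-1 <= s * K z by rewrite -powS ?invr_gt0//; exact: le_trans h2.
have h4 : 4^-1 `^ (nu - 1) * enorm z <= K z.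
  rewrite -(ler_pM2l s0); apply: le_trans h3; rewrite le_eqVlt; apply/orP; left; apply/eqP.
  by rewrite /s; field; rewrite gt_eqF.
have h5 : e `^ (nu - 1) * enorm z <= 4^-1 `^ (nu - 1) * enorm z.
  have e4' : e <= 4^-1 by move: e4; rewrite mul1r.
  have e00 : 0 <= e by lra.
  by rewrite ler_wpM2r ?(ltW z0)// ge0_ler_powR// nnegrE.
have h6 : 0 < e `^ (nu - 1) * e by rewrite mulr_gt0.
have h7 : 0 < 4^-1 `^ (nu - 1) * enorm z by rewrite mulr_gt0// powR_gt0// invr_gt0.
split; lra.
Qed.

End PowerLowerBound.

End Convex.

(** * From random fields to finite configurations *)

Section Action.
Context {R : realType} {d : nat}.
Local Notation V := 'rV[R]_d.
Local Notation mu := (@lebesgue_measure R).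
Implicit Types (gam : R -> V) (K : V -> R) (G : 'rV[int]_d -> R).

(** At the two end points the derivative depends on the arbitrary continuation of [gam] beyond the
    interval. They are added to the null set of exceptional times. *)
Lemma action_cost {T : Type} K (om : 'rV[int]_d -> T -> R) (w : T) t gam : 0 < t -> lip_path t gam ->
  continuous K -> bounded_cells (fun k => om k w) ->
  action K om t gam w = (cost K (fun k => om k w) gam 0 t)%:E.
Proof.
move=> t0 gl Kc Gb; have [v [N [[mN N0 vK] _]]] := cost_repr (ltW t0) gl.
have [mphi [M phiM] phiE] := vK K _ Kc Gb.
set phi := (fun s => _) in mphi phiM phiE.
have ii b1 b2 : mu.-integrable [set` Interval (BSide b1 0) (BSide b2 t)] (EFin \o phi).
  exact: integrable_itv_bounded phiM.
have m01 : measurable ([set 0; t] : set R).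
  by apply: measurableU; exact: measurable_set1.
have z01 : mu [set 0; t] = 0%E by apply: countable_lebesgue_measure0; apply: finite_set_countable; exact: finite_set2.
have mN' : measurable (N `|` [set 0; t]) by exact: measurableU.
have N0' : mu (N `|` [set 0; t]) = 0%E by rewrite measureU0.
have E1 : (action K om t gam w = \int[mu]_(s in `]0%R, t[) (phi s)%:E)%E.
  rewrite -(@integral_itv_bndoo _ 0 t (fun s => (phi s)%:E) true false); last first.
    by apply/measurable_EFinP; exact: measurable_funS mphi.
  apply: (lebesgue_null_eq mN' N0') => s /=; rewrite in_itv/= => /andP[s0 st] Ns; congr (_%:E).
  rewrite -[RHS](phiE s) => [||Nss]; [by []| |by apply: Ns; left].
  by rewrite !lt_neqAle s0 st !andbT; apply/andP; split; apply/eqP => e; apply: Ns; right; [left|right].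
rewrite E1 /cost /Rintegral -(@fineK _ (\int[mu]_(s in `]0%R, t[) (phi s)%:E)%E); last first.
  by apply: integrable_fin_num => //; exact: (ii false true).
congr (fine _)%:E; apply: (lebesgue_null_eq mN N0) => s /=; rewrite in_itv/= => hs Ns.
by rewrite phiE.
Qed.

Lemma dot_continuous p : continuous (dot p : V -> R).
Proof.
by apply: convex_continuous => y z l _; rewrite dotD !dotZ.
Qed.

Lemma continuous_add (f h : V -> R) : continuous f -> continuous h -> continuous (fun z => f z + h z).
Proof. by move=> fc hc z; apply: continuousD; [exact: fc|exact: hc]. Qed.

Lemma cost_dot p (e : R) T gam : lip_path T gam -> 0 <= T ->
  cost (dot p) (fun=> e) gam 0 T = dot p (gam T - gam 0) + e * T.
Proof.
move=> gl T0; have be (e' : R) : bounded_cells (d := d) (fun=> e') by exists `|e'|.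
suff H (l : seq 'I_d) : continuous (fun z : V => \sum_(i <- l) p ord0 i * z ord0 i) /\
    cost (fun z => \sum_(i <- l) p ord0 i * z ord0 i) (fun=> e) gam 0 T =
    \sum_(i <- l) p ord0 i * (gam T - gam 0) ord0 i + e * T.
  by have [_] := H (index_enum 'I_d).
elim: l => [|i l [IHc IH]].
  rewrite (_ : (fun z : V => _) = (fun=> 0)); last by apply/funext => z; rewrite big_nil.
  split; first exact: cst_continuous.
  by rewrite big_nil add0r (cost_cst (a := e)) ?subr0// => s _; rewrite /lagr add0r.
rewrite (_ : (fun z : V => _) = (fun z : V => p ord0 i * z ord0 i + \sum_(j <- l) p ord0 j * z ord0 j)); last first.
  by apply/funext => z; rewrite big_cons.
have cc := @continuous_coordM R d (p ord0 i) i.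
split; first exact: continuous_add.
rewrite (_ : (fun _ : 'rV[int]_d => e) = (fun _ : 'rV[int]_d => 0 + e)); last by apply/funext => ?; rewrite add0r.
rewrite (costD (T := T))// (cost_coord _ _ _ gl)// IH big_cons mul0r addr0 addrA.
by rewrite !mxE.
Qed.

Lemma action_tilt {T : Type} K (om : 'rV[int]_d -> T -> R) (w : T) t gam p (a : R) : 0 < t -> lip_path t gam ->
  continuous K -> continuous (fun z => K z - dot p z) -> bounded_cells (fun k => om k w) ->
  action K om t gam w =
  (cost (fun z => K z - dot p z) (fun k => om k w - a) gam 0 t + (dot p (gam t - gam 0) + a * t))%:E.
Proof.
move=> t0 gl Kc Ktc Gb; rewrite action_cost//; congr (_%:E).
have ba : bounded_cells (d := d) (fun=> a) by exists `|a|.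
have Gb' : bounded_cells (fun k => om k w - a).
  have [M HM] := Gb; exists (M + `|a|) => k.
  by apply: le_trans (ler_normB _ _) _; rewrite lerD2r.
have dc := @dot_continuous p.
rewrite -(cost_dot _ _ gl (ltW t0)) -(costD (T := t))//; last exact: ltW.
by congr (cost _ _ _ _ _); apply/funext => z; rewrite subrK.
Qed.

Lemma admissible_lip t x gam : admissible t x gam <-> gam 0 = x /\ lip_path t gam.
Proof.
split=> [[g0 [L HL]]|[g0 [L HL]]]; split => //.
  by exists L => s1 s2 h1 h2; apply: le_trans (norm_le_enorm _) (HL _ _ h1 h2).
exists (d%:R * L) => s1 s2 h1 h2; apply: le_trans (enorm_le_norm _) _.
by rewrite -mulrA ler_wpM2l// HL.
Qed.

(** Tilting [K] and shifting the potential change the action by [dot p (gam t - x) + a * t], which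
    depends only on the end point of the path and can be moved into [g]. *)
Lemma value_valueG {T : Type} K (om : 'rV[int]_d -> T -> R) (w : T) g t x p (a : R) : 0 < t ->
  continuous K -> continuous (fun z => K z - dot p z) -> bounded_cells (fun k => om k w) ->
  value K om g t x w =
  valueG (fun z => K z - dot p z) (fun k => om k w - a)
    (fun y => (g y - (dot p (y - x) + a * t)%:E)%E) t x.
Proof.
move=> t0 Kc Ktc Gb; rewrite /value /valueG; congr ereal_sup; apply/seteqP; split => _ [gam hg <-] /=.
- have [g0 gl] := (admissible_lip _ _ _).1 hg.
  exists gam => //; rewrite (action_tilt (p := p) a)// g0 EFinD addeC fin_num_oppeD// addeA addeAC.
  by rewrite addeC addeA.
- have [g0 gl] := hg; exists gam; first exact/admissible_lip.
  by rewrite (action_tilt (p := p) a)// g0 EFinD fin_num_oppeD// addeA addeAC.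
Qed.

End Action.

Section Locality.
Context {R : realType} {d : nat}.
Local Notation V := 'rV[R]_d.
Variables (K : V -> R) (dl : R).
Hypotheses (Kc : continuous K) (K0 : forall z, 0 <= K z) (Kz : K 0 = 0) (dl0 : 0 <= dl).
Hypothesis (Ksup : forall M, exists c, forall z, M * `|z| <= K z + c).
Variables (B A : R).
Hypotheses (B0 : 0 <= B) (A0 : 0 <= A).
Hypothesis HA : forall G g x H t e gam H', env dl G -> growth g x H B -> 1 <= t -> e <= 1 ->
  near_opt K G g t x e gam H' -> forall s, 0 <= s <= t -> `|gam s - x| <= A * t.

(** Near-optimal paths stay within [A * t] of [x], so both environments charge them the same
    cost. *)
Lemma valueG_le_local G G' g x H t : env dl G -> env dl G' -> growth g x H B -> 1 <= t ->
  (forall y, `|y - x| <= A * t -> G (cell y) = G' (cell y)) ->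
  fine (valueG K G g t x) <= fine (valueG K G' g t x).
Proof.
move=> eG eG' gr t1 GG; apply/ler_addgt0Pr => e e0; have t0 : 0 <= t by lra.
have e'0 : 0 < Num.min 1 e by rewrite lt_min ltr01.
have [gam [H' no]] := near_opt_ex Kc K0 Kz Ksup B0 eG gr t1 e'0.
have e1 : Num.min 1 e <= 1 by rewrite ge_min lexx.
have ee : Num.min 1 e <= e by rewrite ge_min lexx orbT.
have gx := HA eG gr t1 e1 no; have [g0 gl gt nopt] := no.
have E : cost K G gam 0 t = cost K G' gam 0 t.
  by apply: eq_cost_cells => s /andP[s0 st]; apply: GG; apply: gx; rewrite !ltW.
have re := reach_sub Kc K0 eG' gl (lexx _) t0 (lexx _); rewrite subr0 g0 -E in re.
have := value_ge_fin Kc K0 Kz Ksup B0 eG' gr t1 re gt; lra.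
Qed.

Lemma valueG_local G G' g x H t : env dl G -> env dl G' -> growth g x H B -> 1 <= t ->
  (forall y, `|y - x| <= A * t -> G (cell y) = G' (cell y)) ->
  fine (valueG K G g t x) = fine (valueG K G' g t x).
Proof.
move=> eG eG' gr t1 GG; apply/eqP; rewrite eq_le.
by rewrite !(valueG_le_local _ _ gr t1)// => y /GG ->.
Qed.

End Locality.

Lemma int_box_offset (a b : int) (h N : nat) : `|a - b| <= h%:Z -> (2 * h < N)%N ->
  exists2 n : nat, a - (b - h%:Z) = n%:Z & (n < N)%N.
Proof. move=> ab hN; exists (absz (a - (b - h%:Z))%R); lia. Qed.

Section Unwrapping.
Context {d : nat} (N h : nat) (k0 : 'rV[int]_d).
Hypotheses (N1 : (1 < N)%N) (hN : (2 * h < N)%N).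
Local Notation lab := 'rV['Z_N]_d.

(* [unwrap] inverts [wrap N] on the box of radius [h] around [k0]. *)
Definition corner : 'rV[int]_d := k0 - const_mx h%:Z.
Definition unwrap (i : lab) : 'rV[int]_d :=
  corner + map_mx (fun z : 'Z_N => (z : nat)%:Z) (i - wrap N corner).

Lemma unwrapK : cancel unwrap (wrap N).
Proof.
move=> i; rewrite /unwrap wrapD addrC -[RHS](subrK (wrap N corner)); congr (_ + _).
by apply/rowP => j; rewrite !mxE -pmulrn natr_Zp.
Qed.

Lemma wrapK (k : 'rV[int]_d) : (forall i, `|k ord0 i - k0 ord0 i| <= h%:Z) -> unwrap (wrap N k) = k.
Proof.
move=> H; rewrite /unwrap -wrapB; apply/rowP => j; rewrite !mxE.
have [n nE nN] := int_box_offset (H j) hN.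
rewrite nE -[(n%:Z)%:~R]/(n%:R) val_Zp_nat// modn_small//; by rewrite -nE addrC subrK.
Qed.

End Unwrapping.

(** * The law of a finite configuration *)

Section Probability.
Context {R : realType} {dT : measure_display} {T : measurableType dT} (P : probability T R).

Lemma integral_finite_range (I : finType) (cw : T -> I) (pr : I -> R) (h : I -> R) :
  (forall i, measurable (cw @^-1` [set i])) -> (forall i, P (cw @^-1` [set i]) = (pr i)%:E) ->
  (\int[P]_w (h (cw w))%:E = (\sum_i pr i * h i)%:E)%E.
Proof.
move=> mc Pc.
transitivity (\int[P]_(w in setT) (\sum_(i <- index_enum I) ((h i)%:E * (\1_(cw @^-1` [set i]) w)%:E)))%E.
  apply: eq_integral => w _; rewrite (bigD1 (cw w))//= big1 ?adde0.
    by rewrite indicE mem_set// mule1.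
  by move=> i ne; rewrite indicE memNset ?mule0// => /= e; rewrite e eqxx in ne.
rewrite integral_sum//; last first.
  by move=> i; apply: integrableZl => //; exact: integrable_indic.
rewrite -sumEFin; apply: eq_bigr => i _.
rewrite integralZl//; last exact: integrable_indic.
by rewrite integral_indic// setIT mulrC EFinM; congr (_ * _)%E; exact: Pc.
Qed.

Lemma variance_finite_range (I : finType) (al : R) (cw : T -> {ffun I -> bool}) (F : {ffun I -> bool} -> R) :
  (forall c, measurable (cw @^-1` [set c])) -> (forall c, P (cw @^-1` [set c]) = (weight al c)%:E) ->
  ('V_P[fun w => F (cw w)] = (variance_fin al F)%:E)%E.
Proof.
move=> mc Pc.
have EX : ('E_P[fun w => F (cw w)] = (expect al F)%:E)%E.
  by rewrite unlock; exact: integral_finite_range.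
rewrite /variance unlock EX /= unlock.
exact: (integral_finite_range (fun c => (F c - expect al F) * (F c - expect al F)) mc Pc).
Qed.

Lemma indep_two_valued_law (I : finType) (J : choiceType) (s : I -> J) (X : J -> T -> R) (a b al : R)
    (c : {ffun I -> bool}) : injective s -> a != b ->
  (forall k, measurable_fun setT (X k)) -> (forall k w, X k w = a \/ X k w = b) ->
  (forall k, P (X k @^-1` [set a]) = al%:E) -> (forall k, P (X k @^-1` [set b]) = (1 - al)%:E) ->
  mutually_independent P X ->
  measurable ([set w | [ffun i => X (s i) w == a] = c]) /\
  P [set w | [ffun i => X (s i) w == a] = c] = (weight al c)%:E.
Proof.
move=> si ab mX Xab Pa Pb ind.
pose l := [seq s i | i <- enum I].
have ul : uniq l by rewrite map_inj_uniq// enum_uniq.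
(* The configuration is carried over to the sites along the injection [s]. The default [false] is
   harmless, since only sites of the list [l] enter the event. *)
pose ch k := if [pick i | s i == k] is Some i then c i else false.
have chE i : ch (s i) = c i.
  rewrite /ch; case: pickP => [j /eqP/si ->//|/(_ i)]; by rewrite eqxx.
pose Bs k : set R := if ch k then [set a] else [set b].
have mB k : measurable (Bs k) by rewrite /Bs; case: ifP => _; exact: measurable_set1.
have E : [set w | [ffun i => X (s i) w == a] = c] = \bigcap_(k in [set k | k \in l]) (X k @^-1` Bs k).
  apply/seteqP; split => w /=.
    move=> cE k /mapP[i _ ->]; rewrite /preimage /Bs /= chE -cE ffunE.
    by case: eqP => //= ne; case: (Xab (s i) w).
  move=> H; apply/ffunP => i; rewrite ffunE.
  have : (X (s i) @^-1` Bs (s i)) w by apply: H; apply/mapP; exists i; rewrite ?mem_enum.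
  rewrite /preimage /Bs /= chE; case: (c i) => /= ->; first by rewrite eqxx.
  by rewrite eq_sym (negbTE ab).
have mE k : measurable (X k @^-1` Bs k) by rewrite -[X k @^-1` _]setTI; exact: mX.
rewrite E; split; first by rewrite bigcap_seq; apply: bigsetI_measurable => k _.
rewrite ind// /l big_map big_enum /= /weight -prodEFin; apply: eq_bigr => i _.
by rewrite /Bs chE /wgt; case: (c i).
Qed.

End Probability.

Theorem theorem1p1 (R : realType) (d : nat) (K : 'rV[R]_d -> R) (nu : R)
  (alpha C1 delta : R) :
  (2 <= d)%N ->
  convex_fun K -> K 0 = 0 -> superlinear K ->
  (d = 2%N -> 1 < nu /\
     forall z : 'rV[R]_d, enorm z < 1 / 2 -> enorm z `^ nu <= K z) ->
  0 < alpha < 1 -> 0 < delta ->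
  exists C : R, 0 < C /\
  forall (a b : R) (x : 'rV[R]_d) (g : 'rV[R]_d -> \bar R)
    (dT : measure_display) (T : measurableType dT) (P : probability T R)
    (om : 'rV[int]_d -> T -> R),
    a < b -> b - a = delta ->
    (forall k, measurable_fun setT (om k)) ->
    (forall k w, om k w = a \/ om k w = b) ->
    (forall k, P (om k @^-1` [set a]) = alpha%:E) ->
    (forall k, P (om k @^-1` [set b]) = (1 - alpha)%:E) ->
    mutually_independent P om ->
    usc g -> g x \is a fin_num ->
    (forall y, (g y < g x + (C1 * (1 + enorm (y - x)))%:E)%E) ->
    forall t : R, 2 <= t ->
      (forall w, value K om g t x w \is a fin_num) /\
      ('V_P[fun w => fine (value K om g t x w)] <= (C * (t / ln t))%:E)%E.
Proof.
move=> d2 Kcvx K0 Ksl Hd /andP[al0 al1] dl0.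
(* In dimension 2 the power bound already makes [K] nonnegative. There [p = 0] is taken, so that the
   bound applies to the tilted cost as it stands. *)
have [p [Kp pz]] : exists p : 'rV[R]_d, (forall z, dot p z <= K z) /\
    ((2 < d)%N \/ (p = 0 /\ d = 2%N)).
  have [dd|dd] := eqVneq d 2%N; last first.
    have [p Kp] := convex_subgradient0 Kcvx K0; exists p; split => //; left.
    by rewrite ltn_neqAle eq_sym dd.
  exists 0; split; last by right.
  move=> z; have [nu1 Knu] := Hd dd.
  rewrite /dot big1 => [|i _]; last by rewrite mxE mul0r.
  by have [] := @power_lower_bound _ _ _ Kcvx K0 _ nu1 Knu (1 / 4) z ltac:(lra) (lexx _).
pose Kt z := K z - dot p z.
have Ktcvx := convex_sub_dot Kcvx p.
have Kc : continuous K by exact: convex_continuous.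
have Ktc : continuous Kt by exact: convex_continuous.
have Kt0 z : 0 <= Kt z by rewrite /Kt subr_ge0.
have Ktz : Kt 0 = 0 by rewrite /Kt K0 /dot big1 ?subrr// => i _; rewrite mxE mulr0.
have Ktsup M : exists c, forall z, M * `|z| <= Kt z + c by exact: superlinear_sub_dot.
(* The first term converts the growth of [g] from the Euclidean norm to the sup norm; the second
   absorbs the tilt. [B] involves neither [g] nor [x]. *)
pose B := `|C1| * (1 + d%:R) + d%:R * `|p|.
have B0 : 0 <= B by rewrite addr_ge0 ?mulr_ge0.
have Hd' : (2 < d)%N \/ (exists2 nu, 1 < nu & forall e, 0 < e -> e <= 1 / 4 ->
    forall z, e `^ (nu - 1) * `|z| <= Kt z + e `^ (nu - 1) * e).
  case: pz => [|[p0 dd]]; [by left|right].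
  have [nu1 Knu] := Hd dd; exists nu => // e e0 e4 z.
  have [h _] := power_lower_bound Kcvx K0 nu1 Knu z e0 e4.
  have -> : Kt z = K z by rewrite /Kt p0 /dot big1 ?subr0// => i _; rewrite mxE mul0r.
  by apply: le_trans h; rewrite ler_wpM2l ?powR_ge0// norm_le_enorm.
have [C C0 HC] := cell_variance_sublinear Ktc Kt0 Ktz (ltW dl0) Ktsup al0 al1 B0 d2 Hd'.
exists C; split => // a b x g dT T P om ab bad mom omab Pa Pb ind _ gx gC t t2.
have t1 : 1 <= t by lra.
have t0 : 0 < t by lra.
have [A A0 HA0] := near_opt_bounds Ktc Kt0 Ktz (ltW dl0) Ktsup B0.
have HA G g' x' H t' e gam H' : env delta G -> growth g' x' H B -> 1 <= t' -> e <= 1 ->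
    near_opt Kt G g' t' x' e gam H' -> forall s, 0 <= s <= t' -> `|gam s - x'| <= A * t'.
  by move=> eG gr t'1 e1 no; have [_] := HA0 _ _ _ _ _ _ _ _ eG gr t'1 e1 no.
pose g' y := (g y - (dot p (y - x) + a * t)%:E)%E.
pose H := fine (g x) - a * t.
have gr : growth g' x H B.
  split; first by rewrite /g' subrr /H -[in LHS](fineK gx) -EFinB /dot big1 ?add0r// => i _; rewrite mxE mulr0.
  move=> y; rewrite /g'; have := ltW (gC y); rewrite -{1}(fineK gx) -EFinD => hy.
  apply: (le_trans (leeB hy (lexx _))); rewrite -EFinB lee_fin /H.
  have h1 : C1 * (1 + enorm (y - x)) <= `|C1| * ((1 + d%:R) * (1 + `|y - x|)).
    apply: (@le_trans _ _ (`|C1| * (1 + enorm (y - x)))).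
      by rewrite ler_wpM2r ?ler_norm// addr_ge0// enorm_ge0.
    rewrite ler_wpM2l//; have := enorm_le_norm (y - x).
    by rewrite mulrDl mul1r mulrDr mulr1; have := normr_ge0 (y - x); have := ler0n R d; lra.
  have h2 := dot_le p (y - x); rewrite ler_norml in h2; move/andP: h2 => [h2 _].
  have h3 : d%:R * `|p| * `|y - x| <= d%:R * `|p| * (1 + `|y - x|).
    by rewrite ler_wpM2l ?mulr_ge0// lerDr.
  by move: h1 h2 h3; rewrite /B mulrA [X in _ <= _ + X]mulrDl; lra.
pose G w k := om k w - a.
have eG w : env delta (G w).
  by move=> k; rewrite /G; case: (omab k w) => ->; lra.
have bG w : bounded_cells (fun k => om k w).
  by exists (`|a| + `|b|) => k; case: (omab k w) => ->; rewrite ?lerDl ?lerDr.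
have vE w : value K om g t x w = valueG Kt (G w) g' t x.
  by rewrite (value_valueG (p := p) g x a t0 Kc Ktc (bG w)).
have vf w : value K om g t x w \is a fin_num.
  by rewrite vE; exact: (value_fin Ktc Kt0 Ktz Ktsup B0 (eG w) gr t1).
split => //.
have [N0 hN0] := HC t t2.
(* The cells of points within [A * t] of [x] have coordinates within [A * t + 1] of those of the
   cell of [x]. *)
pose h := (Num.truncn (A * t + 1)).+1.
have hh : A * t + 1 < h%:R.
  have a0 : 0 <= A * t + 1 by rewrite addr_ge0// mulr_ge0// ltW.
  by have /andP[] := truncn_itv a0.
pose N := (N0 + 2 * h + 2)%N.
have N1 : (1 < N)%N by rewrite /N addn2.
have hN : (2 * h < N)%N by rewrite /N addn2 ltnS ltnW// ltnS leq_addl.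
have NN0 : (N0 <= N)%N by rewrite /N -addnA leq_addr.
(* Each label is represented by one site. For the cells that near-optimal paths can meet, that site
   is the cell itself, so the periodic environment built from [cw] agrees there with the random
   one. *)
pose sg := @unwrap d N h (cell x).
pose cw w := [ffun i => om (sg i) w == a].
have ne : a != b by rewrite lt_eqF.
have law c := indep_two_valued_law c (can_inj (@unwrapK d N h (cell x))) ne mom omab Pa Pb ind.
have fE w : fine (value K om g t x w) = cvalue Kt delta g' x t (cw w).
  rewrite vE /cvalue; apply: (valueG_local Ktc Kt0 Ktz Ktsup B0 HA (eG w) _ gr t1).
    by apply: env_envc; exact: ltW.
  move=> y yx; rewrite /envc /cw ffunE /sg wrapK//.
    rewrite /G; case: (omab (cell y) w) => ->; first by rewrite eqxx subrr.
    by rewrite eq_sym (negbTE ne).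
  move=> i; have := cell_dist y x i; rewrite -intr_norm => hd.
  by rewrite -(ler_int R); apply: le_trans hd _; apply: le_trans (ltW hh); rewrite lerD2r.
rewrite (_ : (fun w => _) = (fun w => cvalue Kt delta g' x t (cw w))); last by apply/funext => w; exact: fE.
rewrite (variance_finite_range (al := alpha) _ (fun c => (law c).1) (fun c => (law c).2)) lee_fin.
exact: hN0 gr.
Qed.
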